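(* Let $H:\mathfrak H_1=\mathrm{dom}(H)\subseteq\mathcal F\to\mathcal F$ be self-adjoint and bounded-from-below in the Hilbert space $\mathcal F$, let $S$ be a symmetric $H$-small operator in $\mathcal F$, let $A:\mathfrak H_1\to\mathcal F$ belong to $\mathcal B(\mathfrak H_s,\mathcal F)$ for some $s\in(0,1)$, and suppose that $\mathrm{ran}(G_z)\cap\mathfrak H_1=\{0\}$ for all $z\in\varrho(H)$, where $G_z=(AR_{\bar z})^*$. Let $\lambda_\circ<\inf\sigma(H)$ be real, $R:=R_{\lambda_\circ}$, $G:=G_{\lambda_\circ}$, $\mathfrak D:=\{\psi\in\mathcal F:\psi-G\psi\in\mathfrak H_1\}$, $T_S:=(1-G^* )S(1-G)$ on $\mathfrak D$, and let $H_S:\mathfrak D\subseteq\mathcal F\to\mathcal F$ be the (bounded-from-below, self-adjoint) operator $H_S\psi=\overline H\psi+A^*\psi+A(\psi-G\psi)-T_S\psi$. Let $A_n:\mathrm{dom}(A_n)\subseteq\mathcal F\to\mathcal F$, $n\ge1$, be a sequence of closable operators such that $\mathrm{dom}(A_n)\supseteq\mathfrak H_{1/2}$, $A_n\in\mathcal B(\mathfrak H_{1/2},\mathcal F)$ and $A_n^*+A_n$ is $H$-small, and let $H_n:=H+A_n^*+A_n:\mathfrak H_1\subseteq\mathcal F\to\mathcal F$ (which is self-adjoint and bounded-from-below). Suppose that $$\lim_{n\to\infty}\|A_n-A\|_{\mathfrak H_1,\mathcal F}=0$$ and that there exists a sequence $\{E_n\}_{n\ge1}$ of bounded symmetric operators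 in $\mathcal F$ such that $$(E_n-A_nRA_n^* )\ \text{is uniformly}\ (H_n-A_nRA_n^* )\text{-small}$$ and $$\lim_{n\to\infty}\ \sup_{\{\psi\in\mathfrak D\,:\,\|T_S\psi\|^2+\|\psi\|^2\le1\}}\|(E_n-A_nRA_n^* )\psi-T_S\psi\|=0\,.$$ Then $$\lim_{n\to\infty}(H_n-E_n)=H_S\quad\text{in norm resolvent sense.}$$
   Context: $\mathcal B(X,Y)$ denotes bounded linear operators from $X$ to $Y$, with norm $\|\cdot\|_{X,Y}$; $\varrho$, $\sigma$ denote resolvent set and spectrum. A linear operator $S$ is $H$-small if $\mathrm{dom}(S)\supseteq\mathrm{dom}(H)$ and there are $a\in[0,1)$, $b\in\mathbb R$ with $\|S\psi\|\le a\|H\psi\|+b\|\psi\|$ for all $\psi\in\mathrm{dom}(H)$. A sequence $S_n$ is uniformly $K_n$-small if each $S_n$ is $K_n$-small with constants $a\in[0,1)$, $b\in\mathbb R$ independent of $n$. For $s\in[-1,1]$, $\mathfrak H_s$ is the completion of $\mathrm{dom}(H)$ with respect to the scalar product $\langle\psi_1,\psi_2\rangle_s=\langle(H^2+1)^{s/2}\psi_1,(H^2+1)^{s/2}\psi_2\rangle$; so $\mathfrak H_0=\mathcal F$, $\mathfrak H_1=\mathrm{dom}(H)$, and $\mathfrak H_{-s}$ is identified with the (anti-)dual of $\mathfrak H_s$ via the pairing extending the scalar product of $\mathcal F$. Adjoints are taken with respect to these dualities. ''$A\in\mathcal B(\mathfrak H_s,\mathcal F)$'' means that $A$ extends to a bounded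 operator $\mathfrak H_s\to\mathcal F$. $R_z:=(-H+z)^{-1}$ for $z\in\varrho(H)$, extended to a bounded map $\mathfrak H_{-1}\to\mathcal F$ (and $\mathfrak H_{-1/2}\to\mathfrak H_{1/2}$). $G_z:=(AR_{\bar z})^*\in\mathcal B(\mathcal F)$, equivalently $G_z=R_zA^*$ with $A^*:\mathcal F\to\mathfrak H_{-1}$. $\overline H:\mathcal F\to\mathfrak H_{-1}$ is the bounded closure (extension) of $H:\mathfrak H_1\subseteq\mathcal F\to\mathfrak H_{-1}$; the sum $\overline H\psi+A^*\psi$ is computed in $\mathfrak H_{-1}$ and lies in $\mathcal F$ for $\psi\in\mathfrak D$. In $A_n^*+A_n$, $A_n^*$ is the Hilbert space adjoint of $A_n$ in $\mathcal F$. The operator $A_nRA_n^*\in\mathcal B(\mathcal F)$ is defined through $A_n^*:\mathcal F\to\mathfrak H_{-1/2}$ (the dual of $A_n:\mathfrak H_{1/2}\to\mathcal F$), $R:\mathfrak H_{-1/2}\to\mathfrak H_{1/2}$ and $A_n:\mathfrak H_{1/2}\to\mathcal F$. Norm resolvent convergence means convergence of $(-(H_n-E_n)+z)^{-1}$ to $(-H_S+z)^{-1}$ in the norm of $\mathcal B(\mathcal F)$ for $z\in\mathbb C\setminus\mathbb R$. *)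

(* Defs.v *)
(* Unbounded operators in a complex Hilbert space, over MathComp-Analysis. *)
From HB Require Import structures.
From mathcomp Require Import all_boot all_order all_algebra.
From mathcomp Require Import all_classical all_reals all_analysis.
From mathcomp.real_closed Require Import complex.

Set Implicit Arguments.
Unset Strict Implicit.
Unset Printing Implicit Defensive.

Import Order.TTheory GRing.Theory Num.Theory.
Import numFieldNormedType.Exports.

Local Open Scope classical_set_scope.
Local Open Scope ring_scope.
Local Open Scope complex_scope.

(* The scalar product is linear in its first argument. *)
HB.mixin Record CompleteNormedModule_isHilbert (R : realType) F
    of CompleteNormedModule R[i] F := {
  dotp : {dot F for @Num.conj R[i]};
  dotp_norm : forall x : F, `|x| ^+ 2 = dotp x x
}.

#[short(type="hilbertType")]
HB.structure Definition Hilbert (R : realType) :=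
  {F of CompleteNormedModule_isHilbert R F & CompleteNormedModule R[i] F}.

Notation "''[' x , y ]" := (dotp x y)
  (at level 0, format "''[' x ,  y ]") : ring_scope.

(* The values of app outside dom carry no information. *)
Record operator (R : realType) (F : hilbertType R) := Operator {
  dom : set F;
  app :> F -> F }.

Section Operators.
Context {R : realType} {F : hilbertType R}.
Implicit Types (T S H : operator F) (z : R[i]) (psi phi u f : F).

(* The norm of F takes its values in R[i]; hnorm is the same norm in R. *)
Definition hnorm psi : R := complex.Re `|psi|.

Definition total (B : F -> F) : operator F := Operator setT B.

Definition addop T S : operator F :=
  Operator (dom T `&` dom S) (fun psi => T psi + S psi).

Definition subop T S : operator F :=
  Operator (dom T `&` dom S) (fun psi => T psi - S psi).

Definition compop T S : operator F :=
  Operator [set psi | dom S psi /\ dom T (S psi)] (fun psi => T (S psi)).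

Definition linear_op T :=
  dom T 0 /\ forall (a : R[i]) psi phi, dom T psi -> dom T phi ->
    dom T (a *: psi + phi) /\ T (a *: psi + phi) = a *: T psi + T phi.

Definition bounded_op T :=
  [/\ linear_op T, dom T = setT &
      exists C : R, forall psi, hnorm (T psi) <= C * hnorm psi].

Definition symmetric_op T :=
  linear_op T /\ forall psi phi, dom T psi -> dom T phi ->
    '[T psi, phi] = '[psi, T phi].

Definition closable T :=
  forall (u : nat -> F) (v : F), (forall k, dom T (u k)) ->
    u k @[k --> \oo] --> (0 : F) -> T (u k) @[k --> \oo] --> v -> v = 0.

(* The Hilbert space adjoint; for a densely defined T the value is unique. *)
Definition is_adj T psi u :=
  forall phi, dom T phi -> '[T phi, psi] = '[phi, u].

Definition adj T : operator F :=
  Operator [set psi | exists u, is_adj T psi u]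
           (fun psi => xget 0 [set u | is_adj T psi u]).

Definition self_adjoint T :=
  [/\ linear_op T, dense (dom T), dom (adj T) = dom T &
      forall psi, dom T psi -> adj T psi = T psi].

Definition bounded_below T :=
  exists m : R, forall psi, dom T psi ->
    (m * hnorm psi ^+ 2)%:C <= '[T psi, psi].

(* B = (- T + z)^-1 *)
Definition is_resolvent T z (B : F -> F) :=
  [/\ bounded_op (total B),
      forall f, dom T (B f) /\ - T (B f) + z *: B f = f &
      forall psi, dom T psi -> B (- T psi + z *: psi) = psi].

Definition resolvent_set T : set R[i] :=
  [set z | exists B, is_resolvent T z B].

Definition spectrum T : set R[i] := ~` resolvent_set T.

Definition resolvent T z : F -> F :=
  xget (fun=> 0) [set B | is_resolvent T z B].

(* The infimum of the spectrum of a self-adjoint operator, whose spectrum is a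
   subset of the real line *)
Definition inf_spectrum T : \bar R :=
  ereal_inf [set x%:E | x in [set x : R | spectrum T x%:C]].

(* S is T-small with constants a and b *)
Definition small_with (a b : R) S T :=
  dom T `<=` dom S /\ forall psi, dom T psi ->
    hnorm (S psi) <= a * hnorm (T psi) + b * hnorm psi.

Definition small S T := exists a b : R, 0 <= a < 1 /\ small_with a b S T.

Definition uniformly_small (S K : nat -> operator F) :=
  exists a b : R, 0 <= a < 1 /\ forall n, small_with a b (S n) (K n).

(* The norm of T : (D, N) -> F, where N is a norm on the subspace D *)
Definition opnorm (D : set F) (N : F -> R) (T : F -> F) : \bar R :=
  ereal_sup [set (hnorm (T psi))%:E | psi in [set psi | D psi /\ N psi <= 1]].

Definition norm_resolvent_cvg (T : nat -> operator F) (S : operator F) :=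
  forall z : R[i], complex.Im z != 0 ->
    [/\ resolvent_set S z, forall n, resolvent_set (T n) z &
        opnorm setT hnorm (resolvent (T n) z \- resolvent S z)
          @[n --> \oo] --> 0%E].

(** Functional calculus *)

Definition projection_valued_measure (E : set R -> F -> F) :=
  [/\ forall B : set R, measurable B ->
        symmetric_op (total (E B)) /\ forall psi, E B (E B psi) = E B psi,
      forall psi, E setT psi = psi &
      forall B : nat -> set R, (forall k, measurable (B k)) ->
        trivIset setT B -> forall psi,
        (\sum_(0 <= k < n) E (B k) psi) @[n --> \oo]
          --> E (\bigcup_k B k) psi].

(* <E(.) psi, psi> *)
Definition spectral_mu (E : set R -> F -> F) psi : set R -> \bar R :=
  fun B => (complex.Re '[E B psi, psi])%:E.

(* T is the integral of f with respect to E *)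
Definition spectral_integral (E : set R -> F -> F) (f : R -> R) T :=
  [/\ dom T = [set psi | \int[spectral_mu E psi]_x (f x ^+ 2)%:E < +oo]%E,
      forall psi, dom T psi ->
        (hnorm (T psi) ^+ 2)%:E = (\int[spectral_mu E psi]_x (f x ^+ 2)%:E)%E &
      forall psi, dom T psi ->
        '[T psi, psi] = (fine (\int[spectral_mu E psi]_x (f x)%:E)%E)%:C].

(* The spectral theorem gives exactly one such measure (on Borel sets) when H
   is self-adjoint. *)
Definition spectral_measure H : set R -> F -> F :=
  xget (fun _ _ => 0)
    [set E | projection_valued_measure E /\ spectral_integral E id H].

(** The scale of spaces associated with H *)

(* ||(H^2 + 1)^(s/2) psi||^2: the squared norm of f(H) psi is the integral of
   f^2 with respect to <E(.) psi, psi> (see spectral_integral). *)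
Definition Hs_sqnorm H (s : R) psi : \bar R :=
  (\int[spectral_mu (spectral_measure H) psi]_x ((x ^+ 2 + 1) `^ s)%:E)%E.

(* For 0 <= s <= 1 the completion of dom H is realized inside F, as the domain
   of (H^2 + 1)^(s/2); for s = 1 it is dom H. *)
Definition Hs H (s : R) : set F := [set psi | (Hs_sqnorm H s psi < +oo)%E].

Definition Hs_norm H (s : R) psi : R := Num.sqrt (fine (Hs_sqnorm H s psi)).

(* T extends to a bounded operator from Hs H s to F. *)
Definition bounded_on_Hs H (s : R) T :=
  exists T' : operator F,
    [/\ linear_op T', dom T' = Hs H s,
        forall psi, dom T psi -> Hs H s psi -> T' psi = T psi &
        exists C : R, forall psi, Hs H s psi ->
          hnorm (T' psi) <= C * Hs_norm H s psi].

(* The space of order -1 is the anti-dual of dom H with the norm of order 1: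
   its elements are represented by functions F -> R[i], of which only the
   values on dom H matter. The space of order -1/2 is contained in it, by
   restriction of functionals to dom H. *)
Definition Hm1_norm_le H (l : F -> R[i]) (c : R) :=
  forall phi, dom H phi -> `|l phi| <= (c * Hs_norm H 1 phi)%:C.

(* F as a subspace of the space of order -1 *)
Definition emb u : F -> R[i] := fun phi => '[u, phi].

(* The element of F which represents l *)
Definition unemb H (l : F -> R[i]) : F :=
  xget 0 [set u | forall phi, dom H phi -> emb u phi = l phi].

(* The adjoint T^* psi, as a functional *)
Definition dual_adj T psi : F -> R[i] := fun phi => '[psi, T phi].

(* The closure of H, as an operator from F to the space of order -1 *)
Definition Hbar H psi : F -> R[i] :=
  xget (fun=> 0) [set l | forall e : R, 0 < e -> exists phi,
    [/\ dom H phi, hnorm (phi - psi) <= e &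
        Hm1_norm_le H (fun chi => emb (H phi) chi - l chi) e]].

(* The continuous extension of (- H + z)^-1 to the space of order -1 *)
Definition resolvent_ext H z (l : F -> R[i]) : F :=
  xget 0 [set u | forall e : R, 0 < e -> exists f,
    Hm1_norm_le H (fun chi => emb f chi - l chi) e /\
    hnorm (resolvent H z f - u) <= e].

Definition G_op H T z : operator F :=
  adj (compop T (total (resolvent H z^*))).

(* T R T^* with R = (- H + z)^-1 *)
Definition TRT H z T : operator F :=
  total (fun psi => T (resolvent_ext H z (dual_adj T psi))).

(** The operator H_S; below lam is the real point which determines
    R = (- H + lam)^-1 and G. *)

Definition D_op H T (lam : R) : set F :=
  [set psi | dom H (psi - G_op H T lam%:C psi)].

Definition T_op H S T (lam : R) : operator F :=
  let G := G_op H T lam%:C in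
  Operator (D_op H T lam)
    (fun psi => let u := S (psi - G psi) in u - adj G u).

Definition HS_op H S T (lam : R) : operator F :=
  Operator (D_op H T lam)
    (fun psi => unemb H (fun phi => Hbar H psi phi + dual_adj T psi phi)
      + T (psi - G_op H T lam%:C psi) - T_op H S T lam psi).

End Operators.

(* Main.v *)
Require Import Defs.
From HB Require Import structures.
From mathcomp Require Import all_boot all_order all_algebra.
From mathcomp Require Import all_classical all_reals all_analysis.
From mathcomp Require Import measurable_realfun.
From mathcomp Require Import ring lra.
From mathcomp.real_closed Require Import complex.

Set Implicit Arguments.
Unset Strict Implicit.
Unset Printing Implicit Defensive.

Import Order.TTheory GRing.Theory Num.Theory.
Import numFieldNormedType.Exports.

Local Open Scope classical_set_scope.
Local Open Scope ring_scope.
Local Open Scope complex_scope.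

(* With R = (- H + lam)^-1, W = A R and G = W^*, the operator
   K = H + A^* + A - A R A^* equals lam + (1 - G^* ) (H - lam) (1 - G), so that
   H_S = K - T_S. On dom H the operator K_n = H_n - A_n R A_n^* has the same form
   with W_n = A_n R, and W_n tends to W in norm.

   Since A_n and A are H-small with a bound that is uniform in n and arbitrarily
   small, (H - lam) (1 - G_n) psi is controlled by (K_n - z) psi uniformly in n.
   The difference of the resolvents of K_n and K is therefore of order
   ||G_n - G||. The same estimate makes the resolvents of the K_n a Cauchy
   sequence, whose limit shows that K - z is surjective; so K is self-adjoint.

   Put S_n = E_n - A_n R A_n^*. For z = i eta with eta large, S_n (K_n - z)^-1 has
   norm at most some q < 1, uniformly in n. As T_S (K - z)^-1 is the weak limit of
   these operators on a dense set, it has norm at most q as well, hence H_S is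
   self-adjoint, and 1 - (K_n - z)^-1 S_n is invertible uniformly in n. This
   reduces the convergence of the resolvents of H_n - E_n = K_n - S_n to the
   convergence of S_n (H_S - z)^-1 to T_S (H_S - z)^-1, which is assumed. *)

(** * Scalar product and convergence *)

(** In general [G] maps out of [dom H], so [K] and the [K_n] have different domains. Hence [K] is
    not treated as a relatively bounded perturbation of [H], and the second resolvent identity
    between [K_n] and [K] is replaced by a duality argument, with surjectivity obtained as a limit.
    Since lam is an arbitrary real point below the spectrum, [W] comes with some bound c that may
    exceed 1, and [1 - G] is never inverted; the estimate ||W h|| <= ||h|| / 2 + C ||R h|| takes its
    place, because its first term can be absorbed. The spectral theorem is not proved. The scale of
    [H] rests on a chosen spectral measure; if there were none, all its norms would be 0 and
    boundedness would force [A] and the [A_n] to vanish on [dom H]. This degenerate case is carried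
    along. Otherwise the spectral measure yields an arbitrarily small relative bound at order s < 1,
    and at order 1/2 a bound by the quadratic form of [H] with lower semicontinuity. Objects defined
    by choice, such as [adj], [Hbar], [resolvent_ext] and [unemb], are each identified by existence
    and uniqueness. *)

Section Dot.
Context {R : realType} {F : hilbertType R}.
Implicit Types (x y v w : F) (a z : R[i]).

Lemma dotDl x y v : '[x + y, v] = '[x, v] + '[y, v].
Proof. by rewrite linearDl. Qed.
Lemma dotBl x y v : '[x - y, v] = '[x, v] - '[y, v].
Proof. by rewrite linearBl. Qed.
Lemma dotDr x y v : '[x, y + v] = '[x, y] + '[x, v].
Proof. by rewrite linearDr. Qed.
Lemma dotBr x y v : '[x, y - v] = '[x, y] - '[x, v].
Proof. by rewrite linearBr. Qed.
Lemma dotNl x y : '[- x, y] = - '[x, y].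
Proof. by rewrite linearNl. Qed.
Lemma dotNr x y : '[x, - y] = - '[x, y].
Proof. by rewrite linearNr. Qed.
Lemma dotZl a x y : '[a *: x, y] = a * '[x, y].
Proof. by rewrite linearZl_LR. Qed.
Lemma dotZr a x y : '[x, a *: y] = a^*%C * '[x, y].
Proof. by rewrite linearZr_LR. Qed.
Lemma dot0l x : '[0, x] = 0.
Proof. by rewrite linear0l. Qed.
Lemma dot0r x : '[x, 0] = 0.
Proof. by rewrite linear0r. Qed.
Lemma dotC x y : '[x, y] = '[y, x]^*%C.
Proof. by rewrite (hermC dotp) expr0 mul1r. Qed.

Lemma hnormE x : `|x| = (hnorm x)%:C.
Proof. by rewrite /hnorm RRe_real// ger0_real. Qed.
Lemma hnorm_ge0 x : 0 <= hnorm x.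
Proof. by rewrite -ler0c -hnormE. Qed.

Definition cabs a : R := complex.Re `|a|.

Lemma cabsE a : `|a| = (cabs a)%:C.
Proof. by rewrite /cabs RRe_real// ger0_real. Qed.
Lemma cabs_ge0 a : 0 <= cabs a.
Proof. by rewrite -ler0c -cabsE. Qed.
Lemma cabsR (r : R) : cabs r%:C = `|r|.
Proof. by rewrite /cabs normc_def /= expr0n addr0 sqrtr_sqr. Qed.
Lemma cabs_conj a : cabs a^*%C = cabs a.
Proof. by rewrite /cabs normcJ. Qed.
Lemma cabs_sq a : cabs a ^+ 2 = complex.Re a ^+ 2 + complex.Im a ^+ 2.
Proof. by apply: complexI; rewrite rmorphXn /= -cabsE -add_Re2_Im2. Qed.
Lemma ler_Re_cabs a : complex.Re a <= cabs a.
Proof.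
apply: (le_trans (ler_norm _)); rewrite -lecR -cabsE; exact: normc_ge_Re.
Qed.
Lemma mulcJ a : a * a^*%C = (cabs a ^+ 2)%:C.
Proof. by rewrite rmorphXn /= -cabsE sqr_normc. Qed.
Lemma conjcB a z : (a - z)^*%C = a^*%C - z^*%C.
Proof. by rewrite rmorphB. Qed.
Lemma Im_conjc z : complex.Im z^*%C = - complex.Im z.
Proof. by case: z. Qed.
Lemma cabs_eq0 a : (cabs a == 0) = (a == 0).
Proof. by rewrite -(inj_eq (@complexI R)) -cabsE normr_eq0. Qed.
Lemma hnorm0 : hnorm (0 : F) = 0.
Proof. by rewrite /hnorm normr0. Qed.
Lemma hnorm_eq0 x : hnorm x = 0 -> x = 0.
Proof. by move=> h; apply/eqP; rewrite -normr_eq0 hnormE h. Qed.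
Lemma hnormN x : hnorm (- x) = hnorm x.
Proof. by rewrite /hnorm normrN. Qed.
Lemma hnorm_distC x y : hnorm (x - y) = hnorm (y - x).
Proof. by rewrite -hnormN opprB. Qed.
Lemma ler_hnormD x y : hnorm (x + y) <= hnorm x + hnorm y.
Proof. by rewrite -lecR rmorphD /= -!hnormE; exact: ler_normD. Qed.
Lemma ler_hnormB x y : hnorm (x - y) <= hnorm x + hnorm y.
Proof. by rewrite -(hnormN y); exact: ler_hnormD. Qed.
Lemma ler_hnorm_dist x y v : hnorm (x - v) <= hnorm (x - y) + hnorm (y - v).
Proof. by rewrite -[x - v](subrKA y); apply: ler_hnormD. Qed.
Lemma hnormZ a x : hnorm (a *: x) = cabs a * hnorm x.
Proof. by apply: complexI; rewrite rmorphM /= -!hnormE -cabsE normrZ. Qed.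
Lemma dotxx x : '[x, x] = (hnorm x ^+ 2)%:C.
Proof. by rewrite -dotp_norm hnormE rmorphXn. Qed.
Lemma hnorm_sq x : hnorm x ^+ 2 = complex.Re '[x, x].
Proof. by rewrite dotxx. Qed.
Lemma Re_dotC x y : complex.Re '[x, y] = complex.Re '[y, x].
Proof. by rewrite dotC; case: '[y, x]. Qed.
Lemma hnorm_sqD x y :
  hnorm (x + y) ^+ 2 = hnorm x ^+ 2 + 2 * complex.Re '[x, y] + hnorm y ^+ 2.
Proof.
rewrite !hnorm_sq dotDl !dotDr !raddfD /= (Re_dotC y x); ring.
Qed.
Lemma hnorm_sqB x y :
  hnorm (x - y) ^+ 2 = hnorm x ^+ 2 - 2 * complex.Re '[x, y] + hnorm y ^+ 2.
Proof. by rewrite hnorm_sqD hnormN dotNr raddfN /= mulrN. Qed.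

Lemma dot_Re_le x y : complex.Re '[x, y] <= hnorm x * hnorm y.
Proof.
have [y0|y0] := eqVneq (hnorm y) 0.
  by rewrite (hnorm_eq0 y0) dot0r hnorm0 mulr0.
have [x0|x0] := eqVneq (hnorm x) 0.
  by rewrite (hnorm_eq0 x0) dot0l hnorm0 mul0r.
have px : 0 < hnorm x by rewrite lt_def x0 hnorm_ge0.
have py : 0 < hnorm y by rewrite lt_def y0 hnorm_ge0.
have := sqr_ge0 (hnorm ((hnorm y)%:C *: x - (hnorm x)%:C *: y)).
rewrite hnorm_sqB !hnormZ !cabsR !ger0_norm ?hnorm_ge0//.
rewrite dotZl dotZr conjc_real mulrA -rmorphM /=.
set d := '[x, y].
have -> : complex.Re ((hnorm y * hnorm x)%:C * d) = hnorm y * hnorm x * complex.Re d.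
  by case: d => a b /=; rewrite mul0r subr0.
move=> h; have p := mulr_gt0 px py.
suff : 0 <= hnorm x * hnorm y * (hnorm x * hnorm y - complex.Re d).
  by rewrite pmulr_rge0// subr_ge0.
nra.
Qed.

Lemma dot_cabs_le x y : cabs '[x, y] <= hnorm x * hnorm y.
Proof.
set d := '[x, y]; have [d0|d0] := eqVneq (cabs d) 0.
  by rewrite d0 mulr_ge0 ?hnorm_ge0.
have pd : 0 < cabs d by rewrite lt_def d0 cabs_ge0.
(* Multiplying [y] by [d] makes the scalar product real, equal to |d|^2. *)
have := dot_Re_le x (d *: y).
rewrite dotZr -/d mulrC mulcJ hnormZ /= => h.
suff : cabs d * cabs d <= cabs d * (hnorm x * hnorm y) by rewrite ler_pM2l.
by rewrite -expr2; nra.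
Qed.

Lemma dot_norm_le x y : `|'[x, y]| <= (hnorm x * hnorm y)%:C.
Proof. by rewrite cabsE lecR dot_cabs_le. Qed.

Lemma dot_eqr x y : (forall v, '[v, x] = '[v, y]) -> x = y.
Proof.
move=> h; apply/eqP; rewrite -subr_eq0; apply/eqP/hnorm_eq0.
have : hnorm (x - y) ^+ 2 = 0 by rewrite hnorm_sq dotBr h subrr.
by move=> /eqP; rewrite sqrf_eq0 => /eqP.
Qed.

Lemma dot_eql x y : (forall v, '[x, v] = '[y, v]) -> x = y.
Proof. by move=> h; apply: dot_eqr => v; rewrite dotC h -dotC. Qed.

Lemma small_eq0 (r : R) : 0 <= r -> (forall e, 0 < e -> r <= e) -> r = 0.
Proof.
move=> r0 h; apply/eqP; rewrite eq_le r0 andbT; apply/ler_addgt0Pl => e e0.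
by rewrite addr0; exact: h.
Qed.

Lemma ler_hnorm_sq x (c : R) : 0 <= c ->
  hnorm x ^+ 2 <= c * hnorm x -> hnorm x <= c.
Proof.
move=> c0 h; have := hnorm_ge0 x; rewrite le_eqVlt => /orP[/eqP <-//|p].
by rewrite -(ler_pM2r p) -expr2.
Qed.

(** The norm of [F] is complex-valued, so the epsilons of the filter statements are complex as well;
    this form keeps them real. [hcvgP] translates. *)
Definition hcvg (u : nat -> F) (l : F) :=
  forall e : R, 0 < e -> exists N, forall n, (N <= n)%N -> hnorm (u n - l) <= e.

Definition hcauchy (u : nat -> F) :=
  forall e : R, 0 < e -> exists N, forall m n, (N <= m)%N -> (N <= n)%N ->
    hnorm (u m - u n) <= e.

Lemma gt0c_real (e : R[i]) : 0 < e -> exists2 r : R, 0 < r & e = r%:C.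
Proof.
rewrite ltcE => /andP[/eqP i0 r0]; exists (complex.Re e) => //.
by case: e i0 {r0} => a b /= ->.
Qed.

Lemma hcvgP (u : nat -> F) (l : F) : hcvg u l <-> (u k @[k --> \oo] --> l).
Proof.
split=> h.
  apply/cvgrPdist_le => e /gt0c_real[r r0 ->].
  have [N hN] := h _ r0; exists N => // n /= Nn.
  by rewrite hnormE lecR hnorm_distC; exact: hN.
move=> e e0; have ec : (0 : R[i]) < e%:C by rewrite ltcR.
have /cvgrPdist_le/(_ _ ec)[N _ hN] := h.
exists N => n Nn; have := hN n Nn.
by rewrite hnormE lecR hnorm_distC.
Qed.

Lemma hcauchy_cvg (u : nat -> F) : hcauchy u -> exists l, hcvg u l.
Proof.
move=> h; have : cvg (u @ \oo).
  apply: cauchy_cvg; apply/cauchyP => e /gt0c_real[r r0 ->].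
  have r20 : 0 < r / 2 by rewrite divr_gt0.
  have [N hN] := h _ r20; exists (u N); exists N => // n /= Nn.
  rewrite -ball_normE /= hnormE ltcR.
  by apply: (le_lt_trans (hN _ _ (leqnn N) Nn)); rewrite ltr_pdivrMr// ltr_pMr// ltr1n.
by move=> /hcvgP; exists (lim (u @ \oo)).
Qed.

Lemma denseP (D : set F) :
  dense D <-> forall x (e : R), 0 < e -> exists2 y, D y & hnorm (y - x) <= e.
Proof.
split=> h.
  move=> x e e0; have ec : (0 : R[i]) < e%:C by rewrite ltcR.
  have [||y [yb Dy]] := h (ball x e%:C).
  - by exists x; apply: ballxx.
  - exact: ball_open.
  - exists y => //; move: yb; rewrite -ball_normE /= hnormE ltcR hnorm_distC.
    exact: ltW.
move=> O [x Ox] oO.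
have /nbhs_ballP[e /= /gt0c_real[r r0 ->] hb] := open_nbhs_nbhs (conj oO Ox).
have r20 : 0 < r / 2 by rewrite divr_gt0.
have [y Dy hy] := h x _ r20; exists y; split => //; apply: hb.
rewrite -ball_normE /= hnormE ltcR hnorm_distC.
by apply: (le_lt_trans hy); rewrite ltr_pdivrMr// ltr_pMr// ltr1n.
Qed.

Lemma hcvg_dot u l v : hcvg u l -> forall e : R, 0 < e ->
  exists N, forall n, (N <= n)%N -> cabs ('[u n, v] - '[l, v]) <= e.
Proof.
move=> h e e0.
have v0 : 0 < hnorm v + 1 by rewrite ltr_wpDl// hnorm_ge0.
have [N hN] := h (e / (hnorm v + 1)) (divr_gt0 e0 v0).
exists N => n /hN {}hN; rewrite -dotBl; apply: (le_trans (dot_cabs_le _ _)).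
have a0 := hnorm_ge0 (u n - l); have b0 := hnorm_ge0 v.
rewrite ler_pdivlMr// in hN; nra.
Qed.

Lemma hcvg_uniq u l l' : hcvg u l -> hcvg u l' -> l = l'.
Proof. by move=> /hcvgP h /hcvgP h'; exact: cvg_unique h h'. Qed.

Lemma hcvgB u (v : nat -> F) l k : hcvg u l -> hcvg v k -> hcvg (fun n => u n - v n) (l - k).
Proof. by move=> /hcvgP h /hcvgP h'; apply/hcvgP; exact: cvgB. Qed.
Lemma hcvgD u (v : nat -> F) l k : hcvg u l -> hcvg v k -> hcvg (fun n => u n + v n) (l + k).
Proof. by move=> /hcvgP h /hcvgP h'; apply/hcvgP; exact: cvgD. Qed.
Lemma hcvgZ a u l : hcvg u l -> hcvg (fun n => a *: u n) (a *: l).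
Proof. by move=> /hcvgP h; apply/hcvgP; exact: cvgZr. Qed.
Lemma hcvg_cst l : hcvg (fun _ => l) l.
Proof. by apply/hcvgP; exact: cvg_cst. Qed.

Lemma hcvg_bnd (C : R) (B : F -> F) u l :
  (forall x y, B (x - y) = B x - B y) -> (forall x, hnorm (B x) <= C * hnorm x) ->
  hcvg u l -> hcvg (B \o u) (B l).
Proof.
move=> lB bB h e e0.
have v0 : 0 < `|C| + 1 by rewrite ltr_wpDl.
have [N hN] := h (e / (`|C| + 1)) (divr_gt0 e0 v0).
exists N => n /hN {}hN /=; rewrite -lB; apply: (le_trans (bB _)).
have a0 := hnorm_ge0 (u n - l); have b0 := ler_norm C.
have c0 := normr_ge0 C.
rewrite ler_pdivlMr// in hN; nra.
Qed.

Lemma invS_le (e : R) n : 0 < e -> (Num.truncn e^-1 <= n)%N -> n.+1%:R^-1 <= e.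
Proof.
move=> e0 hn; rewrite invf_ple ?posrE ?ltr0n//.
by apply/ltW/(lt_le_trans (truncnS_gt _)); rewrite ler_nat ltnS.
Qed.

Lemma dense_seq (D : set F) : dense D -> forall x, exists u : nat -> F,
  (forall k, D (u k)) /\ hcvg u x.
Proof.
move=> /denseP h x.
have /choice[u hu] : forall k : nat, exists y, D y /\ hnorm (y - x) <= k.+1%:R^-1.
  move=> k; have k0 : 0 < k.+1%:R^-1 :> R by rewrite invr_gt0.
  have [y Dy hy] := h x _ k0.
  by exists y; split.
exists u; split=> [k|e e0]; first by have [] := hu k.
exists (Num.truncn e^-1) => n hn; apply: (le_trans (hu n).2).
exact: invS_le.
Qed.

Lemma hcvg_dot_eq (u v : nat -> F) (l p : F) x y : hcvg u l -> hcvg v p ->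
  (forall k, '[u k, x] = '[v k, y]) -> '[l, x] = '[p, y].
Proof.
move=> hu hv e; apply/eqP; rewrite -subr_eq0 -cabs_eq0; apply/eqP.
apply: small_eq0 => [|d d0]; first exact: cabs_ge0.
have d2 : 0 < d / 2 by rewrite divr_gt0.
have [N1 h1] := hcvg_dot x hu d2; have [N2 h2] := hcvg_dot y hv d2.
have {}h1 := h1 _ (leq_maxl N1 N2); have {}h2 := h2 _ (leq_maxr N1 N2).
have -> : '[l, x] - '[p, y] = ('[v (maxn N1 N2), y] - '[p, y]) -
   ('[u (maxn N1 N2), x] - '[l, x]) by rewrite e; ring.
rewrite -lecR -cabsE; apply: (le_trans (ler_normB _ _)).
by rewrite !cabsE -rmorphD lecR /=; lra.
Qed.

Lemma hcvg_norm_le (u v : nat -> F) (l p : F) (K : R) : hcvg u l -> hcvg v p -> 0 <= K ->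
  (forall k, hnorm (u k) <= K * hnorm (v k)) -> hnorm l <= K * hnorm p.
Proof.
move=> hu hv K0 h; apply/ler_addgt0Pl => e e0.
have e2 : 0 < e / 2 by rewrite divr_gt0.
have ek : 0 < e / 2 / (K + 1) by rewrite divr_gt0// ltr_wpDl.
have [N1 h1] := hu _ e2; have [N2 h2] := hv _ ek.
pose n := maxn N1 N2.
have {}h1 := h1 n (leq_maxl _ _); have {}h2 := h2 n (leq_maxr _ _).
have h3 := ler_hnormD (l - u n) (u n); rewrite subrK hnorm_distC in h3.
have h4 := ler_hnormD (v n - p) p; rewrite subrK in h4.
have h5 := h n.
have h6 : K * hnorm (v n) <= K * (e / 2 / (K + 1) + hnorm p).
  by rewrite ler_wpM2l//; lra.
have h7 : K * (e / 2 / (K + 1)) <= e / 2.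
  rewrite mulrA ler_pdivrMr ?ltr_wpDl// mulrC ler_wpM2l ?(ltW e2)// ; lra.
lra.
Qed.

Lemma hcvg_shift (u : nat -> F) (l : F) N : hcvg u l -> hcvg (fun k => u (k + N)%N) l.
Proof.
move=> h e /h[M hM]; exists M => n hn; apply: hM.
by rewrite (leq_trans hn)// leq_addr.
Qed.

End Dot.

(* Linear identities between vectors become ring identities between scalar
   products. *)
Ltac vector_ring := apply: dot_eql => ?; rewrite ?(dotDl, dotNl, dotZl, dot0l); ring.

(** * The projection theorem *)

Section Projection.
Context {R : realType} {F : hilbertType R}.
Implicit Types (x y v w : F) (a z : R[i]).

Definition subspace (V : set F) :=
  V 0 /\ forall a x y, V x -> V y -> V (a *: x + y).

Lemma subspaceD V x y : subspace V -> V x -> V y -> V (x + y).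
Proof. by move=> [_ h] hx hy; rewrite -[x]scale1r; exact: h. Qed.
Lemma subspaceZ V a x : subspace V -> V x -> V (a *: x).
Proof. by move=> [h0 h] hx; rewrite -[_ *: _]addr0; exact: h. Qed.
Lemma subspaceB V x y : subspace V -> V x -> V y -> V (x - y).
Proof. by move=> hV hx hy; rewrite -scaleN1r; apply: subspaceD => //; apply: subspaceZ. Qed.

Definition hclosed (V : set F) :=
  forall u l, (forall k, V (u k)) -> hcvg u l -> V l.

Lemma parallelogram x y :
  hnorm (x + y) ^+ 2 + hnorm (x - y) ^+ 2 = 2 * hnorm x ^+ 2 + 2 * hnorm y ^+ 2.
Proof. rewrite hnorm_sqD hnorm_sqB; ring. Qed.

Lemma nearest_point (V : set F) x : subspace V -> hclosed V ->
  exists2 p, V p & forall v, V v -> hnorm (x - p) <= hnorm (x - v).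
Proof.
move=> hV cV.
pose D := [set hnorm (x - v) ^+ 2 | v in V].
have D0 : D !=set0 by exists (hnorm (x - 0) ^+ 2); exists 0 => //; exact: hV.1.
have Dlb : has_lbound D by exists 0 => _ [v _ <-]; exact: sqr_ge0.
pose d := inf D.
have dle v : V v -> d <= hnorm (x - v) ^+ 2 by move=> hv; apply: ge_inf => //; exists v.
have /choice[u hu] : forall k : nat, exists v,
    V v /\ hnorm (x - v) ^+ 2 <= d + k.+1%:R^-1.
  move=> k; have k0 : 0 < k.+1%:R^-1 :> R by rewrite invr_gt0 ltr0n.
  have [_ [v hv <-] h] := inf_adherent k0 (conj D0 Dlb).
  by exists v; split=> //; exact: ltW.
(* The midpoint of [u m] and [u n] lies in [V], so its squared distance to [x] is at least [d]; the
   parallelogram law turns this into a bound on [u m - u n]. *)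
have key m n : hnorm (u m - u n) ^+ 2 <= 2 * (m.+1%:R^-1 + n.+1%:R^-1).
  have := parallelogram (x - u m) (x - u n).
  have -> : x - u m + (x - u n) = 2%:R *: (x - 2^-1 *: (u m + u n)).
    rewrite scalerBr scalerA divff ?pnatr_eq0// scale1r scaler_nat mulr2n opprD.
    by rewrite addrACA.
  have -> : x - u m - (x - u n) = u n - u m by rewrite opprB addrC subrKA.
  rewrite hnormZ (hnorm_distC (u n)) => e.
  have hm := (hu m).2; have hn := (hu n).2.
  have := dle (2^-1 *: (u m + u n)) (subspaceZ _ hV (subspaceD hV (hu m).1 (hu n).1)).
  have c2 : cabs 2%:R = 2 :> R.
    by rewrite -(rmorph_nat (real_complex R)) cabsR ger0_norm.
  rewrite c2 exprMn in e; move: e hm hn; move: (m.+1%:R^-1) (n.+1%:R^-1) => a b; lra.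
have uc : hcauchy u.
  move=> e e0; have e2 : 0 < e ^+ 2 / 4 by rewrite divr_gt0// exprn_gt0.
  exists (Num.truncn (e ^+ 2 / 4)^-1) => m n hm hn.
  rewrite -(@ler_pXn2r _ 2) ?nnegrE ?hnorm_ge0 ?(ltW e0)//.
  have := key m n; have := invS_le e2 hm; have := invS_le e2 hn.
  move: (m.+1%:R^-1) (n.+1%:R^-1) => s t; lra.
have [p hp] := hcauchy_cvg uc.
have Vp : V p by apply: cV hp => k; exact: (hu k).1.
exists p => // v hv.
rewrite -(@ler_pXn2r _ 2) ?nnegrE ?hnorm_ge0//.
apply: le_trans (dle v hv).
rewrite -[leRHS]sqr_sqrtr; last first.
  by apply: lb_le_inf => // _ [w _ <-]; exact: sqr_ge0.
rewrite ler_pXn2r ?nnegrE ?hnorm_ge0 ?sqrtr_ge0//.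
apply/ler_addgt0Pl => e e0.
have e2 : 0 < e / 2 by rewrite divr_gt0.
have e2' : 0 < (e / 2) ^+ 2 by rewrite exprn_gt0.
have [N hN] := hp _ e2.
pose k := maxn N (Num.truncn ((e / 2) ^+ 2)^-1).
have h1 := hN k (leq_maxl _ _).
have h2 : hnorm (x - u k) <= e / 2 + Num.sqrt d.
  have d0 : 0 <= d by apply: lb_le_inf => // _ [w _ <-]; exact: sqr_ge0.
  rewrite -(@ler_pXn2r _ 2) ?nnegrE ?hnorm_ge0 ?addr_ge0 ?sqrtr_ge0 ?(ltW e2)//.
  apply: (le_trans (hu k).2).
  have hk : k.+1%:R^-1 <= (e / 2) ^+ 2 := invS_le e2' (leq_maxr _ _).
  rewrite sqrrD sqr_sqrtr//.
  have : 0 <= e / 2 * Num.sqrt d by rewrite mulr_ge0 ?sqrtr_ge0 ?ltW.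
  move: hk; move: (k.+1%:R^-1) ((e / 2) ^+ 2) (e / 2 * Num.sqrt d) => s t r; lra.
have := ler_hnorm_dist x (u k) p; lra.
Qed.

Lemma orth_decomp (V : set F) x : subspace V -> hclosed V ->
  exists2 p, V p & forall v, V v -> '[v, x - p] = 0.
Proof.
move=> hV cV; have [p Vp hp] := nearest_point x hV cV.
exists p => // v Vv.
set w := x - p; set c := '[v, w].
(* [p] is compared with [p + t c^* v]. The first-order change of the squared distance is - 2 t
   |c|^2, and minimality forces the second-order term to outweigh it. *)
have c2 : forall t : R, 0 < t -> 2 * cabs c ^+ 2 <= t * cabs c ^+ 2 * hnorm v ^+ 2.
  move=> t t0.
  have := hp (p + (t%:C * c^*%C) *: v) (subspaceD hV Vp (subspaceZ _ hV Vv)).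
  rewrite -(@ler_pXn2r _ 2) ?nnegrE ?hnorm_ge0// opprD addrA -/w.
  rewrite (hnorm_sqB w) hnormZ (Re_dotC w) dotZl -/c.
  have -> : t%:C * c^*%C * c = (t * cabs c ^+ 2)%:C.
    by rewrite -mulrA (mulrC (conjc c)) mulcJ -rmorphM.
  have -> : cabs (t%:C * c^*%C) = t * cabs c.
    apply: complexI; rewrite -cabsE normrM !cabsE cabsR cabs_conj ger0_norm ?ltW//.
    by rewrite rmorphM.
  rewrite /= => h.
  have : 0 <= t * (t * cabs c ^+ 2 * hnorm v ^+ 2 - 2 * cabs c ^+ 2) by nra.
  by rewrite pmulr_rge0// subr_ge0.
apply/eqP; rewrite -cabs_eq0 -sqrf_eq0; apply/eqP.
set X := cabs c ^+ 2 in c2 *.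
have X0 : 0 <= X by exact: sqr_ge0.
have v1 : 0 < hnorm v ^+ 2 + 1 by rewrite ltr_wpDl// sqr_ge0.
(* Any t > 0 with t ||v||^2 < 2 forces |c|^2 = 0; the added 1 covers [v = 0]. *)
have := c2 (hnorm v ^+ 2 + 1)^-1; rewrite invr_gt0 => /(_ v1).
rewrite mulrAC (mulrC _^-1).
have : hnorm v ^+ 2 * (hnorm v ^+ 2 + 1)^-1 <= 1.
  by rewrite ler_pdivrMr// mul1r lerDl.
have : 0 <= hnorm v ^+ 2 * (hnorm v ^+ 2 + 1)^-1.
  by rewrite mulr_ge0 ?sqr_ge0// invr_ge0 ltW.
set Y := hnorm v ^+ 2 * _; nra.
Qed.

Lemma orth_trivial_full (V : set F) : subspace V -> hclosed V ->
  (forall w, (forall v, V v -> '[v, w] = 0) -> w = 0) -> forall x, V x.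
Proof.
move=> hV cV h x; have [p Vp hp] := orth_decomp x hV cV.
by have /eqP := h _ hp; rewrite subr_eq0 => /eqP ->.
Qed.

Lemma orth_trivial_dense (V : set F) : subspace V ->
  (forall w, (forall v, V v -> '[v, w] = 0) -> w = 0) -> dense V.
Proof.
move=> hV h.
pose W : set F := [set x | forall e : R, 0 < e -> exists2 y, V y & hnorm (y - x) <= e].
suff HW : forall x, W x by apply/denseP => x e e0; exact: HW.
have VW x : V x -> W x by move=> hx e e0; exists x => //; rewrite subrr hnorm0 ltW.
apply: orth_trivial_full.
- split; first by apply: VW; exact: hV.1.
  move=> a x y hx hy e e0.
  have ca : 0 < cabs a + 1 by rewrite ltr_wpDl ?cabs_ge0.
  have e1 : 0 < e / 2 / (cabs a + 1) by rewrite !divr_gt0.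
  have e2 : 0 < e / 2 by rewrite divr_gt0.
  have [x' Vx' h1] := hx _ e1; have [y' Vy' h2] := hy _ e2.
  exists (a *: x' + y'); first exact: hV.2.
  rewrite opprD addrACA -scalerBr.
  apply: (le_trans (ler_hnormD _ _)); rewrite hnormZ.
  have n0 := hnorm_ge0 (x' - x); have c0 := cabs_ge0 a.
  rewrite ler_pdivlMr// in h1; nra.
- move=> u l hu hl e e0; have e2 : 0 < e / 2 by rewrite divr_gt0.
  have [N hN] := hl _ e2; have [y Vy hy] := hu N _ e2.
  exists y => //; have := hN N (leqnn _); have := ler_hnorm_dist y (u N) l; lra.
- by move=> w hw; apply: h => v Vv; apply: hw; exact: VW.
Qed.

Lemma dense_orth (D : set F) w : dense D ->
  (forall v, D v -> '[v, w] = 0) -> w = 0.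
Proof.
move=> /denseP dD h; apply: hnorm_eq0; apply: small_eq0; first exact: hnorm_ge0.
move=> e e0; have [y Dy hy] := dD w _ e0.
apply: ler_hnorm_sq; first exact: ltW.
have -> : hnorm w ^+ 2 = complex.Re '[w - y, w] by rewrite dotBl (h _ Dy) subr0 -hnorm_sq.
apply: (le_trans (dot_Re_le _ _)); rewrite hnorm_distC.
by rewrite ler_wpM2r ?hnorm_ge0.
Qed.

(** Testing on a dense set only is what later allows a symmetric unbounded operator to be moved onto
    [w]. *)
Lemma dense_Re_bound (D : set F) v (c : R) : dense D -> 0 <= c ->
  (forall w, D w -> complex.Re '[v, w] <= c * hnorm w) -> hnorm v <= c.
Proof.
move=> /(dense_seq)/(_ v)[u [Du hu]] c0 h.
apply: ler_hnorm_sq => //; apply/ler_addgt0Pl => e e0.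
pose k := hnorm v + c + 1.
have k0 : 0 < k by rewrite /k; have := hnorm_ge0 v; lra.
have [N hN] := hu _ (divr_gt0 e0 k0).
have := hN N (leqnn _); rewrite ler_pdivlMr// => {}hN.
have -> : hnorm v ^+ 2 = complex.Re '[v, u N] + complex.Re '[v, v - u N].
  by rewrite hnorm_sq dotBr raddfB /= addrCA subrr addr0.
have h1 := h _ (Du N); have h2 := dot_Re_le v (v - u N).
rewrite hnorm_distC in h2.
have h3 : hnorm (u N) <= hnorm (u N - v) + hnorm v by rewrite -{1}(subrK v (u N)) ler_hnormD.
have h4 := hnorm_ge0 (u N - v); have h5 := hnorm_ge0 v.
have h6 : c * hnorm (u N) <= c * (hnorm (u N - v) + hnorm v) by exact: ler_wpM2l.
rewrite /k in hN; nra.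
Qed.

(* The value of a bounded functional is read off a vector orthogonal to its
   kernel. *)
Lemma riesz (l : F -> R[i]) (c : R) :
  (forall a x y, l (a *: x + y) = a * l x + l y) ->
  (forall x, cabs (l x) <= c * hnorm x) -> exists u, forall x, l x = '[x, u].
Proof.
move=> lin bnd.
have l0 : l 0 = 0.
  have /eqP := lin 1 0 0; rewrite scale1r mul1r addr0 -subr_eq0 opprD addrA.
  by rewrite subrr sub0r oppr_eq0 => /eqP.
have lZ a x : l (a *: x) = a * l x by rewrite -[a *: x]addr0 lin l0 addr0.
have lB x y : l (x - y) = l x - l y.
  by rewrite addrC -scaleN1r lin mulN1r addrC.
pose V : set F := [set x | l x = 0].
have hV : subspace V by split=> // a x y hx hy; rewrite /V /= lin hx hy mulr0 addr0.
have cV : hclosed V.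
  move=> u x hu hx; apply/eqP; rewrite -cabs_eq0; apply/eqP.
  apply: small_eq0; first exact: cabs_ge0.
  move=> e e0; have k0 : 0 < `|c| + 1 by rewrite ltr_wpDl.
  have [N hN] := hx _ (divr_gt0 e0 k0).
  have := hN N (leqnn _); rewrite ler_pdivlMr// => {}hN.
  have := bnd (x - u N); rewrite lB (hu N) subr0 hnorm_distC.
  have := ler_norm c; have := hnorm_ge0 (u N - x); nra.
have [allV|/existsNP[x hx]] := pselect (forall x, V x).
  by exists 0 => x; rewrite dot0r; exact: allV.
have [p Vp hp] := orth_decomp x hV cV.
set w := x - p in hp.
have lw : l w != 0 by rewrite lB Vp subr0; apply/eqP.
have w0 : '[w, w] != 0.
  apply: contra_neq lw; rewrite dotxx => /(congr1 (@complex.Re R))/= /eqP.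
  by rewrite sqrf_eq0 => /eqP/hnorm_eq0 ->.
exists ((l w / '[w, w])^*%C *: w) => y.
have := hp (l w *: y - l y *: w); rewrite /V /= lB !lZ mulrC subrr => /(_ erefl).
rewrite dotBl !dotZl dotZr conjcK => /eqP; rewrite subr_eq0 => /eqP e.
by rewrite -mulrA (mulrC _^-1) mulrA e mulrK.
Qed.

Lemma bounded_adjoint (B : F -> F) (c : R) :
  (forall a x y, B (a *: x + y) = a *: B x + B y) ->
  (forall x, hnorm (B x) <= c * hnorm x) ->
  exists B' : F -> F, forall x y, '[B x, y] = '[x, B' y].
Proof.
move=> lin bnd.
suff /choice[B' h] : forall y, exists u, forall x, '[B x, y] = '[x, u].
  by exists B' => x y; exact: h.
move=> y; apply: (@riesz (fun x => '[B x, y]) (c * hnorm y)).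
  by move=> a x x'; rewrite lin dotDl dotZl.
move=> x; apply: (le_trans (dot_cabs_le _ _)).
by rewrite mulrAC ler_wpM2r ?hnorm_ge0.
Qed.

End Projection.

(** * Symmetric operators *)

Section OperatorTheory.
Context {R : realType} {F : hilbertType R}.
Implicit Types (T : operator F) (B : F -> F) (z : R[i]).
Implicit Types (psi phi u f g w : F).

(** The sign is that of [is_resolvent]: the resolvent at [z] inverts [shift T z]. *)
Definition shift T z : operator F :=
  Operator (dom T) (fun psi => - T psi + z *: psi).

Definition linear_on (D : set F) B := forall (a : R[i]) psi phi,
  D psi -> D phi -> B (a *: psi + phi) = a *: B psi + B phi.

Definition closed_graph T := forall (u : nat -> F) l v,
  (forall k, dom T (u k)) -> hcvg u l -> hcvg (T \o u) v -> dom T l /\ T l = v.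

Definition surjective_op T := forall f, exists2 psi, dom T psi & T psi = f.

(** Stronger than having no proper symmetric extension: the adjoint relation lies in the graph, so
    this is self-adjointness, stated without the values chosen by [adj]. Density of the domain is
    implied, since a vector orthogonal to it is an adjoint value at 0. *)
Definition maximal_symmetric T :=
  symmetric_op T /\ forall phi u, is_adj T phi u -> dom T phi /\ T phi = u.

Lemma linear_op_dom T : linear_op T -> subspace (dom T).
Proof. by move=> [d0 h]; split=> // a x y hx hy; have [] := h a x y hx hy. Qed.

Lemma linear_opP T a psi phi : linear_op T -> dom T psi -> dom T phi ->
  T (a *: psi + phi) = a *: T psi + T phi.
Proof. by move=> [_ h] hx hy; have [] := h a _ _ hx hy. Qed.

Lemma linear_op0 T : linear_op T -> T 0 = 0.
Proof.
move=> lT; have d0 := lT.1; have := linear_opP 1 lT d0 d0.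
by rewrite !scale1r addr0 -{1}[T 0]addr0 => /addrI <-.
Qed.

Lemma linear_opD T psi phi : linear_op T -> dom T psi -> dom T phi ->
  T (psi + phi) = T psi + T phi.
Proof. by move=> lT hx hy; rewrite -{1}[psi]scale1r linear_opP// scale1r. Qed.

Lemma linear_opZ T a psi : linear_op T -> dom T psi -> T (a *: psi) = a *: T psi.
Proof.
by move=> lT h; rewrite -{1}[a *: psi]addr0 linear_opP ?linear_op0 ?addr0//; exact: lT.1.
Qed.

Lemma linear_opB T psi phi : linear_op T -> dom T psi -> dom T phi ->
  T (psi - phi) = T psi - T phi.
Proof.
by move=> lT hx hy; rewrite addrC -scaleN1r linear_opP// scaleN1r addrC.
Qed.

Lemma linear_op_shift T z : linear_op T -> linear_op (shift T z).
Proof.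
move=> lT; split; first exact: lT.1.
move=> a x y hx hy; split; first by have [] := lT.2 a _ _ hx hy.
by rewrite /= linear_opP// opprD !scalerDr scalerN !scalerA (mulrC z) addrACA.
Qed.

(** The lower bound turns convergent images into convergent preimages, so a closed graph gives a
    closed range; a closed subspace with trivial orthogonal complement is everything. *)
Lemma closed_range_surj T (c : R) : linear_op T -> 0 < c ->
  (forall psi, dom T psi -> c * hnorm psi <= hnorm (T psi)) -> closed_graph T ->
  (forall w, (forall psi, dom T psi -> '[T psi, w] = 0) -> w = 0) ->
  surjective_op T.
Proof.
move=> lT c0 hc cT h.
pose V : set F := [set f | exists2 psi, dom T psi & T psi = f].
suff : forall f, V f by [].
apply: orth_trivial_full.
- split; first by exists 0; [exact: lT.1|exact: linear_op0].
  move=> a _ _ [x hx <-] [y hy <-]; exists (a *: x + y); last exact: linear_opP.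
  by have [] := lT.2 a _ _ hx hy.
- move=> u l hu hl.
  have /choice[v hv] : forall k, exists x, dom T x /\ T x = u k.
    by move=> k; have [x hx e] := hu k; exists x.
  have vc : hcauchy v.
    move=> e e0; have ce : 0 < c * e / 2 by rewrite divr_gt0// mulr_gt0.
    have [N hN] := hl _ ce; exists N => m n hm hn.
    have := hc _ (subspaceB (linear_op_dom lT) (hv m).1 (hv n).1).
    rewrite (linear_opB lT (hv m).1 (hv n).1) (hv m).2 (hv n).2 => h1.
    have h2 := hN _ hm; have h3 := hN _ hn; rewrite (hnorm_distC (u n)) in h3.
    have h4 := ler_hnorm_dist (u m) l (u n).
    by rewrite -(ler_pM2l c0); lra.
  have [p hp] := hcauchy_cvg vc.
  have [|dp ep] := cT v p l (fun k => (hv k).1) hp; last by exists p.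
  have -> : T \o v = u by apply/funext => k /=; exact: (hv k).2.
  by [].
- by move=> w hw; apply: h => psi dpsi; apply: hw; exists psi.
Qed.

(** No series is summed. [1 - B] is bounded below by 1 - q, and a vector [w] orthogonal to its range
    satisfies ||w||^2 = Re <B w, w> <= q ||w||^2. *)
Lemma neumann B (q : R) : (forall a x y, B (a *: x + y) = a *: B x + B y) ->
  q < 1 -> (forall x, hnorm (B x) <= q * hnorm x) ->
  forall f, exists g, g - B g = f.
Proof.
move=> lB q1 bB f.
pose T := Operator setT (fun x => x - B x).
have BB x y : B (x - y) = B x - B y by rewrite addrC -scaleN1r lB scaleN1r addrC.
have lT : linear_op T.
  split=> // a x y _ _; split=> //=.
  by rewrite lB opprD addrACA scalerBr.
suff : surjective_op T by move=> /(_ f)[g _ <-]; exists g.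
have q0 : 0 < 1 - q by rewrite subr_gt0.
apply: (closed_range_surj lT q0).
- move=> x _; have := ler_hnormD (x - B x) (B x); rewrite subrK => h.
  have := bB x; rewrite /=; lra.
- move=> u l v _ hu hv; split=> //=.
  apply: (@hcvg_uniq _ _ (T \o u)) hv.
  by apply: hcvgB => //; exact: hcvg_bnd hu.
- move=> w /(_ w I) /=; rewrite dotBl => /eqP; rewrite subr_eq0 => /eqP e.
  apply: hnorm_eq0; apply/eqP; rewrite -sqrf_eq0; apply/eqP.
  have := dot_Re_le (B w) w; rewrite -e -hnorm_sq => h.
  have := bB w; have := hnorm_ge0 w; have := sqr_ge0 (hnorm w); nra.
Qed.

Lemma dot_sym_real T psi : symmetric_op T -> dom T psi -> complex.Im '[T psi, psi] = 0.
Proof.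
move=> [_ sT] h; have := dotC (T psi) psi; rewrite -(sT _ _ h h).
by case: '[T psi, psi] => a b [] /eqP; rewrite -addr_eq0 -mulr2n mulrn_eq0 => /eqP.
Qed.

Lemma Im_shift T z psi : symmetric_op T -> dom T psi ->
  complex.Im '[shift T z psi, psi] = complex.Im z * hnorm psi ^+ 2.
Proof.
move=> sT h; rewrite /= dotDl dotNl dotZl dotxx.
have := dot_sym_real sT h; case: '[T psi, psi] => a b /= ->; case: z => c d /=.
by rewrite oppr0 add0r mulr0 add0r.
Qed.

Lemma sym_shift_bound T z psi : symmetric_op T -> dom T psi ->
  `|complex.Im z| * hnorm psi <= hnorm (shift T z psi).
Proof.
move=> sT h.
have [p0|p0] := eqVneq (hnorm psi) 0; first by rewrite p0 mulr0 hnorm_ge0.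
have p : 0 < hnorm psi by rewrite lt_def p0 hnorm_ge0.
rewrite -(ler_pM2r p); apply: le_trans (dot_cabs_le _ _).
rewrite -(@ler_pXn2r _ 2) ?nnegrE ?cabs_ge0 ?mulr_ge0 ?hnorm_ge0//.
rewrite cabs_sq (Im_shift z sT h); apply: le_trans (ler_wpDl (sqr_ge0 _) (lexx _)).
by rewrite -mulrA -expr2 !exprMn real_normK// num_real.
Qed.

Lemma sym_shift_inj T z psi phi : symmetric_op T -> complex.Im z != 0 ->
  dom T psi -> dom T phi -> shift T z psi = shift T z phi -> psi = phi.
Proof.
move=> sT z0 h1 h2 e; apply/eqP; rewrite -subr_eq0; apply/eqP/hnorm_eq0.
have lT := linear_op_shift z sT.1.
have := sym_shift_bound z sT (subspaceB (linear_op_dom lT) h1 h2).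
rewrite (linear_opB lT h1 h2) e subrr hnorm0 => h.
have i0 : 0 < `|complex.Im z| by rewrite normr_gt0.
by apply/eqP; rewrite eq_le hnorm_ge0 andbT -(ler_pM2l i0) mulr0.
Qed.

Definition imag (e : R) : R[i] := Complex 0 e.

Lemma sym_shift_imag T (e : R) psi : symmetric_op T -> dom T psi ->
  hnorm (shift T (imag e) psi) ^+ 2 = hnorm (T psi) ^+ 2 + e ^+ 2 * hnorm psi ^+ 2.
Proof.
move=> sT h; rewrite /= addrC hnorm_sqB hnormZ exprMn cabs_sq /=.
rewrite expr0n add0r dotZl (dotC psi) -/(imag e).
have := dot_sym_real sT h; case: '[T psi, psi] => a b /= ->.
by rewrite mul0r oppr0 mulr0 subr0 mulr0 subr0 addrC.
Qed.

(** By [sym_shift_imag], the shift bounds both [T psi] and [e] times [psi]. A relative bound [a < 1]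
    thus becomes an operator bound below 1 on the shift once [e] is large. *)
Lemma sym_small_imag T (e a b : R) psi : symmetric_op T -> dom T psi -> e != 0 ->
  0 <= a -> a * hnorm (T psi) + b * hnorm psi <=
    (a + `|b| / `|e|) * hnorm (shift T (imag e) psi).
Proof.
move=> sT h e0 a0; have hs := sym_shift_imag e sT h.
set N := hnorm (shift _ _ _) in hs *.
have pe : 0 < `|e| by rewrite normr_gt0.
have h1 : hnorm (T psi) <= N.
  rewrite -(@ler_pXn2r _ 2) ?nnegrE ?hnorm_ge0// hs.
  by rewrite lerDl mulr_ge0// sqr_ge0.
have h2 : hnorm psi <= N / `|e|.
  have := sym_shift_bound (imag e) sT h; rewrite ler_pdivlMr//= mulrC.
  exact: le_trans.
rewrite mulrDl lerD//; first exact: ler_wpM2l.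
apply: (le_trans (ler_wpM2r (hnorm_ge0 _) (ler_norm b))).
by rewrite -mulrA (mulrC _^-1) ler_wpM2l.
Qed.

Lemma shift_adj T z phi u : is_adj (shift T z) phi u <->
  is_adj T phi (z^*%C *: phi - u).
Proof.
split=> h psi hpsi; have := h psi hpsi; rewrite /= dotBr dotZr conjcK.
  by rewrite dotDl dotNl dotZl => <-; rewrite opprD opprK addrCA subrr addr0.
by rewrite dotDl dotNl dotZl => ->; rewrite opprB subrK.
Qed.

Lemma shift_sym T z psi phi : symmetric_op T -> dom T psi -> dom T phi ->
  '[shift T z psi, phi] = '[psi, shift T z^*%C phi].
Proof.
move=> sT h1 h2; rewrite /= dotDl dotDr dotNl dotNr dotZl dotZr conjcK.
by rewrite sT.2.
Qed.

Lemma maxsym_closed T : maximal_symmetric T -> closed_graph T.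
Proof.
move=> [sT mT] u l v hu hl hv; apply: mT => phi hphi.
rewrite dotC (dotC phi); congr (_^*%C).
by apply/esym/(hcvg_dot_eq hv hl) => k; exact: sT.2.
Qed.

Lemma closed_graph_shift T z : closed_graph T -> closed_graph (shift T z).
Proof.
move=> cT u l v hu hl hv.
have [|||dl el] := cT u l (z *: l - v) => //.
  have := hcvgB (hcvgZ z hl) hv.
  congr hcvg; apply/funext => k /=.
  by rewrite opprD opprK addrCA subrr addr0.
by split=> //=; rewrite el opprB subrK.
Qed.

Lemma maxsym_surj T z : maximal_symmetric T -> complex.Im z != 0 ->
  surjective_op (shift T z).
Proof.
move=> mT z0; have sT := mT.1.
have i0 : 0 < `|complex.Im z| by rewrite normr_gt0.
apply: (closed_range_surj (linear_op_shift z sT.1) i0).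
- by move=> psi hpsi; exact: sym_shift_bound.
- exact/closed_graph_shift/maxsym_closed.
- move=> w hw.
  have /shift_adj : is_adj (shift T z) w 0 by move=> psi /hw ->; rewrite dot0r.
  rewrite subr0 => /(mT.2)[dw ew].
  apply: (@sym_shift_inj T z^*%C) => //; try by rewrite Im_conjc oppr_eq0.
    exact: sT.1.1.
  by rewrite /= ew addNr linear_op0 ?oppr0 ?scaler0 ?addr0//; exact: sT.1.
Qed.

Lemma surj_resolvent T z (c : R) : linear_op T -> 0 < c ->
  (forall psi, dom T psi -> c * hnorm psi <= hnorm (shift T z psi)) ->
  surjective_op (shift T z) -> resolvent_set T z.
Proof.
move=> lT c0 hc sT; have lS := linear_op_shift z lT.
have inj psi phi : dom T psi -> dom T phi -> shift T z psi = shift T z phi -> psi = phi.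
  move=> h1 h2 e; apply/eqP; rewrite -subr_eq0; apply/eqP/hnorm_eq0.
  have := hc _ (subspaceB (linear_op_dom lT) h1 h2).
  rewrite (linear_opB lS h1 h2) e subrr hnorm0 => h.
  by apply/eqP; rewrite eq_le hnorm_ge0 andbT -(ler_pM2l c0) mulr0.
have /choice[B hB] : forall f, exists psi, dom T psi /\ shift T z psi = f.
  by move=> f; have [psi h1 h2] := sT f; exists psi.
exists B; split; last first.
- by move=> psi h; apply: inj => //; [exact: (hB _).1|exact: (hB _).2].
- by move=> f; exact: hB.
split=> //; last first.
  exists c^-1 => f; rewrite ler_pdivlMl//=.
  by apply: (le_trans (hc _ (hB f).1)); rewrite (hB f).2.
split=> // a f g _ _; split=> //=.
have [d1 e1] := hB f; have [d2 e2] := hB g; have [d3 e3] := hB (a *: f + g).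
apply: inj => //; first by have [] := lT.2 a _ _ d1 d2.
by rewrite (linear_opP a lS d1 d2) e1 e2.
Qed.

Lemma maxsym_resolvent T z : maximal_symmetric T -> complex.Im z != 0 ->
  resolvent_set T z.
Proof.
move=> mT z0; have i0 : 0 < `|complex.Im z| by rewrite normr_gt0.
apply: (surj_resolvent mT.1.1 i0); last exact: maxsym_surj.
by move=> psi h; apply: sym_shift_bound => //; exact: mT.1.
Qed.

Lemma resolventP T z : resolvent_set T z -> is_resolvent T z (resolvent T z).
Proof. by move=> h; rewrite /resolvent; exact: xgetPex. Qed.

Lemma resolvent_Im_bound T z B f : symmetric_op T -> is_resolvent T z B ->
  `|complex.Im z| * hnorm (B f) <= hnorm f.
Proof.
move=> sT [_ h _]; apply: (le_trans (sym_shift_bound z sT (h f).1)).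
by rewrite /= (h f).2.
Qed.

Lemma self_adjoint_maxsym T : self_adjoint T -> maximal_symmetric T.
Proof.
move=> [lT dT dA eA].
have uniq phi u v : is_adj T phi u -> is_adj T phi v -> u = v.
  move=> hu hv; apply/eqP; rewrite -subr_eq0; apply/eqP.
  by apply: (dense_orth dT) => w dw; rewrite dotBr -hu// -hv// subrr.
have adjE phi u : is_adj T phi u -> adj T phi = u.
  move=> hu; apply: (uniq phi _ _ _ hu).
  by apply: (@xgetPex _ 0 [set u | is_adj T phi u]); exists u.
have h phi u : is_adj T phi u -> dom T phi /\ T phi = u.
  move=> hu; have dphi : dom T phi by rewrite -dA; exists u.
  by split=> //; rewrite -eA// (adjE _ _ hu).
split=> //; split=> // psi phi hpsi hphi.
have : dom (adj T) phi by rewrite dA.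
by move=> [u hu]; rewrite (hu _ hpsi) (h _ _ hu).2.
Qed.

(** For [phi] in the domain of the adjoint, surjectivity at [z] supplies a candidate [psi] in
    [dom T] with the same image; surjectivity at the conjugate point shows that [phi - psi] is
    orthogonal to everything. *)
Lemma surj_maxsym T z : symmetric_op T -> complex.Im z != 0 ->
  surjective_op (shift T z) -> surjective_op (shift T z^*%C) ->
  maximal_symmetric T.
Proof.
move=> sT z0 s1 s2; split=> // phi u hu.
have [psi dpsi e] := s1 (- u + z *: phi).
suff ep : phi = psi.
  by rewrite ep; split=> //; move: e; rewrite -ep /= => /addIr/oppr_inj.
apply: dot_eqr => w; have [chi dchi <-] := s2 w.
rewrite /= !dotDl !dotNl !dotZl hu// sT.2//.
have := congr1 (fun x => '[chi, x]) e.
by rewrite /= !dotDr !dotNr !dotZr => ->.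
Qed.

Lemma maxsym_ext T T' : dom T = dom T' -> (forall psi, dom T psi -> T psi = T' psi) ->
  maximal_symmetric T -> maximal_symmetric T'.
Proof.
case: T => D t; case: T' => D' t' /= <- e [[[l0 l1] s] m]; split=> [|phi u hu].
  split=> [|psi phi hpsi hphi]; last by rewrite /= -!e//; exact: s.
  split=> // a x y hx hy; have [h1 h2] := l1 a _ _ hx hy.
  by split=> //=; rewrite -!e.
have [h1 h2] : D phi /\ t phi = u by apply: m => psi hpsi; rewrite /= e//; exact: hu.
by split=> //=; rewrite -e.
Qed.

Lemma symmetric_add T V : symmetric_op T -> linear_on (dom T) V ->
  (forall psi phi, dom T psi -> dom T phi -> '[V psi, phi] = '[psi, V phi]) ->
  symmetric_op (Operator (dom T) (fun psi => T psi + V psi)).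
Proof.
move=> sT lV sV; split; last first.
  by move=> psi phi h1 h2; rewrite /= dotDl dotDr sT.2// sV.
split; first exact: sT.1.1.
move=> a x y hx hy; have [h1 h2] := sT.1.2 a _ _ hx hy; split=> //=.
by rewrite h2 lV// scalerDr addrACA.
Qed.

Lemma exists_imag (a b : R) : a < 1 -> exists2 e, 0 < e & a + `|b| / e < 1.
Proof.
move=> a1; exists ((`|b| + 1) / (1 - a)).
  by rewrite divr_gt0 ?subr_gt0// ltr_wpDl.
rewrite invf_div mulrA -ltrBrDl ltr_pdivrMr ?ltr_wpDl//.
by rewrite mulrC ltr_pM2l ?subr_gt0// ltrDl.
Qed.

(** With B the resolvent of [T], the shift of [T + V] factors as (1 - V B) times the shift of [T],
    and [V B] has norm at most q < 1. *)
Lemma perturbed_surj T V (e q : R) : symmetric_op T -> e != 0 ->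
  surjective_op (shift T (imag e)) -> linear_on (dom T) V -> q < 1 ->
  (forall psi, dom T psi ->
     hnorm (V psi) <= q * hnorm (shift T (imag e) psi)) ->
  surjective_op (shift (Operator (dom T) (fun psi => T psi + V psi)) (imag e)).
Proof.
move=> sT e0 hs lV q1 hV f.
have i0 : 0 < `|complex.Im (imag e)| by rewrite normr_gt0.
have [B [[[_ lB] _ _] hB _]] : resolvent_set T (imag e).
  apply: (surj_resolvent sT.1 i0) => // psi h; exact: sym_shift_bound.
have [|x|g hg] := @neumann (V \o B) q _ q1 _ f.
- move=> a x y /=; have [_ /= ->] := lB a x y I I.
  by rewrite lV//; [exact: (hB x).1|exact: (hB y).1].
- by apply: (le_trans (hV _ (hB x).1)); rewrite /= (hB x).2.
exists (B g); first exact: (hB g).1.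
by rewrite /= opprD addrAC (hB g).2.
Qed.

Lemma kato_rellich T V (a b : R) : maximal_symmetric T -> 0 <= a < 1 ->
  linear_on (dom T) V ->
  (forall psi phi, dom T psi -> dom T phi -> '[V psi, phi] = '[psi, V phi]) ->
  (forall psi, dom T psi -> hnorm (V psi) <= a * hnorm (T psi) + b * hnorm psi) ->
  maximal_symmetric (Operator (dom T) (fun psi => T psi + V psi)).
Proof.
move=> mT /andP[a0 a1] lV sV hV; have sT := mT.1.
have [e e0 he] := exists_imag b a1.
have aux d : `|d| = e -> d != 0 ->
    surjective_op (shift (Operator (dom T) (fun psi => T psi + V psi)) (imag d)).
  move=> de d0; apply: (@perturbed_surj _ _ _ (a + `|b| / e)) => //.
    exact: maxsym_surj.
  move=> psi h; apply: (le_trans (hV _ h)); rewrite -de; exact: sym_small_imag.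
apply: (@surj_maxsym _ (imag e)).
- exact: symmetric_add.
- by rewrite gt_eqF.
- by apply: aux; [rewrite gtr0_norm|rewrite gt_eqF].
- have -> : (imag e)^*%C = imag (- e) by [].
  by apply: aux; [rewrite normrN gtr0_norm|rewrite oppr_eq0 gt_eqF].
Qed.

End OperatorTheory.

(** * The operators H + A^* + A - A R A^* *)

Section SingularSum.
Context {R : realType} {F : hilbertType R}.
Implicit Types (T : operator F) (W G : F -> F) (z : R[i]).
Implicit Types (psi phi chi u f g w h : F).

(** The bound is a parameter so that one [c] can serve a whole sequence of pairs. *)
Definition adjoint_pair W G (c : R) :=
  [/\ forall a x y, W (a *: x + y) = a *: W x + W y,
      0 <= c, forall x, hnorm (W x) <= c * hnorm x &
      forall x y, '[W x, y] = '[x, G y]].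

Lemma adjoint_pairB W G c x y : adjoint_pair W G c -> W (x - y) = W x - W y.
Proof. by move=> [lW _ _ _]; rewrite addrC -scaleN1r lW scaleN1r addrC. Qed.

Lemma adjoint_pair_sym W G c : adjoint_pair W G c -> adjoint_pair G W c.
Proof.
move=> [lW c0 bW aW].
have aG x y : '[G x, y] = '[x, W y] by rewrite dotC -aW -dotC.
split=> //.
  move=> a x y; apply: dot_eqr => v.
  by rewrite -aW !dotDr !dotZr !aW.
move=> x; apply: ler_hnorm_sq; first by rewrite mulr_ge0 ?hnorm_ge0.
rewrite hnorm_sq aG; apply: (le_trans (dot_Re_le _ _)).
by rewrite (mulrC c) -mulrA ler_wpM2l ?hnorm_ge0.
Qed.

Lemma adjoint_pair_dist W1 G1 c1 W2 G2 c2 (e : R) :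
  adjoint_pair W1 G1 c1 -> adjoint_pair W2 G2 c2 -> 0 <= e ->
  (forall x, hnorm (W1 x - W2 x) <= e * hnorm x) ->
  forall x, hnorm (G1 x - G2 x) <= e * hnorm x.
Proof.
move=> h1 h2 e0 he x; set y := G1 x - G2 x.
apply: ler_hnorm_sq; first by rewrite mulr_ge0 ?hnorm_ge0.
have [_ _ _ a1] := h1; have [_ _ _ a2] := h2.
have -> : hnorm y ^+ 2 = complex.Re '[W1 y - W2 y, x].
  by rewrite dotBl a1 a2 -dotBr hnorm_sq.
apply: (le_trans (dot_Re_le _ _)).
apply: (le_trans (ler_wpM2r (hnorm_ge0 _) (he y))).
by rewrite mulrAC.
Qed.

Variables (H : operator F) (lam : R) (R0 : F -> F).
Hypothesis (mH : maximal_symmetric H) (hR0 : is_resolvent H lam%:C R0).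

Let L := shift H lam%:C.

Let sH : symmetric_op H. Proof. exact: mH.1. Qed.

Let lL : linear_op L. Proof. exact: linear_op_shift sH.1. Qed.

Let sL psi phi : dom H psi -> dom H phi -> '[L psi, phi] = '[psi, L phi].
Proof.
move=> h1 h2; rewrite /L /= dotDl dotDr dotNl dotNr sH.2// dotZl dotZr.
by rewrite conjc_real.
Qed.

Lemma resolvent_linear a x y : R0 (a *: x + y) = a *: R0 x + R0 y.
Proof. by have [[[_ h] _ _] _ _] := hR0; have [] := h a x y I I. Qed.

Lemma resolvent_dom f : dom H (R0 f).
Proof. by have [_ h _] := hR0; have [] := h f. Qed.

Lemma shift_resolvent f : shift H lam%:C (R0 f) = f.
Proof. by have [_ h _] := hR0; have [] := h f. Qed.

Lemma resolvent_shift psi : dom H psi -> R0 (shift H lam%:C psi) = psi.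
Proof. by have [_ _ h] := hR0; exact: h. Qed.

Lemma resolvent_bounded : exists2 c : R, 0 <= c & forall f, hnorm (R0 f) <= c * hnorm f.
Proof.
have [[_ _ [c hc]] _ _] := hR0; exists `|c| => // f.
by apply: (le_trans (hc f)); rewrite ler_wpM2r ?hnorm_ge0 ?ler_norm.
Qed.

Lemma resolvent_sym f g : '[R0 f, g] = '[f, R0 g].
Proof.
rewrite -{1}(shift_resolvent g) -sL ?shift_resolvent//; exact: resolvent_dom.
Qed.

(* On its domain, [Kop W G] is [lam + (1 - W) (H - lam) (1 - G)]; for
   [W = A R0] this is [H + A^* + A - A R0 A^*]. *)
Definition Kop W G : operator F :=
  Operator [set psi | dom H (psi - G psi)]
    (fun psi => lam%:C *: psi -
       (shift H lam%:C (psi - G psi) - W (shift H lam%:C (psi - G psi)))).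

Lemma shift_Kop W G z psi : shift (Kop W G) z psi =
  (z - lam%:C) *: psi + (L (psi - G psi) - W (L (psi - G psi))).
Proof. by rewrite /=; vector_ring. Qed.

Lemma Kop_sym W G c : adjoint_pair W G c -> symmetric_op (Kop W G).
Proof.
move=> hW; have [lG _ _ _] := adjoint_pair_sym hW; have [lW _ _ aW] := hW.
have split0 a x y : a *: x + y - G (a *: x + y) = a *: (x - G x) + (y - G y).
  by rewrite lG opprD addrACA scalerBr.
have G0 : G 0 = 0.
  by rewrite -[0 in LHS](subrr 0) (adjoint_pairB _ _ (adjoint_pair_sym hW)) subrr.
split; last first.
  move=> x y hx hy /=; rewrite !dotBl !dotBr dotZl dotZr conjc_real; congr (_ - _).
  rewrite aW -dotBr.
  have -> : '[x, W (L (y - G y))] = '[G x, L (y - G y)].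
    by rewrite dotC aW -dotC.
  by rewrite -dotBl; exact: sL.
split; first by rewrite /= G0 subrr; exact: sH.1.1.
move=> a x y hx hy /=.
rewrite split0; split; first by have [] := sH.1.2 a _ _ hx hy.
have := linear_opP a lL hx hy; rewrite /L /= => ->.
rewrite lW; set u := - H _ + _; set v := - H _ + _.
vector_ring.
Qed.

(** Put h = L (psi - G psi) and let g be the shift of psi. Then h = g - (z - lam) psi + W h. Half of
    [h] is absorbed, which is the factor 2; the rest of [W h] is controlled by R0 h = psi - G psi,
    and [psi] itself by g / |Im z|. *)
Lemma Kop_apriori W G (c C : R) z psi : adjoint_pair W G c -> 0 <= C ->
  (forall h, hnorm (W h) <= 2^-1 * hnorm h + C * hnorm (R0 h)) ->
  complex.Im z != 0 -> dom (Kop W G) psi ->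
  hnorm (L (psi - G psi)) <=
    2 * (1 + (cabs (z - lam%:C) + C * (1 + c)) / `|complex.Im z|) *
    hnorm (shift (Kop W G) z psi).
Proof.
move=> hW C0 hC z0 hpsi; have [lW c0 bW aW] := hW.
have [_ _ bG _] := adjoint_pair_sym hW.
have i0 : 0 < `|complex.Im z| by rewrite normr_gt0.
have hs := sym_shift_bound z (Kop_sym hW) hpsi.
move: hs; rewrite shift_Kop; set h := L _; set g := _ + _ => hs.
have h1 : hnorm h <= hnorm g + cabs (z - lam%:C) * hnorm psi + hnorm (W h).
  have {1}-> : h = g - (z - lam%:C) *: psi + W h by rewrite /g; vector_ring.
  apply: (le_trans (ler_hnormD _ _)); rewrite lerD2r -hnormZ.
  exact: ler_hnormB.
have h2 := hC h; rewrite (resolvent_shift hpsi) in h2.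
have h3 := ler_hnormB psi (G psi).
have h4 := bG psi.
have h5 : hnorm psi <= hnorm g / `|complex.Im z| by rewrite ler_pdivlMr// mulrC.
have k0 := cabs_ge0 (z - lam%:C).
have h6 : hnorm (psi - G psi) <= (1 + c) * hnorm psi by lra.
have h7 : C * hnorm (psi - G psi) <= C * ((1 + c) * hnorm psi) by rewrite ler_wpM2l.
have h8 : (cabs (z - lam%:C) + C * (1 + c)) * hnorm psi <=
  (cabs (z - lam%:C) + C * (1 + c)) * (hnorm g / `|complex.Im z|).
  by rewrite ler_wpM2l// addr_ge0// mulr_ge0// addr_ge0.
set X := cabs _ + _ in h8 *; set i := `|complex.Im z| in h8 *.
have -> : 2 * (1 + X / i) * hnorm g = 2 * (hnorm g + X * (hnorm g / i)) by ring.
rewrite /X in h8 *; lra.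
Qed.

(** [psi1] and [psi2] lie in different domains, so the two operators cannot be subtracted. Instead
    [psi1 - psi2] is tested against the solution [chi] of the conjugate equation for the second
    operator. The constant 4 is twice the 2 of [Kop_apriori], which enters once for [psi1] and once
    for [chi]. *)
Lemma Kop_dist W1 G1 W2 G2 (c C e : R) z psi1 psi2 :
  adjoint_pair W1 G1 c -> adjoint_pair W2 G2 c -> 0 <= C -> 0 <= e ->
  (forall h, hnorm (W1 h) <= 2^-1 * hnorm h + C * hnorm (R0 h)) ->
  (forall h, hnorm (W2 h) <= 2^-1 * hnorm h + C * hnorm (R0 h)) ->
  (forall x, hnorm (W1 x - W2 x) <= e * hnorm x) ->
  complex.Im z != 0 -> surjective_op (shift (Kop W2 G2) z^*%C) ->
  dom (Kop W1 G1) psi1 -> dom (Kop W2 G2) psi2 ->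
  shift (Kop W1 G1) z psi1 = shift (Kop W2 G2) z psi2 ->
  hnorm (psi1 - psi2) <=
   e * (4 * (1 + (cabs (z - lam%:C) + C * (1 + c)) / `|complex.Im z|)
     / `|complex.Im z|) * hnorm (shift (Kop W1 G1) z psi1).
Proof.
move=> p1 p2 C0 e0 b1 b2 he z0 s2 d1 d2 eq12.
have [chi dchi echi] := s2 (psi1 - psi2).
have z0' : complex.Im z^*%C != 0 by rewrite Im_conjc oppr_eq0.
have i0 : 0 < `|complex.Im z| by rewrite normr_gt0.
have izc : `|complex.Im z^*%C| = `|complex.Im z| by rewrite Im_conjc normrN.
have czc : cabs (z^*%C - lam%:C) = cabs (z - lam%:C).
  by rewrite -cabs_conj conjcB conjcK conjc_real.
have a1 := Kop_apriori p1 C0 b1 z0 d1.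
have a2 := Kop_apriori p2 C0 b2 z0' dchi.
have n1 := sym_shift_bound z (Kop_sym p1) d1.
have n2 := sym_shift_bound z^*%C (Kop_sym p2) dchi.
rewrite echi izc ?czc in a2 n2.
set K := 1 + _ in a1 a2 *; set f := shift _ _ psi1 in eq12 a1 n1 *.
have hG := adjoint_pair_dist p1 p2 e0 he.
have [_ _ _ aW1] := p1; have [_ _ _ aW2] := p2.
(* The unbounded main terms agree because [L] is symmetric on [psi1 - G1 psi1] and [chi - G2 chi],
   both in [dom H]; only differences of [G1] and [G2] survive. *)
have key : '[psi1 - psi2, psi1 - psi2] =
    '[G1 psi1 - G2 psi1, L (chi - G2 chi)] - '[L (psi1 - G1 psi1), G2 chi - G1 chi].
  rewrite -{2}echi dotBl.
  have -> : '[psi2, shift (Kop W2 G2) z^*%C chi] = '[f, chi].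
    by rewrite eq12 (shift_sym _ (Kop_sym p2)).
  rewrite shift_Kop /f shift_Kop.
  have eL : '[psi1 - G1 psi1, L (chi - G2 chi)] = '[L (psi1 - G1 psi1), chi - G2 chi].
    by rewrite sL.
  move: eL; move: (L (chi - G2 chi)) (L (psi1 - G1 psi1)) => y0 x0.
  have -> : '[psi1, (z^*%C - lam%:C) *: chi + (y0 - W2 y0)] =
      (z - lam%:C) * '[psi1, chi] + '[psi1, y0] - '[G2 psi1, y0].
    rewrite dotDr dotBr dotZr conjcB conjcK conjc_real addrA; congr (_ - _).
    by rewrite dotC aW2 -dotC.
  rewrite !(dotDl, dotNl, dotDr, dotNr, dotZl) aW1 => /eqP.
  rewrite subr_eq => /eqP ->; ring.
have bnd : hnorm (psi1 - psi2) ^+ 2 <=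
    e * hnorm psi1 * hnorm (L (chi - G2 chi)) +
    hnorm (L (psi1 - G1 psi1)) * (e * hnorm chi).
  rewrite hnorm_sq key raddfB /= -raddfN -dotNr opprB; apply: lerD.
    apply: (le_trans (dot_Re_le _ _)); rewrite ler_wpM2r ?hnorm_ge0//; exact: hG.
  by apply: (le_trans (dot_Re_le _ _)); rewrite ler_wpM2l ?hnorm_ge0//; exact: hG.
have K0 : 0 <= K.
  rewrite addr_ge0// divr_ge0// addr_ge0 ?cabs_ge0// mulr_ge0// addr_ge0//.
  by have [] := p1.
set i := `|complex.Im z| in i0 n1 n2 K K0 a1 a2 *.
apply: ler_hnorm_sq.
  by rewrite !mulr_ge0 ?invr_ge0 ?hnorm_ge0 ?(ltW i0).
apply: (le_trans bnd).
set N := hnorm (psi1 - psi2) in n2 a2 *.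
have m1 : hnorm psi1 <= hnorm f / i by rewrite ler_pdivlMr// mulrC.
have m2 : hnorm chi <= N / i by rewrite ler_pdivlMr// mulrC.
have N0 : 0 <= N by exact: hnorm_ge0.
have f0 : 0 <= hnorm f by exact: hnorm_ge0.
have t1 : hnorm psi1 * hnorm (L (chi - G2 chi)) <= hnorm f / i * (2 * K * N).
  by apply: ler_pM; rewrite ?hnorm_ge0.
have t2 : hnorm (L (psi1 - G1 psi1)) * hnorm chi <= 2 * K * hnorm f * (N / i).
  by apply: ler_pM; rewrite ?hnorm_ge0.
have -> : e * (4 * K / i) * hnorm f * N =
  e * (hnorm f / i * (2 * K * N)) + e * (2 * K * hnorm f * (N / i)) by field; rewrite gt_eqF.
rewrite -mulrA [X in _ + X]mulrCA.
by apply: lerD; apply: ler_wpM2l.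
Qed.

(** The solutions [p n] of the approximating equations are Cauchy by [Kop_dist]. To pass to the
    limit in the equation, [L (p n - Gn n (p n))] has to converge as well; closedness of [H] then
    puts the limit into the domain. *)
Lemma Kop_surj_lim (Wn Gn : nat -> F -> F) W G (c C : R) z :
  (forall n, adjoint_pair (Wn n) (Gn n) c) -> adjoint_pair W G c -> 0 <= C ->
  (forall n h, hnorm (Wn n h) <= 2^-1 * hnorm h + C * hnorm (R0 h)) ->
  (forall e : R, 0 < e -> exists N, forall n, (N <= n)%N -> forall x,
      hnorm (Wn n x - W x) <= e * hnorm x) ->
  complex.Im z != 0 ->
  (forall n, surjective_op (shift (Kop (Wn n) (Gn n)) z)) ->
  (forall n, surjective_op (shift (Kop (Wn n) (Gn n)) z^*%C)) ->
  surjective_op (shift (Kop W G) z).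
Proof.
move=> hWn hW C0 hC cvW z0 s1 s2 f.
have i0 : 0 < `|complex.Im z| by rewrite normr_gt0.
have /choice[p hp] : forall n, exists x, dom (Kop (Wn n) (Gn n)) x /\
    shift (Kop (Wn n) (Gn n)) z x = f.
  by move=> n; have [x h1 h2] := s1 n f; exists x.
have c0 : 0 <= c by have [] := hW.
pose K := 1 + (cabs (z - lam%:C) + C * (1 + c)) / `|complex.Im z|.
have K0 : 0 <= K.
  by rewrite addr_ge0// divr_ge0// addr_ge0 ?cabs_ge0// mulr_ge0// addr_ge0.
have cauW e : 0 < e -> exists N, forall m n, (N <= m)%N -> (N <= n)%N -> forall x,
    hnorm (Wn m x - Wn n x) <= e * hnorm x.
  move=> e0; have e2 : 0 < e / 2 by rewrite divr_gt0.
  have [N hN] := cvW _ e2; exists N => m n hm hn x.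
  apply: (le_trans (ler_hnorm_dist _ (W x) _)); rewrite (hnorm_distC (W x)).
  have := hN _ hm x; have := hN _ hn x; lra.
have cp : hcauchy p.
  move=> e e0; pose k := 4 * K / `|complex.Im z| * hnorm f.
  have k0 : 0 <= k by rewrite !mulr_ge0// ?hnorm_ge0// invr_ge0 ltW.
  have ek : 0 < e / (k + 1) by rewrite divr_gt0// ltr_wpDl.
  have [N hN] := cauW _ ek; exists N => m n hm hn.
  have := Kop_dist (hWn m) (hWn n) C0 (ltW ek) (hC m) (hC n) (hN _ _ hm hn) z0 (s2 n)
    (hp m).1 (hp n).1.
  rewrite (hp m).2 (hp n).2 => /(_ erefl) h; apply: (le_trans h).
  rewrite -mulrA -/K -/k mulrAC ler_pdivrMr ?ltr_wpDl//.
  by rewrite ler_wpM2l ?(ltW e0)// lerDl.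
have [q hq] := hcauchy_cvg cp.
pose p0 n := p n - Gn n (p n); pose hh n := L (p0 n).
have bh n : hnorm (hh n) <= 2 * K * hnorm f.
  have := Kop_apriori (hWn n) C0 (hC n) z0 (hp n).1.
  by rewrite (hp n).2.
have cvG : forall e : R, 0 < e -> exists N, forall n, (N <= n)%N -> forall x,
      hnorm (Gn n x - G x) <= e * hnorm x.
  move=> e e0; have [N hN] := cvW _ e0; exists N => n hn.
  exact: (adjoint_pair_dist (hWn n) hW (ltW e0) (hN _ hn)).
have [lG _ bG _] := adjoint_pair_sym hW.
have [lW _ bW _] := hW.
have GB x y : G (x - y) = G x - G y by exact: (adjoint_pairB _ _ (adjoint_pair_sym hW)).
have cvp0 : hcvg p0 (q - G q).
  apply: hcvgB => // e e0.
  have e2 : 0 < e / 2 by rewrite divr_gt0.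
  have [N1 h1] := hcvg_bnd GB bG hq e2.
  pose k := hnorm f / `|complex.Im z|.
  have k0 : 0 <= k by rewrite divr_ge0// hnorm_ge0.
  have ek : 0 < e / 2 / (k + 1) by rewrite !divr_gt0// ltr_wpDl.
  have [N2 h2] := cvG _ ek.
  exists (maxn N1 N2) => n; rewrite geq_max => /andP[/h1 /= hn1 /h2 hn2].
  have hpk : hnorm (p n) <= k.
    rewrite ler_pdivlMr// mulrC -(hp n).2.
    exact: sym_shift_bound (Kop_sym (hWn n)) (hp n).1.
  have {hn2} := hn2 (p n).
  have : e / 2 / (k + 1) * hnorm (p n) <= e / 2.
    rewrite mulrAC ler_pdivrMr ?ltr_wpDl// ler_wpM2l ?divr_ge0 ?(ltW e0)//.
    by rewrite (le_trans hpk)// lerDl.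
  have := ler_hnorm_dist (Gn n (p n)) (G (p n)) (G q); lra.
have ehh n : hh n = f - (z - lam%:C) *: p n + Wn n (hh n).
  rewrite -{1}(hp n).2 shift_Kop -/(p0 n) -/(hh n); vector_ring.
(* The difference of [ehh] at [m] and [n] bounds [hh m - hh n] by half of itself plus three errors
   of size e / 6: those of [p], of [p0] and of the operators [Wn] on the bounded sequence [hh].
   Absorbing the half doubles e / 2 to e. *)
have ch : hcauchy hh.
  move=> e e0.
  have k0 : 0 <= 2 * K * hnorm f by rewrite !mulr_ge0 ?hnorm_ge0.
  set k := 2 * K * hnorm f in k0 bh.
  have cz0 := cabs_ge0 (z - lam%:C).
  have e8 : 0 < e / 6 by rewrite divr_gt0.
  have ek1 : 0 < e / 6 / (cabs (z - lam%:C) + 1) by rewrite divr_gt0// ltr_wpDl.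
  have ek2 : 0 < e / 6 / (k + 1) by rewrite divr_gt0// ltr_wpDl.
  have ek3 : 0 < e / 12 / (C + 1) by rewrite !divr_gt0// ltr_wpDl.
  have [N1 h1] := cp _ ek1; have [N2 h2] := cauW _ ek2; have [N3 h3] := cvp0 _ ek3.
  exists (maxn N1 (maxn N2 N3)) => m n; rewrite !geq_max.
  move=> /andP[m1 /andP[m2 m3]] /andP[n1 /andP[n2 n3]].
  have {h1} q1 := h1 _ _ m1 n1; have {h2} q2 := h2 _ _ m2 n2 (hh n).
  have q3 : hnorm (p0 m - p0 n) <= 2 * (e / 12 / (C + 1)).
    have := h3 _ m3; have := h3 _ n3; rewrite (hnorm_distC (p0 n)).
    have := ler_hnorm_dist (p0 m) (q - G q) (p0 n); lra.
  have q4 := hC m (hh m - hh n).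
  have dp0 : dom H (p0 m) /\ dom H (p0 n) by split; [exact: (hp m).1|exact: (hp n).1].
  have eR : R0 (hh m - hh n) = p0 m - p0 n.
    rewrite /hh -(linear_opB lL)//; try by [exact: dp0.1|exact: dp0.2].
    apply: resolvent_shift; apply: subspaceB dp0.1 dp0.2.
    exact: linear_op_dom sH.1.
  rewrite eR in q4.
  have q5 : hnorm (hh m - hh n) <= cabs (z - lam%:C) * hnorm (p m - p n) +
      hnorm (Wn m (hh m - hh n)) + hnorm (Wn m (hh n) - Wn n (hh n)).
    rewrite {1}(ehh m) {1}(ehh n) (adjoint_pairB _ _ (hWn m)).
    have -> : f - (z - lam%:C) *: p m + Wn m (hh m) -
       (f - (z - lam%:C) *: p n + Wn n (hh n)) =
       (z - lam%:C) *: (p n - p m) + (Wn m (hh m) - Wn m (hh n)) +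
       (Wn m (hh n) - Wn n (hh n)).
      by vector_ring.
    apply: (le_trans (ler_hnormD _ _)); rewrite lerD2r.
    apply: (le_trans (ler_hnormD _ _)); rewrite lerD2r hnormZ.
    by rewrite (hnorm_distC (p n)).
  have r1 : cabs (z - lam%:C) * hnorm (p m - p n) <= e / 6.
    move: q1; rewrite ler_pdivlMr ?ltr_wpDl//.
    have := hnorm_ge0 (p m - p n); nra.
  have r2 : hnorm (Wn m (hh n) - Wn n (hh n)) <= e / 6.
    apply: (le_trans q2); rewrite mulrAC ler_pdivrMr ?ltr_wpDl//.
    rewrite ler_wpM2l ?(ltW e8)//; apply: (le_trans (bh n)); by rewrite lerDl.
  have r3 : C * hnorm (p0 m - p0 n) <= e / 6.
    have : C * (2 * (e / 12 / (C + 1))) <= e / 6.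
      have -> : C * (2 * (e / 12 / (C + 1))) = C / (C + 1) * (e / 6).
        by field; rewrite gt_eqF// ltr_wpDl.
      rewrite ler_piMl ?(ltW e8)// ler_pdivrMr ?ltr_wpDl// mul1r; lra.
    by apply: le_trans; rewrite ler_wpM2l.
  lra.
have [k hk] := hcauchy_cvg ch.
have [dq ek] := closed_graph_shift (z := lam%:C) (maxsym_closed mH)
  (fun n => (hp n).1 : dom (shift H lam%:C) (p0 n)) cvp0 hk.
exists q; first exact: dq.
rewrite shift_Kop /L ek.
have WB x y : W (x - y) = W x - W y by exact: adjoint_pairB hW.
apply: (@hcvg_uniq _ _ (fun n => (z - lam%:C) *: p n + (hh n - Wn n (hh n)))); last first.
  have -> : (fun n => (z - lam%:C) *: p n + (hh n - Wn n (hh n))) = fun=> f.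
    apply/funext => n; rewrite -[RHS](hp n).2 shift_Kop //.
  exact: hcvg_cst.
apply: hcvgD; first exact: hcvgZ.
apply: hcvgB => // e e0.
have e2 : 0 < e / 2 by rewrite divr_gt0.
have [N1 h1] := hcvg_bnd WB bW hk e2.
have k0 : 0 <= 2 * K * hnorm f by rewrite !mulr_ge0 ?hnorm_ge0.
have ek2 : 0 < e / 2 / (2 * K * hnorm f + 1) by rewrite !divr_gt0// ltr_wpDl.
have [N2 h2] := cvW _ ek2.
exists (maxn N1 N2) => n; rewrite geq_max => /andP[/h1 /= hn1 /h2 hn2].
have {hn2} := hn2 (hh n).
have : e / 2 / (2 * K * hnorm f + 1) * hnorm (hh n) <= e / 2.
  rewrite mulrAC ler_pdivrMr ?ltr_wpDl// ler_wpM2l ?divr_ge0 ?(ltW e0)//.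
  by rewrite (le_trans (bh n))// lerDl.
have := ler_hnorm_dist (Wn n (hh n)) (W (hh n)) (W k); lra.
Qed.

End SingularSum.

(** * Perturbation of norm resolvent limits *)

Section Perturbation.
Context {R : realType} {F : hilbertType R}.
Implicit Types (T K : operator F) (z : R[i]).
Implicit Types (psi phi chi u f g w h : F).

Lemma surj_dense T z : symmetric_op T -> complex.Im z != 0 ->
  surjective_op (shift T z) -> dense (dom T).
Proof.
move=> sT z0 hs; apply: orth_trivial_dense; first exact: linear_op_dom sT.1.
move=> w hw; have [chi dchi e] := hs w.
have := Im_shift z sT dchi; rewrite e dotC hw//= oppr0 => /esym/eqP.
rewrite mulf_eq0 (negPf z0) sqrf_eq0 /= => /eqP/hnorm_eq0 chi0.
by rewrite -e chi0 /= linear_op0 ?oppr0 ?scaler0 ?addr0//; exact: sT.1.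
Qed.

(** The first resolvent identity, used on both sides, gives R1(z) - R2(z) = (1 + (z0 - z) R1(z))
    (R1(z0) - R2(z0)) (1 + (z0 - z) R2(z)). *)
Lemma resolvent_change T1 T2 z0 z f : symmetric_op T1 -> symmetric_op T2 ->
  resolvent_set T1 z0 -> resolvent_set T1 z ->
  resolvent_set T2 z0 -> resolvent_set T2 z ->
  let g := f + (z0 - z) *: resolvent T2 z f in
  let d := resolvent T1 z0 g - resolvent T2 z0 g in
  resolvent T1 z f - resolvent T2 z f = d + (z0 - z) *: resolvent T1 z d.
Proof.
move=> s1 s2 /resolventP h10 /resolventP h1 /resolventP h20 /resolventP h2 g d.
have lin T y : is_resolvent T y (resolvent T y) ->
    forall a x x', resolvent T y (a *: x + x') = a *: resolvent T y x + resolvent T y x'.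
  by move=> [[[_ h] _ _] _ _] a x x'; have [] := h a x x' I I.
have linB T y : is_resolvent T y (resolvent T y) ->
    forall x x', resolvent T y (x - x') = resolvent T y x - resolvent T y x'.
  by move=> /lin h x x'; rewrite addrC -scaleN1r h scaleN1r addrC.
have id T y y' f' : is_resolvent T y (resolvent T y) ->
    is_resolvent T y' (resolvent T y') ->
    resolvent T y (f' + (y - y') *: resolvent T y' f') = resolvent T y' f'.
  move=> [_ _ hy] [_ hy' _]; have [d' e'] := hy' f'.
  rewrite -{1}e' -[RHS]hy//; congr (resolvent T y _); vector_ring.
have e2 : resolvent T2 z0 g = resolvent T2 z f by rewrite /g id.
have e3 x : resolvent T1 z0 x + (z0 - z) *: resolvent T1 z (resolvent T1 z0 x) =
    resolvent T1 z x.
  have := id T1 z z0 x h1 h10; rewrite addrC lin// => {1}<-; vector_ring.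
rewrite /d (linB _ _ h1) e2.
have -> : resolvent T1 z0 g - resolvent T2 z f + (z0 - z) *:
    (resolvent T1 z (resolvent T1 z0 g) - resolvent T1 z (resolvent T2 z f)) =
    resolvent T1 z0 g + (z0 - z) *: resolvent T1 z (resolvent T1 z0 g) -
    (resolvent T2 z f + (z0 - z) *: resolvent T1 z (resolvent T2 z f)) by vector_ring.
rewrite e3 /g addrC (addrC f) lin//; vector_ring.
Qed.

(** With [nrm] the norm of [F] this is convergence in operator norm; with a graph norm on [D] it is
    the convergence assumed towards T_S. *)
Definition unif_cvg (D : set F) (Bn : nat -> F -> F) (B : F -> F) (nrm : F -> R) :=
  forall e : R, 0 < e -> exists N, forall n, (N <= n)%N -> forall x, D x ->
    hnorm (Bn n x - B x) <= e * nrm x.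

Lemma resolvent_cvg_change (Tn : nat -> operator F) T z0 z :
  (forall n, symmetric_op (Tn n)) -> symmetric_op T ->
  complex.Im z0 != 0 -> complex.Im z != 0 ->
  (forall n, resolvent_set (Tn n) z0) -> (forall n, resolvent_set (Tn n) z) ->
  resolvent_set T z0 -> resolvent_set T z ->
  unif_cvg setT (fun n => resolvent (Tn n) z0) (resolvent T z0) hnorm ->
  unif_cvg setT (fun n => resolvent (Tn n) z) (resolvent T z) hnorm.
Proof.
move=> sn sT z00 zz hn0 hn h0 h1 cv e e0.
pose k := 1 + cabs (z0 - z) / `|complex.Im z|.
have i0 : 0 < `|complex.Im z| by rewrite normr_gt0.
have k1 : 1 <= k by rewrite lerDl divr_ge0 ?cabs_ge0.
have k0 : 0 < k by apply: lt_le_trans k1.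
(* [k] bounds 1 + (z0 - z) R(z) for every symmetric operator, and [resolvent_change] has two such
   factors. *)
have ek : 0 < e / (k * k) by rewrite divr_gt0// mulr_gt0.
have bnd T' f : symmetric_op T' -> resolvent_set T' z ->
    hnorm (f + (z0 - z) *: resolvent T' z f) <= k * hnorm f.
  move=> sT' /resolventP hT'; apply: (le_trans (ler_hnormD _ _)).
  rewrite hnormZ mulrDl mul1r lerD2l -mulrA ler_wpM2l ?cabs_ge0//.
  by rewrite ler_pdivlMl// (resolvent_Im_bound _ sT' hT').
have [N hN] := cv _ ek; exists N => n Nn f _.
rewrite (@resolvent_change _ _ z0)//.
apply: (le_trans (bnd _ _ (sn n) (hn n))).
have := hN n Nn (f + (z0 - z) *: resolvent T z f) I.
set X := hnorm _; set Y := hnorm _ => hX.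
have hY : Y <= k * hnorm f by exact: bnd.
have -> : e * hnorm f = k * (e / (k * k) * (k * hnorm f)) by field; rewrite gt_eqF.
apply: ler_wpM2l; first exact: ltW.
by apply: (le_trans hX); rewrite ler_wpM2l// ltW.
Qed.

(** * Relatively bounded perturbations of a convergent sequence *)

Variables (K : operator F) (Kn : nat -> operator F) (V : F -> F) (Vn : nat -> F -> F).
Variables (a b : R).
Hypothesis (sK : symmetric_op K) (mKn : forall n, maximal_symmetric (Kn n)).
Hypothesis surjK : forall z, complex.Im z != 0 -> surjective_op (shift K z).
Hypothesis cvK : forall z, complex.Im z != 0 -> forall e : R, 0 < e ->
  exists N, forall n, (N <= n)%N -> forall psi phi, dom K psi -> dom (Kn n) phi ->
    shift (Kn n) z phi = shift K z psi -> hnorm (phi - psi) <= e * hnorm (shift K z psi).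
Hypothesis lV : linear_on (dom K) V.
Hypothesis sV : forall psi phi, dom K psi -> dom K phi -> '[V psi, phi] = '[psi, V phi].
Hypothesis lVn : forall n, linear_on setT (Vn n).
Hypothesis bVn : forall n, exists c : R, forall x, hnorm (Vn n x) <= c * hnorm x.
Hypothesis sVn : forall n x y, '[Vn n x, y] = '[x, Vn n y].
Hypothesis a01 : 0 <= a < 1.
Hypothesis smallVn : forall n psi, dom (Kn n) psi ->
  hnorm (Vn n psi) <= a * hnorm (Kn n psi) + b * hnorm psi.
Hypothesis cvV : unif_cvg (dom K) Vn V (fun x => hnorm (V x) + hnorm x).

Let KV : operator F := Operator (dom K) (fun psi => K psi + V psi).
Let KVn n : operator F := Operator (dom (Kn n)) (fun psi => Kn n psi + Vn n psi).

Let q (e : R) := a + `|b| / `|e|.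

(** For fixed [n] the perturbation is bounded, hence of relative bound 0 with a constant that may
    depend on [n]. *)
Lemma perturbed_maxsym n : maximal_symmetric (KVn n).
Proof.
have [c hc] := bVn n.
apply: (@kato_rellich _ _ _ _ 0 c) => //; first by rewrite lexx ltr01.
- by move=> d x y _ _; exact: lVn.
- by move=> x _; rewrite mul0r add0r.
Qed.

Let smallVn_imag n (e : R) psi : e != 0 -> dom (Kn n) psi ->
  hnorm (Vn n psi) <= q e * hnorm (shift (Kn n) (imag e) psi).
Proof.
move=> e0 h; apply: (le_trans (smallVn h)).
by apply: sym_small_imag => //; [exact: (mKn n).1|case/andP: a01].
Qed.

(* The relative bound is inherited by the limit: V P is the weak limit of
   [Vn Pn], where P and [Pn] are the resolvents of K and [Kn]. *)
Lemma small_limit (e : R) psi : e != 0 -> dom K psi ->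
  hnorm (V psi) <= q e * hnorm (shift K (imag e) psi).
Proof.
move=> e0 dpsi; have ie0 : complex.Im (imag e) != 0 by [].
have ae0 : 0 < `|e| by rewrite normr_gt0.
have q0 : 0 <= q e by have /andP[? _] := a01; rewrite addr_ge0// divr_ge0.
set f := shift K _ psi.
apply: (dense_Re_bound (surj_dense sK ie0 (surjK ie0))).
  by rewrite mulr_ge0 ?hnorm_ge0.
move=> w dw; apply/ler_addgt0Pl => d d0; rewrite sV//.
pose k := hnorm f * hnorm (V w) + hnorm f / `|e| * (hnorm (V w) + hnorm w).
have k0 : 0 <= k.
  by rewrite addr_ge0 ?mulr_ge0 ?addr_ge0 ?invr_ge0 ?hnorm_ge0.
have dk : 0 < d / (k + 1) by rewrite divr_gt0// ltr_wpDl.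
have [N1 h1] := cvK ie0 dk; have [N2 h2] := cvV dk.
pose n := maxn N1 N2.
have [phi dphi ephi] := maxsym_surj (mKn n) ie0 f.
have r1 := h1 n (leq_maxl _ _) psi phi dpsi dphi ephi; rewrite -/f in r1.
have r2 := h2 n (leq_maxr _ _) w dw.
(* The first term carries the uniform bound [q e]. The other two become small, as [phi] tends to
   [psi] by [cvK] and [Vn n w] to [V w] by [cvV]; [k] collects their coefficients. *)
have -> : '[psi, V w] = '[Vn n phi, w] + '[psi - phi, V w] + '[phi, V w - Vn n w].
  by rewrite dotBl dotBr sVn; ring.
rewrite !raddfD /=.
have t1 : complex.Re '[Vn n phi, w] <= q e * hnorm f * hnorm w.
  apply: (le_trans (dot_Re_le _ _)); rewrite ler_wpM2r ?hnorm_ge0//.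
  by rewrite -ephi; exact: smallVn_imag.
have t2 : complex.Re '[psi - phi, V w] <= d / (k + 1) * (hnorm f * hnorm (V w)).
  apply: (le_trans (dot_Re_le _ _)); rewrite mulrA ler_wpM2r ?hnorm_ge0//.
  by rewrite hnorm_distC.
have t3 : complex.Re '[phi, V w - Vn n w] <=
    d / (k + 1) * (hnorm f / `|e| * (hnorm (V w) + hnorm w)).
  apply: (le_trans (dot_Re_le _ _)); rewrite mulrCA.
  apply: ler_pM; rewrite ?hnorm_ge0//; last by rewrite hnorm_distC.
  rewrite ler_pdivlMr// mulrC -ephi.
  exact: (sym_shift_bound (imag e) (mKn n).1 dphi).
have t4 : d / (k + 1) * k <= d.
  by rewrite mulrAC ler_pdivrMr ?ltr_wpDl// ler_wpM2l ?(ltW d0)// lerDl.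
rewrite /k mulrDr in t4; rewrite -/k in t4; lra.
Qed.

(** [small_limit] bounds [V] by the shift of [K] at each imaginary point rather than by the graph
    norm with the constant [a], so surjectivity is shown directly at the two points plus and minus i
    e. *)
Lemma limit_maxsym : maximal_symmetric KV.
Proof.
have /andP[a0 a1] := a01.
have [e e0 he] := exists_imag b a1.
have aux d : `|d| = e -> d != 0 -> surjective_op (shift KV (imag d)).
  move=> de d0; apply: (@perturbed_surj _ _ _ _ _ (q d)) => //.
  - exact: surjK.
  - by rewrite /q de.
  - by move=> psi h; exact: small_limit.
apply: (@surj_maxsym _ _ _ (imag e)).
- exact: symmetric_add.
- by rewrite gt_eqF.
- by apply: aux; [rewrite gtr0_norm|rewrite gt_eqF].
- have -> : (imag e)^*%C = imag (- e) by [].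
  by apply: aux; [rewrite normrN gtr0_norm|rewrite oppr_eq0 gt_eqF].
Qed.

Lemma perturbed_cvg_imag (e : R) : 0 < e -> q e < 1 ->
  unif_cvg setT (fun n => resolvent (KVn n) (imag e)) (resolvent KV (imag e)) hnorm.
Proof.
move=> e0 q1 d d0; have ie0 : complex.Im (imag e) != 0 by rewrite gt_eqF.
have ee0 : e != 0 by rewrite gt_eqF.
have q0 : 0 <= q e by have /andP[? _] := a01; rewrite addr_ge0// divr_ge0.
have q1' : 0 < 1 - q e by rewrite subr_gt0.
have ae : `|e| = e by rewrite gtr0_norm.
(* One factor 1 / (1 - q) comes from absorbing q ||p - x||, the other from ||g|| <= ||f|| / (1 - q).
   In the numerator, [y2] contributes the first summand and [phi - x] the 1. *)
pose k := (e^-1 * (q e + e^-1) + 1) / (1 - q e) / (1 - q e).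
have ei0 : 0 <= e^-1 by rewrite invr_ge0 ltW.
have kk0 : 0 <= e^-1 * (q e + e^-1) + 1.
  by apply: addr_ge0 => //; apply: mulr_ge0 => //; exact: addr_ge0.
have k0 : 0 <= k by apply: divr_ge0 (ltW q1'); apply: divr_ge0 kk0 (ltW q1').
have dk : 0 < d / (k + 1) by rewrite divr_gt0// ltr_wpDl.
have [N1 h1] := cvK ie0 dk; have [N2 h2] := cvV dk.
exists (maxn N1 N2) => n; rewrite geq_max => /andP[/h1 r1 /h2 r2] f _ {h1 h2}.
have [_ hB _] := resolventP (maxsym_resolvent (perturbed_maxsym n) ie0).
have [_ hB' _] := resolventP (maxsym_resolvent limit_maxsym ie0).
have [dp ep] := hB f; have [dq eq] := hB' f.
set p := resolvent (KVn n) _ f in dp ep *.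
set x := resolvent KV _ f in dq eq *.
rewrite /= in dp ep dq eq.
pose g := shift K (imag e) x.
have eg : g = f + V x by rewrite /g -eq /=; vector_ring.
have hVx : hnorm (V x) <= q e * hnorm g by exact: small_limit.
have hg : (1 - q e) * hnorm g <= hnorm f.
  have := ler_hnormD f (V x); rewrite -eg; lra.
have [phi dphi ephi] := maxsym_surj (mKn n) ie0 g.
have s1 := r1 _ _ dq dphi ephi; rewrite -/g in s1.
have s2 := r2 _ dq.
have hx : hnorm x <= hnorm g / e.
  by rewrite ler_pdivlMr// mulrC -{1}ae; exact: (sym_shift_bound (imag e) sK dq).
have [y1 dy1 ey1] := maxsym_surj (mKn n) ie0 (Vn n (p - x)).
have [y2 dy2 ey2] := maxsym_surj (mKn n) ie0 (Vn n x - V x).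
have VnB u v : Vn n (u - v) = Vn n u - Vn n v.
  by rewrite addrC -scaleN1r lVn// scaleN1r addrC.
have lS := linear_op_shift (imag e) (mKn n).1.1.
have ey : p - phi = y1 + y2.
  apply: (@sym_shift_inj _ _ (Kn n) (imag e)) => //.
  - exact: (mKn n).1.
  - apply: subspaceB dp dphi; exact: linear_op_dom (mKn n).1.1.
  - apply: subspaceD dy1 dy2; exact: linear_op_dom (mKn n).1.1.
  - rewrite (linear_opB lS dp dphi) (linear_opD lS dy1 dy2) ey1 ey2 ephi VnB eg -ep.
    by rewrite /=; vector_ring.
have n2 : hnorm y2 <= e^-1 * (d / (k + 1) * (hnorm (V x) + hnorm x)).
  rewrite ler_pdivlMl//; apply: le_trans s2; rewrite -ey2 -{1}ae.
  exact: (sym_shift_bound (imag e) (mKn n).1 dy2).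
(* [x] need not lie in [dom (Kn n)], so the relative bound cannot be applied to [p - x]. It is
   applied to [w] instead: the inverse shift followed after [Vn] is the adjoint of [Vn] after the
   inverse shift at the conjugate point. *)
have n1 : hnorm y1 <= q e * hnorm (p - x).
  have ie0' : complex.Im (imag e)^*%C != 0 by rewrite Im_conjc oppr_eq0.
  have [w dw ew] := maxsym_surj (mKn n) ie0' y1.
  apply: ler_hnorm_sq; first by rewrite mulr_ge0 ?hnorm_ge0.
  have -> : hnorm y1 ^+ 2 = complex.Re '[p - x, Vn n w].
    by rewrite hnorm_sq -{2}ew -sVn -ey1 (shift_sym _ (mKn n).1).
  apply: (le_trans (dot_Re_le _ _)); rewrite (mulrC (q e)) -mulrA.
  rewrite ler_wpM2l ?hnorm_ge0//.
  have -> : hnorm y1 = hnorm (shift (Kn n) (imag (- e)) w) by rewrite -ew.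
  have -> : q e = q (- e) by rewrite /q normrN.
  by apply: smallVn_imag => //; rewrite oppr_eq0.
have h3 : hnorm (p - x) <= hnorm y1 + hnorm y2 + hnorm (phi - x).
  have := ler_hnorm_dist p phi x; rewrite ey; have := ler_hnormD y1 y2; lra.
have h4 : (1 - q e) * hnorm (p - x) <= d / (k + 1) * ((e^-1 * (q e + e^-1) + 1) * hnorm g).
  have dk0 := ltW dk.
  have : e^-1 * (d / (k + 1) * (hnorm (V x) + hnorm x)) <=
      e^-1 * (d / (k + 1) * (q e * hnorm g + hnorm g / e)).
    by rewrite ler_wpM2l// ler_wpM2l// lerD.
  have -> : d / (k + 1) * ((e^-1 * (q e + e^-1) + 1) * hnorm g) =
     e^-1 * (d / (k + 1) * (q e * hnorm g + hnorm g / e)) + d / (k + 1) * hnorm g.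
    by ring.
  lra.
have h5 : hnorm g <= hnorm f / (1 - q e) by rewrite ler_pdivlMr// mulrC.
have h6 : hnorm (p - x) <= d / (k + 1) * (k * hnorm f).
  rewrite -(ler_pM2l q1'); apply: (le_trans h4).
  rewrite [leRHS]mulrCA ler_wpM2l ?(ltW dk)//.
  have -> : (1 - q e) * (k * hnorm f) =
      (e^-1 * (q e + e^-1) + 1) * (hnorm f / (1 - q e)).
    by rewrite /k; field; rewrite !gt_eqF.
  exact: ler_wpM2l.
apply: (le_trans h6); rewrite mulrA mulrAC -!mulrA ler_wpM2l ?(ltW d0)//.
rewrite mulrCA ler_piMr ?hnorm_ge0//.
by rewrite mulrC ler_pdivrMr ?ltr_wpDl// mul1r lerDl.
Qed.

Lemma perturbed_cvg z : complex.Im z != 0 ->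
  unif_cvg setT (fun n => resolvent (KVn n) z) (resolvent KV z) hnorm.
Proof.
move=> z0; have /andP[a0 a1] := a01; have [e e0 he] := exists_imag b a1.
have ie0 : complex.Im (imag e) != 0 by rewrite gt_eqF.
have mKV := limit_maxsym.
apply: (@resolvent_cvg_change KVn KV (imag e)) => //.
- by move=> n; exact: (perturbed_maxsym n).1.
- exact: mKV.1.
- by move=> n; exact: maxsym_resolvent (perturbed_maxsym n) ie0.
- by move=> n; exact: maxsym_resolvent (perturbed_maxsym n) z0.
- exact: maxsym_resolvent mKV ie0.
- exact: maxsym_resolvent mKV z0.
- by apply: perturbed_cvg_imag => //; rewrite /q (gtr0_norm e0).
Qed.

End Perturbation.

(** * Spectral measures *)

Section SpectralMeasure.
Context {R : realType} {F : hilbertType R}.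
Implicit Types (B C : set R) (psi phi chi : F).
Variable (E : set R -> F -> F).
Hypothesis hE : projection_valued_measure E.

Let sE B : measurable B -> symmetric_op (Defs.total (E B)).
Proof. by move=> mB; have [h _ _] := hE; have [] := h B mB. Qed.

Let EE B psi : measurable B -> E B (E B psi) = E B psi.
Proof. by move=> mB; have [h _ _] := hE; have [_ ->] := h B mB. Qed.

Lemma pvm_linear B a psi phi : measurable B ->
  E B (a *: psi + phi) = a *: E B psi + E B phi.
Proof. by move=> /sE[[_ h] _]; have [_] := h a psi phi I I. Qed.

Lemma pvm_sym B psi phi : measurable B -> '[E B psi, phi] = '[psi, E B phi].
Proof. by move=> /sE[_ h]; exact: h. Qed.

Lemma pvm_sq B psi : measurable B ->
  complex.Re '[E B psi, psi] = hnorm (E B psi) ^+ 2.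
Proof. by move=> mB; rewrite hnorm_sq -pvm_sym// EE. Qed.

Lemma pvm_le B psi : measurable B -> hnorm (E B psi) <= hnorm psi.
Proof.
move=> mB; apply: ler_hnorm_sq; first exact: hnorm_ge0.
by rewrite -pvm_sq// mulrC; exact: dot_Re_le.
Qed.

Lemma pvmB B psi phi : measurable B -> E B (psi - phi) = E B psi - E B phi.
Proof. by move=> mB; rewrite addrC -scaleN1r pvm_linear// scaleN1r addrC. Qed.

Lemma pvmN B psi : measurable B -> E B (- psi) = - E B psi.
Proof.
move=> mB; rewrite -[- psi]sub0r pvmB//.
by have := linear_op0 (sE mB).1; rewrite /= => ->; rewrite sub0r.
Qed.

Lemma pvmD B psi phi : measurable B -> E B (psi + phi) = E B psi + E B phi.
Proof. by move=> mB; rewrite -{1}[psi]scale1r pvm_linear// scale1r. Qed.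

Lemma pvm0 psi : E set0 psi = 0.
Proof.
have [_ _ h] := hE.
have t0 : trivIset [set: nat] (fun=> set0 : set R) by exact: trivIset_set0.
have /hcvgP hc := h (fun=> set0) (fun=> measurable0) t0 psi.
apply: hnorm_eq0; apply: small_eq0 => [|e e0]; first exact: hnorm_ge0.
have e2 : 0 < e / 2 by rewrite divr_gt0.
have [N hN] := hc _ e2.
have := hN N (leqnn _); have := hN N.+1 (leqnSn _).
(* Consecutive partial sums of the constant empty family have the same limit and differ by
   [E set0 psi]. *)
rewrite big_nat_recr//=.
set X := \sum_(_ <= _ < _) _; set Y := E (\bigcup_ _ _) _; set Z := E _ _ => h1 h2.
have -> : Z = (X + Z - Y) - (X - Y) by vector_ring.
have := ler_hnormB (X + Z - Y) (X - Y); lra.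
Qed.

Lemma pvmU B C psi : measurable B -> measurable C -> B `&` C = set0 ->
  E (B `|` C) psi = E B psi + E C psi.
Proof.
move=> mB mC BC; have [_ _ h] := hE.
have mS k : measurable (bigcup2 B C k) by rewrite /=; do 2?case: ifP.
have tS : trivIset setT (bigcup2 B C) by move: BC; rewrite trivIset_bigcup2.
have /hcvgP hc := h _ mS tS psi.
rewrite bigcup2E in hc.
apply: (hcvg_uniq hc) => e e0; exists 2%N => n n2.
have -> : \sum_(0 <= k < n) E (bigcup2 B C k) psi = E B psi + E C psi.
  rewrite -(subnKC n2) big_nat_recl// big_nat_recl//= /bigcup2/=.
  rewrite big1 ?addr0// => k _; exact: pvm0.
by rewrite subrr hnorm0 ltW.
Qed.

(* The sum of two projections is a projection only if they are orthogonal. *)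
Lemma pvm_disjoint B C psi : measurable B -> measurable C -> B `&` C = set0 ->
  E B (E C psi) = 0.
Proof.
move=> mB mC BC.
have mU : measurable (B `|` C) by exact: measurableU.
have anti x : E B (E C x) = - E C (E B x).
  have := EE x mU; rewrite !pvmU// !pvmD// !EE//.
  move: (E B x) (E C x) (E B (E C x)) (E C (E B x)) => p q r s e.
  have e' : p + r + (s + q) - (p + q) = 0 by rewrite e subrr.
  have e2 : r + s = 0 by rewrite -e'; vector_ring.
  by apply/eqP; rewrite -addr_eq0; apply/eqP.
(* Anticommutation is used twice: with idempotence it makes [E B (E C psi)] equal to its own
   negative. *)
have e1 : E B (E C (E B psi)) = E B (E C psi) by rewrite anti EE// -anti.
have e2 : E B (E C psi) = - E B (E C psi).
  by rewrite -{1}(EE (E C psi) mB) {1}anti pvmN// e1.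
move/eqP: e2; rewrite -addr_eq0 -mulr2n -scaler_nat scaler_eq0 pnatr_eq0.
by move/eqP.
Qed.

Lemma pvmI B C psi : measurable B -> measurable C ->
  E B (E C psi) = E (B `&` C) psi.
Proof.
move=> mB mC.
have dec X Y phi : measurable X -> measurable Y ->
    E X phi = E (X `&` Y) phi + E (X `\` Y) phi.
  move=> mX mY; rewrite -pvmU ?setUIDK//; [exact: measurableI|exact: measurableD|].
  by rewrite setDE setIACA setICr setI0.
rewrite (dec C B)// pvmD// (pvm_disjoint _ mB (measurableD mC mB)) ?setDIK// addr0.
rewrite [LHS](dec B C)// (setIC C B) EE//; last exact: measurableI.
rewrite [X in _ + X]pvm_disjoint ?addr0//; [exact: measurableD|exact: measurableI|].
by rewrite setDE setIACA setICl setI0.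
Qed.

(* A measure in the sense of the library is nonnegative on every set, so the
   value on a set that is not Borel is set to 0. *)
Definition pvm_mu (h : projection_valued_measure E) psi : set R -> \bar R :=
  fun B => if `[< measurable B >] then (hnorm (E B psi) ^+ 2)%:E else 0%E.

Lemma pvm_muE psi B : measurable B -> pvm_mu hE psi B = (hnorm (E B psi) ^+ 2)%:E.
Proof. by move=> mB; rewrite /pvm_mu asboolT. Qed.

Lemma pvm_mu_spectral psi B : measurable B -> spectral_mu E psi B = pvm_mu hE psi B.
Proof. by move=> mB; rewrite pvm_muE// /spectral_mu pvm_sq. Qed.

Lemma pvm_muT psi : pvm_mu hE psi setT = (hnorm psi ^+ 2)%:E.
Proof. by rewrite pvm_muE//; have [_ -> _] := hE. Qed.

Let mu0 psi : pvm_mu hE psi set0 = 0%E.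
Proof. by rewrite pvm_muE// pvm0 hnorm0 expr0n. Qed.

Let mu_ge0 psi B : (0 <= pvm_mu hE psi B)%E.
Proof. by rewrite /pvm_mu; case: ifP => // _; rewrite lee_fin sqr_ge0. Qed.

Let mu_sigma psi : semi_sigma_additive (pvm_mu hE psi).
Proof.
move=> B mB tB mU; have [_ _ h] := hE; have /hcvgP hc := h B mB tB psi.
rewrite pvm_muE//.
have -> : (fun n => \sum_(0 <= i < n) pvm_mu hE psi (B i))%E =
    (fun n => (complex.Re '[\sum_(0 <= i < n) E (B i) psi, psi])%:E).
  apply/funext => n; rewrite linear_sumlz raddf_sum -sumEFin /=.
  by apply: eq_bigr => i _; rewrite pvm_muE// pvm_sq.
apply: cvg_EFin; first by apply: nearW.
apply/cvgrPdist_le => e e0; have [N hN] := hcvg_dot psi hc e0.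
exists N => // n /hN /= {}hN; rewrite distrC -pvm_sq// -raddfB.
rewrite -lecR; apply: (le_trans (normc_ge_Re _)).
by rewrite cabsE lecR.
Qed.

HB.instance Definition _ psi := isMeasure.Build _ _ _ (pvm_mu hE psi)
  (mu0 psi) (mu_ge0 psi) (@mu_sigma psi).

Let mu_fin psi : fin_num_fun (pvm_mu hE psi).
Proof. by move=> B mB; rewrite pvm_muE. Qed.

HB.instance Definition _ psi := Measure_isFinite.Build _ _ _ (pvm_mu hE psi)
  (@mu_fin psi).

End SpectralMeasure.

(** * Form bounds from the spectral measure *)

Section SpectralBounds.
Context {R : realType} {F : hilbertType R}.
Implicit Types (psi phi chi : F).
Variables (H : operator F) (E : set R -> F -> F) (m : R).
Hypothesis hE : projection_valued_measure E.
Hypothesis hI : spectral_integral E id H.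
Hypothesis hm : forall psi, dom H psi ->
  (m * hnorm psi ^+ 2)%:C <= '[H psi, psi].

Local Notation mu psi := (pvm_mu hE psi).

Import HBNNSimple.

Lemma spectral_sintegral psi (h : {nnsfun R >-> R}) :
  sintegral (spectral_mu E psi) h = sintegral (mu psi) h.
Proof. by apply: eq_fsbigr => x _; rewrite pvm_mu_spectral. Qed.

(** The integral evaluates its measure only on preimages under simple functions. These are Borel
    sets, where the two set functions agree, so the theorems on measures become available for
    [spectral_mu]. *)
Lemma spectral_integralE psi (f : R -> \bar R) :
  (\int[spectral_mu E psi]_x f x = \int[mu psi]_x f x)%E.
Proof.
rewrite /integral; congr (ereal_sup _ - ereal_sup _)%E;
  apply: eq_imagel => h _; exact: spectral_sintegral.
Qed.

Let msq : measurable_fun [set: R] (fun x : R => (x ^+ 2)%:E).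
Proof. by apply/measurable_EFinP; exact: measurable_funX. Qed.

Let maff (a b : R) : measurable_fun [set: R] (fun x : R => (a * x ^+ 2 + b)%:E).
Proof.
apply/measurable_EFinP; apply: measurable_funD => //.
by apply: measurable_funM => //; exact: measurable_funX.
Qed.

Let mpow (s : R) : measurable_fun [set: R] (fun x : R => ((x ^+ 2 + 1) `^ s)%:E).
Proof.
apply/measurable_EFinP; apply: (measurableT_comp (measurable_powR _)).
by apply: measurable_funD => //; exact: measurable_funX.
Qed.

Lemma spectral_dom psi : dom H psi <-> (\int[mu psi]_x (x ^+ 2)%:E < +oo)%E.
Proof. by have [-> _ _] := hI; rewrite /= spectral_integralE. Qed.

Lemma spectral_sq psi : dom H psi ->
  (\int[mu psi]_x (x ^+ 2)%:E = (hnorm (H psi) ^+ 2)%:E)%E.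
Proof. by move=> h; have [_ h2 _] := hI; rewrite h2// spectral_integralE. Qed.

Lemma spectral_id psi : dom H psi ->
  '[H psi, psi] = (fine (\int[mu psi]_x x%:E)%E)%:C.
Proof. by move=> h; have [_ _ h2] := hI; rewrite h2// spectral_integralE. Qed.

Lemma spectral_cst psi (c : R) :
  (\int[mu psi]_x c%:E = (c * hnorm psi ^+ 2)%:E)%E.
Proof. by rewrite integral_cst//= pvm_muT EFinM. Qed.

Lemma spectral_affine_sq psi (a b : R) : dom H psi -> 0 <= a -> 0 <= b ->
  (\int[mu psi]_x (a * x ^+ 2 + b)%:E =
   (a * hnorm (H psi) ^+ 2 + b * hnorm psi ^+ 2)%:E)%E.
Proof.
move=> h a0 b0; under eq_integral do rewrite EFinD EFinM.
rewrite ge0_integralD//.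
- by rewrite ge0_integralZl_EFin ?spectral_sq ?spectral_cst// => x _; rewrite lee_fin sqr_ge0.
- by move=> x _; rewrite lee_fin mulr_ge0// sqr_ge0.
- exact: measurable_funeM.
Qed.

Lemma spectral_integrable psi (b : R) : dom H psi ->
  (mu psi).-integrable setT (fun x => (x + b)%:E).
Proof.
move=> h; have b0 : 0 <= 2 * b ^+ 2 + 1 by have := sqr_ge0 b; lra.
have aux (x : R) : `|x + b| <= 2 * x ^+ 2 + (2 * b ^+ 2 + 1).
  rewrite ler_norml; have := sqr_ge0 (x - b); have := sqr_ge0 (x + b + 1).
  by have := sqr_ge0 (x + b - 1); nra.
have ig : (mu psi).-integrable setT (fun x => (2 * x ^+ 2 + (2 * b ^+ 2 + 1))%:E).
  apply/integrableP; split.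
    exact: maff.
  rewrite (eq_integral (fun x : R => (2 * x ^+ 2 + (2 * b ^+ 2 + 1))%:E)); last first.
    by move=> x _; rewrite gee0_abs// lee_fin addr_ge0// mulr_ge0// sqr_ge0.
  by rewrite spectral_affine_sq ?ltry.
apply: le_integrable ig => //.
- by apply/measurable_EFinP; exact: measurable_funD.
- move=> x _; rewrite !abse_EFin lee_fin; apply: le_trans (ler_norm _).
  exact: aux.
Qed.

Lemma spectral_affine psi (b : R) : dom H psi ->
  (\int[mu psi]_x (x + b)%:E = (complex.Re '[H psi, psi] + b * hnorm psi ^+ 2)%:E)%E.
Proof.
move=> h; have i0 := spectral_integrable 0 h.
have i1 : (mu psi).-integrable setT (EFin \o (fun x => x)).
  by apply: eq_integrable i0 => // x _; rewrite addr0.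
have i2 : (mu psi).-integrable setT (EFin \o cst b) by exact: finite_measure_integrable_cst.
have := integralD_EFin measurableT i1 i2 => /= ->.
rewrite spectral_cst EFinD spectral_id//=; congr (_ + _)%E.
by rewrite fineK//; exact: integrable_fin_num i1.
Qed.

Let B : set R := [set` `]-oo, (m - 1)[].

Let mB : measurable B. Proof. exact: measurable_itv. Qed.

Lemma pvm_mu_restrict psi (C : set R) : measurable C ->
  mu (E B psi) C = mu psi (C `&` B).
Proof.
by move=> mC; rewrite !pvm_muE ?pvmI//; exact: measurableI.
Qed.

(** For [phi = E B psi] the integral gives <H phi, phi> <= (m - 1) ||phi||^2, while the lower bound
    gives at least m ||phi||^2. The gap of 1 in the choice of [B] forces [phi = 0]. *)
Lemma spectral_support psi : dom H psi -> mu psi B = 0%E.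
Proof.
move=> h; pose phi := E B psi.
have mle (C : set R) : measurable C -> (mu phi C <= mu psi C)%E.
  move=> mC; rewrite pvm_mu_restrict// le_measure ?inE//; exact: measurableI.
have dphi : dom H phi.
  apply/spectral_dom; apply: le_lt_trans ((spectral_dom psi).1 h).
  rewrite !ge0_integralTE; try by move=> x; rewrite lee_fin sqr_ge0.
  apply: ge_ereal_sup => _ [g hg <-].
  apply: (le_trans (le_measure_sintegral mle g)).
  by apply: ereal_sup_ubound; exists g.
have nB : mu phi (~` B) = 0%E.
  by rewrite pvm_mu_restrict ?setICl ?measure0//; exact: measurableC.
have ix := spectral_integrable (1 - m) dphi.
have ixB : (mu phi).-integrable B (fun x => (x + (1 - m))%:E).
  exact: integrableS ix.
have h1 := spectral_affine (1 - m) dphi.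
have aux (y : R) : y < m - 1 -> y + (1 - m) <= 0 by lra.
have h2 : (\int[mu phi]_(x in B) (x + (1 - m))%:E <= 0)%E.
  rewrite -[leRHS](integral0 (mu phi) B); apply: le_integral => //.
    exact: integrable0.
  move=> x; rewrite inE /B /= in_itv/= => hx.
  by rewrite lee_fin; exact: aux.
have h3 : (\int[mu phi]_x (x + (1 - m))%:E = \int[mu phi]_(x in B) (x + (1 - m))%:E)%E.
  rewrite (negligible_integral (measurableC mB) measurableT ix nB).
  by rewrite setTD setCK.
have h4 : complex.Re '[H phi, phi] + (1 - m) * hnorm phi ^+ 2 <= 0.
  by rewrite -lee_fin -h1 h3.
have := hm dphi; rewrite lecE => /andP[_ /= h5].
have h6 : hnorm phi ^+ 2 = 0.
  by apply/eqP; rewrite eq_le sqr_ge0 andbT; lra.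
by rewrite pvm_muE// -/phi h6.
Qed.

(** The norm of order 1/2 becomes comparable with the quadratic form because sqrt (x^2 + 1) <= x + k
    for x >= m - 1, where the measure lives. The value k = 2 |m| + 3 is chosen to keep 2 x + k >= 1
    there, so that (x + k)^2 exceeds x^2 + 1. *)
Lemma spectral_half_le psi : dom H psi ->
  (\int[mu psi]_x ((x ^+ 2 + 1) `^ 2^-1)%:E <=
   (complex.Re '[H psi, psi] + (2 * `|m| + 3) * hnorm psi ^+ 2)%:E)%E.
Proof.
move=> h; rewrite -spectral_affine//.
have mp := mpow 2^-1.
have ix := spectral_integrable (2 * `|m| + 3) h.
have nB := spectral_support h.
have aux (x : R) : m - 1 <= x -> Num.sqrt (x ^+ 2 + 1) <= x + (2 * `|m| + 3).
  move=> hx; have h1 := ler_norm m; have h2 := ler_norm (- m); rewrite normrN in h2.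
  have h3 : 0 <= x + (2 * `|m| + 3) by lra.
  rewrite -[leRHS]ger0_norm// -sqrtr_sqr ler_sqrt ?sqr_ge0//.
  have : 0 <= (2 * `|m| + 3) * (2 * x + (2 * `|m| + 3) - 1) by apply: mulr_ge0; lra.
  nra.
rewrite (negligible_integral mB measurableT ix nB).
rewrite (ge0_negligible_integral mB measurableT mp) //; last first.
  by move=> x _; rewrite lee_fin powR_ge0.
apply: ge0_le_integral.
- exact: measurableD.
- by move=> x _; rewrite lee_fin powR_ge0.
- exact: measurable_funTS.
- apply: measurable_funTS; exact: measurable_int ix.
- move=> x [_ /= hx]; rewrite lee_fin powR12_sqrt; last by rewrite addr_ge0// sqr_ge0.
  apply: aux; rewrite leNgt; apply/negP => hx'; apply: hx.
  by rewrite /B /= in_itv.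
Qed.

Lemma spectral_interp (s e : R) : 0 < s < 1 -> 0 < e -> exists2 C, 0 <= C &
  forall psi, dom H psi ->
  (\int[mu psi]_x ((x ^+ 2 + 1) `^ s)%:E <=
   (e * (hnorm (H psi) ^+ 2 + hnorm psi ^+ 2) + C * hnorm psi ^+ 2)%:E)%E.
Proof.
move=> /andP[s0 s1] e0.
(* [T] is the point where t^s = e t: below it t^s is at most T^s, above it at most e t. The exponent
   needs s < 1. *)
pose T := (e^-1) `^ (1 - s)^-1; exists (T `^ s); first exact: powR_ge0.
have s1' : 0 < 1 - s by rewrite subr_gt0.
have ptw (t : R) : 1 <= t -> t `^ s <= e * t + T `^ s.
  move=> t1; have t0 : 0 < t by apply: lt_le_trans t1.
  have [tT|/ltW tT] := leP t T.
    apply: (@le_trans _ _ (T `^ s)); last by rewrite lerDr mulr_ge0// ltW.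
    by apply: ge0_ler_powR; rewrite ?nnegrE ?(ltW s0) ?(ltW t0) ?powR_ge0.
  apply: (@le_trans _ _ (e * t)); last by rewrite lerDl powR_ge0.
  have h1 : e^-1 <= t `^ (1 - s).
    have -> : e^-1 = T `^ (1 - s).
      by rewrite /T -powRrM mulVf ?gt_eqF// powRr1// invr_ge0 ltW.
    by apply: ge0_ler_powR; rewrite ?nnegrE ?(ltW s1') ?(ltW t0) ?powR_ge0.
  have h2 : t = t `^ s * t `^ (1 - s).
    rewrite -powRD; first by rewrite addrC subrK powRr1// ltW.
    by apply/implyP => _; rewrite gt_eqF.
  rewrite {2}h2 mulrCA ler_peMr ?powR_ge0//.
  by rewrite -(ler_pM2l e0) divff ?gt_eqF// in h1.
move=> psi h.
have -> : e * (hnorm (H psi) ^+ 2 + hnorm psi ^+ 2) + T `^ s * hnorm psi ^+ 2 =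
   e * hnorm (H psi) ^+ 2 + (e + T `^ s) * hnorm psi ^+ 2 by ring.
rewrite -spectral_affine_sq ?addr_ge0 ?powR_ge0 ?(ltW e0)//.
apply: ge0_le_integral => //.
- by move=> x _; rewrite lee_fin powR_ge0.
- move=> x _; rewrite lee_fin addrA -{2}[e]mulr1 -mulrDr.
  by apply: ptw; rewrite lerDr sqr_ge0.
Qed.

Lemma spectral_half_le1 psi :
  (\int[mu psi]_x ((x ^+ 2 + 1) `^ 2^-1)%:E <= \int[mu psi]_x ((x ^+ 2 + 1) `^ 1)%:E)%E.
Proof.
apply: ge0_le_integral => //.
- by move=> x _; rewrite lee_fin powR_ge0.
- move=> x _; rewrite lee_fin ler_powR ?lerDr ?sqr_ge0//.
  by rewrite invf_le1 ?ler1n.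
Qed.

Lemma spectral_one psi : dom H psi ->
  (\int[mu psi]_x ((x ^+ 2 + 1) `^ 1)%:E = (hnorm (H psi) ^+ 2 + hnorm psi ^+ 2)%:E)%E.
Proof.
move=> h; have := spectral_affine_sq h (@ler01 R) (@ler01 R); rewrite !mul1r => <-.
by apply: eq_integral => x _; rewrite powRr1 ?mul1r// addr_ge0// sqr_ge0.
Qed.

Lemma pvm_mu_cvg (u : nat -> F) psi (A : set R) : measurable A -> hcvg u psi ->
  mu (u k) A @[k --> \oo] --> mu psi A.
Proof.
move=> mA hu; rewrite pvm_muE//.
have -> : (fun k => mu (u k) A) = (fun k => (hnorm (E A (u k)) ^+ 2)%:E).
  by apply/funext => k; rewrite pvm_muE.
apply: cvg_EFin; first exact: nearW.
have h : hnorm (E A (u k)) @[k --> \oo] --> hnorm (E A psi).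
  apply/cvgrPdist_le => e e0; have [N hN] := hu _ e0; exists N => // n /hN {}hN.
  have h1 := pvm_le hE (u n - psi) mA; rewrite pvmB// in h1.
  rewrite ler_norml; have h2 := ler_hnormD (E A (u n) - E A psi) (E A psi).
  rewrite subrK in h2.
  have h3 := ler_hnormD (E A psi - E A (u n)) (E A (u n)).
  rewrite subrK hnorm_distC in h3; apply/andP; split; lra.
by under eq_fun do rewrite expr2; rewrite expr2; exact: (cvgM h h).
Qed.

(** The integral is a supremum over simple functions, and for each of these it is continuous in the
    vector. *)
Lemma spectral_lsc (f : R -> \bar R) (u : nat -> F) psi (C : R) :
  (forall x, 0 <= f x)%E -> hcvg u psi ->
  (forall k, \int[mu (u k)]_x f x <= C%:E)%E -> (\int[mu psi]_x f x <= C%:E)%E.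
Proof.
move=> f0 hu hC; rewrite ge0_integralTE//.
apply: ge_ereal_sup => _ [g hg <-].
have le k : (sintegral (mu (u k)) g <= C%:E)%E.
  apply: le_trans (hC k); rewrite ge0_integralTE//.
  by apply: ereal_sup_ubound; exists g.
apply: (@cvge_to_le _ \oo _ _ (fun k => sintegral (mu (u k)) g)); last exact: nearW.
rewrite sintegralE fsbig_finite//=.
have -> : (fun k => sintegral (mu (u k)) g) = (fun k =>
   \sum_(x <- finmap.enum_fset (fset_set (range g))) x%:E * mu (u k) (g @^-1` [set x]))%E.
  by apply/funext => k; rewrite sintegralE fsbig_finite.
apply: cvg_nnesum => x _; first by apply: nearW => k; exact: nnsfun_mulemu_ge0.
by apply: cvgeZl => //; exact: pvm_mu_cvg.
Qed.

End SpectralBounds.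

(** * The scale of spaces of H *)

Section Scale.
Context {R : realType} {F : hilbertType R}.
Implicit Types (T A H : operator F) (psi phi chi : F).

(* When no projection-valued measure represents H, the choice operator makes
   [spectral_measure H] zero and every norm of the scale vanishes. *)
Lemma spectral_measureP H :
  (projection_valued_measure (spectral_measure H) /\
   spectral_integral (spectral_measure H) id H) \/
  (forall s psi, Hs_sqnorm H s psi = 0%E).
Proof.
pose P := [set E | projection_valued_measure E /\ spectral_integral E id H].
have [hP|hP] := pselect (exists E, P E).
  left; exact: (@xgetPex _ (fun=> fun=> 0) P hP).
right => s psi; rewrite /Hs_sqnorm.
have -> : spectral_mu (spectral_measure H) psi = (fun=> 0%E).
  apply/funext => B; rewrite /spectral_mu /spectral_measure xgetPN ?dot0l//.
  by move=> E hE; apply: hP; exists E.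
apply: (@integral_measure_zero _ _ _ setT).
Qed.

Lemma Hs_sqnorm_ge0 H s psi : (0 <= Hs_sqnorm H s psi)%E.
Proof.
have [[hE _]|->//] := spectral_measureP H.
rewrite /Hs_sqnorm (spectral_integralE hE).
by apply: integral_ge0 => x _; rewrite lee_fin powR_ge0.
Qed.

Lemma ereal_cvg0 (X : nat -> \bar R) : X n @[n --> \oo] --> 0%E ->
  forall e : R, 0 < e -> exists N, forall n, (N <= n)%N -> (X n <= e%:E)%E.
Proof.
move=> /fine_cvgP[[N1 _ h1] h2] e e0.
have /cvgrPdist_le/(_ _ e0)[N2 _ {}h2] := h2.
exists (maxn N1 N2) => n; rewrite geq_max => /andP[/h1 /= fn /h2 /=].
rewrite sub0r normrN -lee_fin => h; rewrite -(fineK fn).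
by apply: le_trans h; rewrite lee_fin ler_norm.
Qed.

Lemma cvg0_ereal (X : nat -> \bar R) : (forall n, 0 <= X n)%E ->
  (forall e : R, 0 < e -> exists N, forall n, (N <= n)%N -> (X n <= e%:E)%E) ->
  X n @[n --> \oo] --> 0%E.
Proof.
move=> X0 h; apply/fine_cvgP; split.
  have [N hN] := h 1 ltr01; exists N => // n /= /hN hn.
  by rewrite ge0_fin_numE//; apply: le_lt_trans hn _; rewrite ltry.
apply/cvgrPdist_le => e e0; have [N hN] := h e e0; exists N => // n /= /hN hn.
have fn : X n \is a fin_num by rewrite ge0_fin_numE//; apply: le_lt_trans hn _; rewrite ltry.
rewrite sub0r normrN ger0_norm ?fine_ge0//.
by rewrite -lee_fin fineK.
Qed.

(* A supremum over the unit ball of the homogeneous functional N controls the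
   whole subspace, also where N vanishes. *)
Lemma unit_ball_bound (D : set F) (N : F -> R) (T : F -> F) (Q : F -> Prop) (e : R) :
  0 <= e -> subspace D ->
  (forall t psi, D psi -> T (t%:C *: psi) = t%:C *: T psi) ->
  (forall t psi, D psi -> 0 < t -> t * N psi <= 1 -> Q (t%:C *: psi)) ->
  (forall psi, D psi -> 0 <= N psi) ->
  (ereal_sup [set (hnorm (T psi))%:E | psi in [set psi | D psi /\ Q psi]] <= e%:E)%E ->
  forall psi, D psi -> hnorm (T psi) <= e * N psi.
Proof.
move=> e0 sD hT hQ N0 hsup psi Dpsi; apply/ler_addgt0Pl => d d0.
have k0 : 0 < e + 1 by rewrite ltr_wpDl.
pose c := N psi + d / (e + 1).
have c0 : 0 < c by rewrite ltr_wpDl ?N0// divr_gt0.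
have h : (hnorm (T ((c^-1)%:C *: psi)) <= e).
  rewrite -lee_fin; apply: le_trans hsup; apply: ereal_sup_ubound.
  exists ((c^-1)%:C *: psi) => //; split; first exact: subspaceZ.
  apply: hQ; rewrite ?invr_gt0// ler_pdivrMl// mulr1 /c lerDl.
  by rewrite divr_ge0// ltW.
rewrite hT// hnormZ cabsR gtr0_norm ?invr_gt0// ler_pdivrMl// in h.
apply: (le_trans h); rewrite /c mulrDl addrC lerD//; last by rewrite mulrC.
rewrite mulrAC ler_pdivrMr// ler_wpM2l ?(ltW d0)//.
by rewrite lerDl.
Qed.

Variable H : operator F.
Hypothesis (saH : self_adjoint H) (bH : bounded_below H).

Let lH : linear_op H. Proof. by have [] := saH. Qed.

Lemma Hs_norm1_sq : (forall psi, dom H psi ->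
    Hs_norm H 1 psi = Num.sqrt (hnorm (H psi) ^+ 2 + hnorm psi ^+ 2)) \/
  (forall s psi, Hs_sqnorm H s psi = 0%E).
Proof.
have [[hE hI]|h] := spectral_measureP H; last by right.
left => psi dpsi; rewrite /Hs_norm /Hs_sqnorm (spectral_integralE hE).
by rewrite (spectral_one hE hI dpsi).
Qed.

Lemma Hs_norm_ge0 s psi : 0 <= Hs_norm H s psi.
Proof. exact: sqrtr_ge0. Qed.

Lemma Hs_norm1_homo t psi : dom H psi -> 0 < t ->
  Hs_norm H 1 (t%:C *: psi) = t * Hs_norm H 1 psi.
Proof.
move=> dpsi t0; have [h|h] := Hs_norm1_sq; last first.
  by rewrite /Hs_norm !h sqrtr0 mulr0.
rewrite !h//; last exact: subspaceZ (linear_op_dom lH) dpsi.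
rewrite (linear_opZ _ lH dpsi) !hnormZ !cabsR gtr0_norm// !exprMn -mulrDr.
by rewrite sqrtrM ?sqr_ge0// sqrtr_sqr gtr0_norm.
Qed.

Lemma Hs_norm1_le psi : dom H psi -> Hs_norm H 1 psi <= hnorm (H psi) + hnorm psi.
Proof.
move=> dpsi; have h0 := hnorm_ge0 (H psi); have h1 := hnorm_ge0 psi.
have [h|h] := Hs_norm1_sq; last by rewrite /Hs_norm h sqrtr0 addr_ge0.
rewrite h// -[leRHS]ger0_norm ?addr_ge0// -sqrtr_sqr ler_sqrt ?sqr_ge0//.
have := mulr_ge0 h0 h1; nra.
Qed.

Lemma dom_Hs_half psi : dom H psi -> Hs H 2^-1 psi.
Proof.
move=> dpsi; have [[hE hI]|h] := spectral_measureP H; last by rewrite /Hs /= h.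
have [m hm] := bH; rewrite /Hs /= /Hs_sqnorm (spectral_integralE hE).
by apply: le_lt_trans (spectral_half_le hE hI hm dpsi) _; rewrite ltry.
Qed.

Lemma Hs_bounded_small A s : dom A = dom H -> 0 < s < 1 -> bounded_on_Hs H s A ->
  forall e : R, 0 < e -> exists2 C : R, 0 <= C &
    forall psi, dom H psi -> hnorm (A psi) <= e * hnorm (H psi) + C * hnorm psi.
Proof.
move=> dA s01 [T [lT dT eT [C0 hC0]]] e e0.
(* If all norms of the scale vanish, boundedness makes [A] zero on [dom H], and any constants will
   do. *)
have [[hE hI]|h] := spectral_measureP H; last first.
  exists 0 => // psi dpsi; have hs : Hs H s psi by rewrite /Hs /= h.
  rewrite -eT ?dA//; apply: (le_trans (hC0 _ hs)).
  by rewrite /Hs_norm h sqrtr0 mulr0 mul0r addr0 mulr_ge0 ?hnorm_ge0 ?(ltW e0).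
have k0 : 0 < `|C0| + 1 by rewrite ltr_wpDl.
(* The denominator compensates the bound [C0] of the extension of [A]; [spectral_interp] is used
   with [d ^+ 2] because it speaks of squared norms. *)
pose d := e / (`|C0| + 1).
have d0 : 0 < d by rewrite divr_gt0.
have d20 : 0 < d ^+ 2 by rewrite exprn_gt0.
have [C C00 hC] := spectral_interp hE hI s01 d20.
exists (`|C0| * (d + Num.sqrt C)).
  by rewrite mulr_ge0// addr_ge0 ?sqrtr_ge0 ?(ltW d0).
move=> psi dpsi; have := hC _ dpsi.
rewrite -(spectral_integralE hE) -/(Hs_sqnorm H s psi) => h1.
have fin : Hs H s psi by apply: le_lt_trans h1 _; rewrite ltry.
rewrite -eT ?dA//; apply: (le_trans (hC0 _ fin)).
have a0 := hnorm_ge0 (H psi); have b0 := hnorm_ge0 psi.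
have n0 := Hs_sqnorm_ge0 H s psi.
have h2 : Hs_norm H s psi <= d * hnorm (H psi) + (d + Num.sqrt C) * hnorm psi.
  have r0 : 0 <= d * hnorm (H psi) + (d + Num.sqrt C) * hnorm psi.
    by rewrite addr_ge0// mulr_ge0// ?addr_ge0 ?sqrtr_ge0 ?(ltW d0).
  rewrite -[leRHS]ger0_norm// -sqrtr_sqr ler_sqrt ?sqr_ge0//.
  apply: (@le_trans _ _ (d ^+ 2 * (hnorm (H psi) ^+ 2 + hnorm psi ^+ 2) + C * hnorm psi ^+ 2)).
    by rewrite -lee_fin fineK// ge0_fin_numE.
  rewrite -{1}(sqr_sqrtr C00).
  have q0 := sqrtr_ge0 C; move: (Num.sqrt C) q0 => q q0.
  have p1 : 0 <= d * hnorm (H psi) * (d * hnorm psi) by rewrite !mulr_ge0// ltW.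
  have p2 : 0 <= d * hnorm (H psi) * (q * hnorm psi) by rewrite !mulr_ge0// ltW.
  have p3 : 0 <= d * hnorm psi * (q * hnorm psi) by rewrite !mulr_ge0// ltW.
  nra.
apply: (@le_trans _ _ (`|C0| * Hs_norm H s psi)).
  by rewrite ler_wpM2r ?Hs_norm_ge0// ler_norm.
apply: (le_trans (ler_wpM2l (normr_ge0 _) h2)).
rewrite mulrDr [X in _ + X <= _]mulrA lerD2r mulrA.
rewrite ler_wpM2r// /d mulrCA ler_piMr ?(ltW e0)// ler_pdivrMr// mul1r.
by rewrite lerDl.
Qed.

Lemma Hs_cvg_eventually A (An : nat -> operator F) : linear_op A -> dom A = dom H ->
  (forall n, linear_op (An n)) -> (forall n, dom H `<=` dom (An n)) ->
  opnorm (dom H) (Hs_norm H 1) (fun psi => An n psi - A psi)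
    @[n --> \oo] --> 0%E ->
  forall e : R, 0 < e -> exists N, forall n, (N <= n)%N -> forall psi, dom H psi ->
    hnorm (An n psi - A psi) <= e * (hnorm (H psi) + hnorm psi).
Proof.
move=> lA dA lAn dAn /ereal_cvg0 h e e0; have [N hN] := h e e0.
exists N => n /hN {}hN psi dpsi.
apply: (@le_trans _ _ (e * Hs_norm H 1 psi)); last first.
  by rewrite ler_wpM2l ?(ltW e0)// Hs_norm1_le.
apply: (unit_ball_bound (ltW e0) (linear_op_dom lH) _ _ _ hN) => //.
- by move=> t phi h1; rewrite !linear_opZ ?dA//; [rewrite scalerBr|exact: dAn].
- by move=> t phi h1 t0; rewrite Hs_norm1_homo.
- by move=> phi _; exact: Hs_norm_ge0.
Qed.

(** Order 1/2 is rephrased through the quadratic form of [H], shifted by [c] to be nonnegative. The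
    last clause, from lower semicontinuity, later shows that [G psi] lies in the domain of [A_n] for
    every [psi]. *)
Lemma Hs_half_form A : bounded_on_Hs H 2^-1 A -> Hs H 2^-1 `<=` dom A ->
  exists C c : R, [/\ 0 <= C, 0 <= c,
    forall psi, dom H psi -> hnorm (A psi) ^+ 2 <=
      C * (complex.Re '[H psi, psi] + c * hnorm psi ^+ 2) &
    forall (u : nat -> F) psi (K : R), (forall k, dom H (u k)) -> hcvg u psi ->
      (forall k, complex.Re '[H (u k), u k] + c * hnorm (u k) ^+ 2 <= K) -> dom A psi].
Proof.
move=> [T [lT dT eT [C0 hC0]]] dA; have [m hm] := bH.
pose c := 2 * `|m| + 3; have c0 : 0 <= c by rewrite addr_ge0// mulr_ge0.
have pos psi : dom H psi -> 0 <= complex.Re '[H psi, psi] + c * hnorm psi ^+ 2.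
  move=> /hm; rewrite lecE => /andP[_ /= h].
  have := ler_norm (- m); rewrite normrN => h1.
  have h2 := sqr_ge0 (hnorm psi).
  have : - m * hnorm psi ^+ 2 <= c * hnorm psi ^+ 2.
    by rewrite ler_wpM2r// /c; have := normr_ge0 m; lra.
  lra.
exists (C0 ^+ 2), c; split=> //; first exact: sqr_ge0.
- move=> psi dpsi; have hs := dom_Hs_half dpsi.
  have h1 : hnorm (A psi) <= C0 * Hs_norm H 2^-1 psi.
    by rewrite -eT//; [exact: hC0|exact: dA].
  have h2 : Hs_norm H 2^-1 psi ^+ 2 <= complex.Re '[H psi, psi] + c * hnorm psi ^+ 2.
    have [[hE hI]|h] := spectral_measureP H; last first.
      by rewrite /Hs_norm h sqrtr0 expr0n; exact: pos.
    have n0 := Hs_sqnorm_ge0 H 2^-1 psi.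
    rewrite sqr_sqrtr ?fine_ge0// -lee_fin fineK ?ge0_fin_numE//.
    rewrite /Hs_sqnorm (spectral_integralE hE).
    exact: spectral_half_le hE hI hm _ dpsi.
  apply: (@le_trans _ _ ((C0 * Hs_norm H 2^-1 psi) ^+ 2)).
    rewrite ler_pXn2r ?nnegrE ?hnorm_ge0//; exact: le_trans (hnorm_ge0 _) h1.
  by rewrite exprMn ler_wpM2l ?sqr_ge0.
- move=> u psi K du hu hK; apply: dA; rewrite /Hs /=.
  have [[hE hI]|h] := spectral_measureP H; last by rewrite h.
  rewrite /Hs_sqnorm (spectral_integralE hE).
  apply: (@le_lt_trans _ _ K%:E); last by rewrite ltry.
  apply: (@spectral_lsc _ _ _ hE (fun x : R => ((x ^+ 2 + 1) `^ 2^-1)%:E) u psi K _ hu)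
    => [x|k].
    by rewrite lee_fin powR_ge0.
  apply: (le_trans (spectral_half_le hE hI hm (du k))).
  by rewrite lee_fin; exact: hK.
Qed.

Lemma Hs_half_bound1 A : bounded_on_Hs H 2^-1 A -> Hs H 2^-1 `<=` dom A ->
  exists2 C : R, 0 <= C & forall psi, dom H psi -> hnorm (A psi) <= C * Hs_norm H 1 psi.
Proof.
move=> [T [lT dT eT [C0 hC0]]] dA; exists `|C0| => // psi dpsi.
have hs := dom_Hs_half dpsi; rewrite -eT//; last exact: dA.
apply: (le_trans (hC0 _ hs)).
apply: (le_trans (ler_wpM2r (Hs_norm_ge0 _ _) (ler_norm _))); rewrite ler_wpM2l//.
have [[hE hI]|h] := spectral_measureP H; last by rewrite /Hs_norm !h.
rewrite /Hs_norm ler_sqrt ?fine_ge0 ?Hs_sqnorm_ge0//.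
rewrite -lee_fin !fineK; last 2 first.
- rewrite ge0_fin_numE ?Hs_sqnorm_ge0// /Hs_sqnorm (spectral_integralE hE).
  by rewrite (spectral_one hE hI dpsi) ltry.
- by rewrite ge0_fin_numE ?Hs_sqnorm_ge0.
rewrite /Hs_sqnorm !(spectral_integralE hE); exact: spectral_half_le1.
Qed.

(** The disjunction covers both cases for the scale. If the order-1 norm dominates [H phi], any
    [psi] is approximated by density; if the norms vanish, [psi] in [dom H] serves as its own
    approximation. *)
Lemma Hbar_dot psi :
  (dom H psi \/ forall phi, dom H phi -> hnorm (H phi) <= Hs_norm H 1 phi) ->
  forall chi, dom H chi -> Hbar H psi chi = '[psi, H chi].
Proof.
have mH := self_adjoint_maxsym saH.
have [_ dH _ _] := saH.
move=> hpsi chi dchi.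
have ex : exists l : F -> R[i], forall e : R, 0 < e -> exists phi,
    [/\ dom H phi, hnorm (phi - psi) <= e &
        Hm1_norm_le H (fun chi => emb (H phi) chi - l chi) e].
  exists (fun chi => '[psi, H chi]) => e e0.
  have [dpsi|h] := hpsi.
    exists psi; split=> //; first by rewrite subrr hnorm0 ltW.
    move=> x dx; rewrite /emb mH.1.2// subrr normr0 lecR mulr_ge0 ?Hs_norm_ge0//.
    exact: ltW.
  have [phi dphi hphi] := (denseP (dom H)).1 dH psi e e0.
  exists phi; split=> // x dx; rewrite /emb mH.1.2// -dotBl.
  by apply: (le_trans (dot_norm_le _ _)); rewrite lecR ler_pM ?hnorm_ge0// h.
have hl : forall e : R, 0 < e -> exists phi,
    [/\ dom H phi, hnorm (phi - psi) <= e &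
        Hm1_norm_le H (fun chi => emb (H phi) chi - Hbar H psi chi) e].
  exact: (@xgetPex _ (fun=> 0) _ ex).
apply/eqP; rewrite -subr_eq0 -cabs_eq0; apply/eqP.
apply: small_eq0 => [|e e0]; first exact: cabs_ge0.
pose k := Hs_norm H 1 chi + hnorm (H chi).
have k0 : 0 <= k by rewrite addr_ge0 ?Hs_norm_ge0 ?hnorm_ge0.
have ek : 0 < e / (k + 1) by rewrite divr_gt0// ltr_wpDl.
have [phi [dphi h1 h2]] := hl _ ek.
have := h2 _ dchi; rewrite /emb mH.1.2// cabsE lecR => {}h2.
have h3 : cabs ('[phi, H chi] - '[psi, H chi]) <= e / (k + 1) * hnorm (H chi).
  by rewrite -dotBl; apply: (le_trans (dot_cabs_le _ _)); rewrite ler_wpM2r ?hnorm_ge0.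
have h4 : cabs (Hbar H psi chi - '[psi, H chi]) <= e / (k + 1) * k.
  rewrite /k mulrDr; apply: le_trans (lerD h2 h3).
  rewrite -lecR rmorphD /= -!cabsE -normrN.
  have -> : - (Hbar H psi chi - '[psi, H chi]) = ('[phi, H chi] - Hbar H psi chi) -
     ('[phi, H chi] - '[psi, H chi]) by ring.
  exact: ler_normB.
apply: (le_trans h4).
by rewrite mulrAC ler_pdivrMr ?ltr_wpDl// ler_wpM2l ?(ltW e0)// lerDl.
Qed.

End Scale.

(** * The bounded operators A_n R A_n^* *)

Section Limits.
Context {R : realType} {F : hilbertType R}.
Implicit Types (T : operator F) (x y l p : F).

Lemma is_resolvent_ext T1 T2 z (B : F -> F) : dom T1 = dom T2 ->
  (forall psi, dom T1 psi -> T1 psi = T2 psi) ->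
  is_resolvent T1 z B -> is_resolvent T2 z B.
Proof.
move=> ed e [h1 h2 h3]; split=> //.
  by move=> f; have [d ef] := h2 f; rewrite -ed -e.
by move=> psi; rewrite -ed => d; rewrite -e//; exact: h3.
Qed.

Lemma resolvent_eq T1 T2 z : dom T1 = dom T2 ->
  (forall psi, dom T1 psi -> T1 psi = T2 psi) ->
  resolvent T1 z = resolvent T2 z.
Proof.
move=> ed e; rewrite /resolvent; congr xget; apply/seteqP; split => B.
  exact: is_resolvent_ext.
by apply: is_resolvent_ext => // psi; rewrite -ed => /e.
Qed.

End Limits.

Section CreationAnnihilation.
Context {R : realType} {F : hilbertType R}.
Implicit Types (T B Z : operator F) (psi phi chi u f g h : F).
Variables (H : operator F) (lam : R).
Hypotheses (saH : self_adjoint H) (hlam : resolvent_set H lam%:C).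

Lemma below_spectrum_resolvent : (lam%:E < inf_spectrum H)%E -> resolvent_set H lam%:C.
Proof.
move=> h; apply: contrapT => hs; move: h; rewrite ltNge => /negP; apply.
by apply: ereal_inf_lbound; exists lam.
Qed.

Let mH : maximal_symmetric H := self_adjoint_maxsym saH.
Let lH : linear_op H := mH.1.1.
Let dH : dense (dom H). Proof. by have [] := saH. Qed.
Let R0 := resolvent H lam%:C.
Let hR0 : is_resolvent H lam%:C R0 := resolventP hlam.

Lemma resolvent_graph_bound : exists2 k : R, 0 <= k & forall f,
  hnorm (H (R0 f)) <= hnorm f + `|lam| * hnorm (R0 f) /\
  hnorm (H (R0 f)) + hnorm (R0 f) <= k * hnorm f.
Proof.
have [r r0 hr] := resolvent_bounded hR0.
exists (1 + `|lam| * r + r); first by rewrite !addr_ge0// mulr_ge0.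
move=> f; have e := shift_resolvent hR0 f.
have h1 : hnorm (H (R0 f)) <= hnorm f + `|lam| * hnorm (R0 f).
  have -> : H (R0 f) = lam%:C *: R0 f - f by rewrite -[X in _ - X]e /= -/R0; vector_ring.
  by apply: (le_trans (ler_hnormB _ _)); rewrite hnormZ cabsR addrC.
split=> //; have h2 := ler_wpM2l (normr_ge0 lam) (hr f); have := hr f; lra.
Qed.

(** The composition of [T] with the resolvent is bounded and everywhere defined, so the value chosen
    by [adj] is unique and equals the bounded adjoint; lam is real, hence its own conjugate. *)
Lemma G_op_pair T (c : R) : linear_op T -> dom H `<=` dom T -> 0 <= c ->
  (forall h, hnorm (T (R0 h)) <= c * hnorm h) ->
  adjoint_pair (T \o R0) (G_op H T lam%:C) c.
Proof.
move=> lT dT c0 hT.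
have lW a x y : T (R0 (a *: x + y)) = a *: T (R0 x) + T (R0 y).
  by rewrite (resolvent_linear hR0) linear_opP//; apply: dT; exact: resolvent_dom hR0 _.
have [G hG] := bounded_adjoint (B := T \o R0) lW hT.
split=> // x y; rewrite hG; congr ('[x, _]).
rewrite /G_op conjc_real -/R0.
have ad : is_adj (compop T (Defs.total R0)) y (G y) by move=> phi _; exact: hG.
pose P := [set u | is_adj (compop T (Defs.total R0)) y u].
have hP : P (adj (compop T (Defs.total R0)) y).
  by apply: (@xgetPex _ 0 P); exists (G y).
apply: dot_eqr => v.
have dv : dom (compop T (Defs.total R0)) v.
  by split=> //; apply: dT; exact: resolvent_dom hR0 _.
by rewrite -(ad _ dv) -(hP _ dv).
Qed.

Lemma adj_G_op T (c : R) u : adjoint_pair (T \o R0) (G_op H T lam%:C) c ->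
  adj (G_op H T lam%:C) u = T (R0 u).
Proof.
move=> hW; have [_ _ _ aW] := adjoint_pair_sym hW; have [_ _ _ aW'] := hW.
have dG phi : dom (G_op H T lam%:C) phi.
  exists (G_op H T lam%:C phi); move: aW'; rewrite /G_op conjc_real => aW' psi _.
  exact: aW'.
have : is_adj (G_op H T lam%:C) u (adj (G_op H T lam%:C) u).
  apply: (@xgetPex _ 0 [set v | is_adj (G_op H T lam%:C) u v]).
  by exists (T (R0 u)) => phi _; exact: aW.
by move=> hu; apply: dot_eqr => v; rewrite -(hu _ (dG v)) aW.
Qed.

(** Turns a relative bound with respect to [H] into the absorbable form required by
    [Kop_apriori]. *)
Lemma small_pair_bound T (a b : R) : 0 <= a -> 0 <= b ->
  (forall psi, dom H psi -> hnorm (T psi) <= a * hnorm (H psi) + b * hnorm psi) ->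
  forall h, hnorm (T (R0 h)) <= a * hnorm h + (a * `|lam| + b) * hnorm (R0 h).
Proof.
move=> a0 b0 hT h; have [k _ hk] := resolvent_graph_bound.
apply: (le_trans (hT _ (resolvent_dom hR0 h))).
have := ler_wpM2l a0 (hk h).1; lra.
Qed.

(** * The products B R and B R B^* for a single annihilation operator B *)

Section OneOperator.
Variables (B : operator F) (C c N : R).
Hypotheses (lB : linear_op B) (clB : closable B) (dB : dom H `<=` dom B).
Hypotheses (C0 : 0 <= C) (c0 : 0 <= c) (N0 : 0 <= N).
Hypothesis formB : forall psi, dom H psi -> hnorm (B psi) ^+ 2 <=
      C * (complex.Re '[H psi, psi] + c * hnorm psi ^+ 2).
Hypothesis domB : forall (w : nat -> F) psi (K : R), (forall k, dom H (w k)) ->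
  hcvg w psi -> (forall k, complex.Re '[H (w k), w k] + c * hnorm (w k) ^+ 2 <= K) ->
  dom B psi.
Hypothesis boundB : forall psi, dom H psi -> hnorm (B psi) <= N * Hs_norm H 1 psi.
Hypothesis smallB : small (addop (adj B) B) H.

Let W := B \o R0.
Let G : F -> F := G_op H B lam%:C.

Lemma creation_pair : exists2 g : R, 0 <= g & adjoint_pair W G g.
Proof.
have [k k0 hk] := resolvent_graph_bound.
have Nk : 0 <= N * k by rewrite mulr_ge0.
exists (N * k) => //; apply: G_op_pair => // h.
have dh := resolvent_dom hR0 h.
apply: (le_trans (boundB dh)); rewrite -mulrA ler_wpM2l//.
exact: le_trans (Hs_norm1_le dh) (hk h).2.
Qed.

Let WG x y : '[B (R0 x), y] = '[x, G y].
Proof. by have [g _ [_ _ _ h]] := creation_pair; exact: h. Qed.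

(** Smallness of [B^* + B] contains the inclusion of [dom H] in its domain. *)
Let dadj psi : dom H psi -> dom (adj B) psi.
Proof. by move=> h; have [a [b [_ [sub _]]]] := smallB; have [] := sub _ h. Qed.

Lemma adjP psi : dom H psi -> is_adj B psi (adj B psi).
Proof. by move=> /dadj h; exact: (@xgetPex _ 0 [set v | is_adj B psi v]). Qed.

Let adj_uniq psi u v : is_adj B psi u -> is_adj B psi v -> u = v.
Proof.
move=> hu hv; apply/eqP; rewrite -subr_eq0; apply/eqP.
apply: (dense_orth dH) => w /dB dw; rewrite dotBr.
by rewrite -hu// -hv// subrr.
Qed.

Let adj_dot psi chi : dom H psi -> dom B chi -> '[adj B psi, chi] = '[psi, B chi].
Proof. by move=> h1 h2; rewrite dotC -(adjP h1 h2) -dotC. Qed.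

Lemma adj_linear : linear_on (dom H) (adj B).
Proof.
move=> a x y hx hy; apply: (@adj_uniq (a *: x + y)).
  by apply: adjP; have [] := lH.2 a _ _ hx hy.
move=> phi dphi; rewrite !dotDr !dotZr; congr (_ + _); last exact: adjP.
by congr (_ * _); exact: adjP.
Qed.

Lemma creation_resolvent psi : dom H psi -> G psi = R0 (adj B psi).
Proof.
move=> h; apply: dot_eqr => v; rewrite -WG (adjP h) ?(resolvent_sym mH hR0)//.
by apply: dB; exact: resolvent_dom hR0 _.
Qed.

Let ext_P psi u := forall e : R, 0 < e -> exists f,
    Hm1_norm_le H (fun chi => emb f chi - dual_adj B psi chi) e /\
    hnorm (R0 f - u) <= e.

(** For [phi] in [dom H] near [psi], [adj B phi] is a vector of [F] that approximates the functional
    in order -1, and its resolvent is [G phi], near [G psi]. *)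
Let ext_ex psi : ext_P psi (G psi).
Proof.
have [g g0 hG] := creation_pair; have [_ _ bG _] := adjoint_pair_sym hG.
move=> e e0.
have k0 : 0 < N + g + 1 by rewrite ltr_wpDl// addr_ge0.
have [phi dphi hphi] := (denseP (dom H)).1 dH psi _ (divr_gt0 e0 k0).
exists (adj B phi); split.
  move=> chi dchi; rewrite /emb /dual_adj adj_dot//; last exact: dB.
  rewrite -dotBl; apply: (le_trans (dot_norm_le _ _)); rewrite lecR.
  apply: (le_trans (ler_wpM2l (hnorm_ge0 _) (boundB dchi))).
  rewrite mulrA ler_wpM2r ?Hs_norm_ge0//.
  apply: (le_trans (ler_wpM2r N0 hphi)).
  rewrite mulrAC ler_pdivrMr// ler_pM2l//; lra.
rewrite -creation_resolvent// -(adjoint_pairB _ _ (adjoint_pair_sym hG)).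
apply: (le_trans (bG _)); apply: (le_trans (ler_wpM2l g0 hphi)).
have gN : g <= N + g + 1 by have := N0; lra.
by rewrite mulrA ler_pdivrMr// mulrC ler_pM2l.
Qed.

(** Uniqueness of the extension: if [f1] and [f2] approximate the same functional, then w = R0 (f1 -
    f2) satisfies ||w||^2 = Re <f1 - f2, R0 w>, which the order-1 norm of [R0 w] controls. *)
Lemma resolvent_ext_creation psi : resolvent_ext H lam%:C (dual_adj B psi) = G psi.
Proof.
have hu : ext_P psi (resolvent_ext H lam%:C (dual_adj B psi)).
  by apply: (@xgetPex _ 0 (ext_P psi)); exists (G psi); exact: ext_ex.
set u := resolvent_ext _ _ _ in hu *.
have [k k0 hk] := resolvent_graph_bound.
apply/eqP; rewrite -subr_eq0; apply/eqP/hnorm_eq0.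
apply: small_eq0 => [|e e0]; first exact: hnorm_ge0.
have d0 : 0 < e / (2 + 2 * k) by rewrite divr_gt0// ltr_wpDr// mulr_ge0.
have [f1 [h1 h1']] := hu _ d0; have [f2 [h2 h2']] := ext_ex psi d0.
set d := e / _ in d0 h1 h1' h2 h2'.
have h3 : hnorm (R0 f1 - R0 f2) <= 2 * d * k.
  apply: ler_hnorm_sq.
    by apply: mulr_ge0 => //; apply: mulr_ge0 => //; exact: ltW.
  set w := R0 f1 - R0 f2.
  have -> : hnorm w ^+ 2 = complex.Re '[f1 - f2, R0 w].
    by rewrite hnorm_sq /w dotBl !(resolvent_sym mH hR0) -dotBl.
  apply: (le_trans (ler_Re_cabs _)).
  have dw := resolvent_dom hR0 w.
  have := h1 _ dw; have := h2 _ dw; rewrite !cabsE !lecR => t2 t1.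
  have t3 : cabs '[f1 - f2, R0 w] <= 2 * (d * Hs_norm H 1 (R0 w)).
    rewrite -lecR -cabsE dotBl.
    have -> : '[f1, R0 w] - '[f2, R0 w] =
       (emb f1 (R0 w) - dual_adj B psi (R0 w)) - (emb f2 (R0 w) - dual_adj B psi (R0 w)).
      by rewrite /emb; ring.
    apply: (le_trans (ler_normB _ _)); rewrite !cabsE -rmorphD lecR /=; lra.
  apply: (le_trans t3).
  have t4 := le_trans (Hs_norm1_le dw) (hk w).2.
  by have := ler_wpM2l (ltW d0) t4; lra.
have h4 := ler_hnorm_dist u (R0 f1) (G psi).
have h5 := ler_hnorm_dist (R0 f1) (R0 f2) (G psi).
rewrite hnorm_distC in h1'.
have -> : e = d * (2 + 2 * k) by rewrite /d divfK// gt_eqF// ltr_wpDr// mulr_ge0.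
lra.
Qed.

Let Y psi := B (G psi).

Lemma TRT_creation psi : TRT H lam%:C B psi = Y psi.
Proof. by rewrite /TRT /= resolvent_ext_creation. Qed.

Let domG psi : dom H psi -> dom H (G psi).
Proof. by move=> h; rewrite creation_resolvent//; exact: resolvent_dom hR0 _. Qed.

Lemma H_creation psi : dom H psi -> H (G psi) = lam%:C *: G psi - adj B psi.
Proof.
move=> h; rewrite creation_resolvent// -[X in _ - X](shift_resolvent hR0) /= -/R0.
by vector_ring.
Qed.

(** The mapping property of R between orders -1/2 and 1/2 is replaced by a self-improving estimate.
    The form of [H] at [G psi] equals lam ||G psi||^2 - Re <Y psi, psi>, so the form bound makes ||Y
    psi||^2 at most C (a ||psi||^2 + ||Y psi|| ||psi||), which is quadratic on the left and linear
    on the right in ||Y psi||. *)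
Let Y_core : exists K K' : R, [/\ 0 <= K, 0 <= K',
  forall psi, dom H psi -> hnorm (Y psi) <= K * hnorm psi &
  forall psi, dom H psi ->
    complex.Re '[H (G psi), G psi] + c * hnorm (G psi) ^+ 2 <= K' * hnorm psi ^+ 2].
Proof.
have [g g0 hG] := creation_pair; have [_ _ bG _] := adjoint_pair_sym hG.
pose a := (`|lam| + c) * g ^+ 2.
have a0 : 0 <= a by rewrite mulr_ge0 ?sqr_ge0// addr_ge0.
(* The 1 ensures K >= 1, so that ||Y psi|| > K ||psi|| implies ||psi|| <= ||Y psi||; the quadratic
   inequality then gives ||Y psi|| <= C (a + 1) ||psi||, a contradiction. *)
pose K := C * (a + 1) + 1.
have K0 : 0 <= K by rewrite addr_ge0// mulr_ge0// addr_ge0.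
have key psi : dom H psi -> complex.Re '[H (G psi), G psi] + c * hnorm (G psi) ^+ 2 <=
    a * hnorm psi ^+ 2 + hnorm (Y psi) * hnorm psi.
  move=> h; have dG := domG h.
  have e := H_creation h.
  have -> : complex.Re '[H (G psi), G psi] =
      lam * hnorm (G psi) ^+ 2 - complex.Re '[Y psi, psi].
    rewrite e dotBl dotZl dotxx raddfB /= mul0r subr0; congr (_ - _).
    by rewrite adj_dot//; [rewrite Re_dotC|exact: dB].
  have h1 : hnorm (G psi) ^+ 2 <= g ^+ 2 * hnorm psi ^+ 2.
    rewrite -exprMn ler_pXn2r ?nnegrE ?mulr_ge0 ?hnorm_ge0//; exact: bG.
  have h2 := dot_Re_le (- Y psi) psi; rewrite dotNl raddfN hnormN /= in h2.
  have h3 : (`|lam| + c) * hnorm (G psi) ^+ 2 <= a * hnorm psi ^+ 2.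
    by rewrite /a -mulrA ler_wpM2l// addr_ge0.
  have h4 : lam * hnorm (G psi) ^+ 2 <= `|lam| * hnorm (G psi) ^+ 2.
    by rewrite ler_wpM2r ?sqr_ge0// ler_norm.
  lra.
have Yb psi : dom H psi -> hnorm (Y psi) <= K * hnorm psi.
  move=> h; rewrite leNgt; apply/negP => hK.
  have p0 := hnorm_ge0 psi; have t0 := hnorm_ge0 (Y psi).
  have h1 := formB (domG h); rewrite -/(Y psi) in h1.
  have h2 := ler_wpM2l C0 (key _ h).
  set t := hnorm (Y psi) in hK t0 h1 h2; set p := hnorm psi in hK p0 h2.
  have h3 : t ^+ 2 <= C * (a * p ^+ 2 + t * p) by exact: le_trans h1 h2.
  have K1 : 1 <= K by rewrite /K lerDr mulr_ge0// addr_ge0.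
  have pt : p <= t by apply: ltW; apply: le_lt_trans hK; rewrite ler_peMl.
  have tp : 0 < t by apply: le_lt_trans hK; rewrite mulr_ge0.
  have h4 : a * p ^+ 2 <= a * (t * p) by rewrite ler_wpM2l// expr2 ler_wpM2r.
  have h5 : C * (a * p ^+ 2 + t * p) <= C * ((a + 1) * (t * p)).
    by rewrite ler_wpM2l// mulrDl mul1r lerD2r.
  have h6 : t * t <= t * (C * (a + 1) * p).
    by rewrite -expr2; apply: (le_trans h3); apply: (le_trans h5); lra.
  rewrite ler_pM2l// in h6.
  by have := lt_le_trans hK h6; rewrite /K; lra.
exists K, (a + K); split=> //; first exact: addr_ge0.
move=> psi h; apply: (le_trans (key _ h)); rewrite mulrDl lerD2l expr2 mulrA.
by rewrite ler_wpM2r ?hnorm_ge0//; exact: Yb.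
Qed.

(* Closability identifies the limit of [Y] along an approximating sequence. *)
Let Y_approx psi : dom B (G psi) /\ exists w : nat -> F,
  [/\ forall k, dom H (w k), hcvg w psi & hcvg (Y \o w) (Y psi)].
Proof.
have [K [K' [K0 K0' hY hq]]] := Y_core.
have [g g0 hG] := creation_pair; have [lG _ bG _] := adjoint_pair_sym hG.
have GB x y : G (x - y) = G x - G y by exact: (adjoint_pairB _ _ (adjoint_pair_sym hG)).
have [w' [dw' hw']] := dense_seq dH psi.
have [M hM] := hw' 1 ltr01.
pose w k := w' (k + M)%N.
have dw k : dom H (w k) by exact: dw'.
have hw : hcvg w psi by exact: hcvg_shift.
have wb k : hnorm (w k) <= hnorm psi + 1.
  have := hM (k + M)%N (leq_addl _ _); rewrite -/(w k) => h1.
  have := ler_hnormD (w k - psi) psi; rewrite subrK; lra.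
have hGw : hcvg (G \o w) (G psi) by exact: hcvg_bnd bG hw.
have dG : dom B (G psi).
  apply: (domB (w := G \o w) (K := K' * (hnorm psi + 1) ^+ 2)) => // k /=.
    exact: domG.
  apply: (le_trans (hq _ (dw k))); rewrite ler_wpM2l//.
  by rewrite ler_pXn2r ?nnegrE ?addr_ge0 ?hnorm_ge0.
split=> //; exists w; split=> //.
have YB k n : Y (w k) - Y (w n) = Y (w k - w n).
  by rewrite /Y GB linear_opB//; apply: dB; exact: domG.
have cY : hcauchy (Y \o w).
  move=> e e0; have eK : 0 < e / 2 / (K + 1) by rewrite !divr_gt0// ltr_wpDl.
  have [M' hM'] := hw _ eK; exists M' => k n hk hn /=.
  rewrite YB; apply: (le_trans (hY _ (subspaceB (linear_op_dom lH) (dw k) (dw n)))).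
  have h1 := hM' _ hk; have h2 := hM' _ hn; rewrite hnorm_distC in h2.
  have h3 := ler_hnorm_dist (w k) psi (w n).
  have h4 : hnorm (w k - w n) <= e / (K + 1).
    have -> : e / (K + 1) = e / 2 / (K + 1) + e / 2 / (K + 1).
      by field; rewrite gt_eqF// ltr_wpDl.
    lra.
  apply: (le_trans (ler_wpM2l K0 h4)).
  rewrite mulrA ler_pdivrMr ?ltr_wpDl// mulrC ler_wpM2l ?(ltW e0)//; lra.
have [v hv] := hcauchy_cvg cY.
suff -> : Y psi = v by [].
apply/eqP; rewrite eq_sym -subr_eq0; apply/eqP.
apply: (clB (u := fun k => G (w k) - G psi)).
- by move=> k; apply: subspaceB (linear_op_dom lB) _ dG; apply: dB; exact: domG.
- by apply/hcvgP; rewrite -[0 : F](subrr (G psi)); apply: hcvgB => //; exact: hcvg_cst.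
- apply/hcvgP.
  have -> : (fun k => B (G (w k) - G psi)) = (fun k => Y (w k) - Y psi).
    by apply/funext => k; rewrite linear_opB//; apply: dB; exact: domG.
  by apply: hcvgB => //; exact: hcvg_cst.
Qed.

Lemma TRT_bounded : exists2 K : R, 0 <= K &
  forall psi, hnorm (TRT H lam%:C B psi) <= K * hnorm psi.
Proof.
have [K [K' [K0 K0' hY hq]]] := Y_core; exists K => // psi.
rewrite TRT_creation; have [_ [w [dw hw hYw]]] := Y_approx psi.
by apply: (hcvg_norm_le hYw hw) => // k; exact: hY.
Qed.

Lemma TRT_linear a x y :
  TRT H lam%:C B (a *: x + y) = a *: TRT H lam%:C B x + TRT H lam%:C B y.
Proof.
have [g g0 hG] := creation_pair; have [lG _ _ _] := adjoint_pair_sym hG.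
by rewrite !TRT_creation /Y lG linear_opP//; [have [] := Y_approx x|have [] := Y_approx y].
Qed.

Lemma TRT_sym x y : '[TRT H lam%:C B x, y] = '[x, TRT H lam%:C B y].
Proof.
rewrite !TRT_creation.
have core psi chi : dom H psi -> dom H chi -> '[Y psi, chi] = '[psi, Y chi].
  move=> h1 h2; have d1 := domG h1; have d2 := domG h2.
  rewrite /Y (adjP h2 (dB d1)) creation_resolvent// (resolvent_sym mH hR0).
  by rewrite -/R0 -creation_resolvent// adj_dot//; exact: dB.
(* Symmetry leaves [dom H] one argument at a time, along sequences on which [Y] converges too. *)
have half psi chi : dom H chi -> '[Y psi, chi] = '[psi, Y chi].
  move=> h; have [_ [w [dw hw hYw]]] := Y_approx psi.
  by apply: (hcvg_dot_eq hYw hw) => k; exact: core.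
have [_ [w [dw hw hYw]]] := Y_approx x.
apply: (hcvg_dot_eq hYw hw) => k /=.
by rewrite dotC -half// -dotC.
Qed.

Let HB := addop H (addop (adj B) B).

Let dHB : dom HB = dom H.
Proof.
apply/seteqP; split => x /=; first by case.
by move=> h; split=> //; split; [exact: dadj|exact: dB].
Qed.

(** Serves both for [H_n - E_n] and for K_n = H_n - A_n R A_n^*, since each subtracts a bounded
    symmetric operator. *)
Lemma perturbed_bounded_maxsym Z (Zf : F -> F) (k : R) :
  dom Z = setT -> (forall x, Z x = Zf x) ->
  (forall a x y, Zf (a *: x + y) = a *: Zf x + Zf y) ->
  (forall x y, '[Zf x, y] = '[x, Zf y]) ->
  (forall x, hnorm (Zf x) <= k * hnorm x) -> maximal_symmetric (subop HB Z).
Proof.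
move=> dZ eZ lZ sZ bZ.
have [a [b [a01 [_ hab]]]] := smallB.
pose V psi := adj B psi + B psi - Zf psi.
apply: (@maxsym_ext _ _ (Operator (dom H) (fun psi => H psi + V psi))).
- by rewrite /= dZ setIT; exact: esym dHB.
- by move=> psi _ /=; rewrite eZ /V addrA.
apply: (@kato_rellich _ _ _ V a (b + k)) => //.
- move=> d x y hx hy; rewrite /V adj_linear// lZ linear_opP//; try exact: dB.
  by vector_ring.
- move=> x y hx hy; rewrite /V !dotBl !dotBr !dotDl !dotDr sZ; congr (_ - _).
  rewrite adj_dot//; last exact: dB.
  by rewrite (adjP hy (dB hx)) addrC.
- move=> x hx; apply: (le_trans (ler_hnormB _ _)); rewrite mulrDl addrA.
  by apply: lerD => //; exact: hab.
Qed.

(** [G] maps [dom H] into itself here, because it is the resolvent after [adj B] there. This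
    separates the regularized operators from the limit and lets the products be expanded. *)
Lemma sum_Kop psi : dom H psi ->
  dom (Kop H lam W G) psi /\ subop HB (TRT H lam%:C B) psi = Kop H lam W G psi.
Proof.
move=> h; have dG := domG h.
have d0 : dom H (psi - G psi) by exact: subspaceB (linear_op_dom lH) h dG.
split=> //; rewrite /subop /= resolvent_ext_creation.
have eH : H (psi - G psi) = H psi - lam%:C *: G psi + adj B psi.
  by rewrite linear_opB// H_creation//; vector_ring.
have eW : W (- H (psi - G psi) + lam%:C *: (psi - G psi)) = B psi - Y psi.
  have := resolvent_shift hR0 d0 => /= e.
  by rewrite /W /= e linear_opB//; exact: dB.
by rewrite eW eH /Y; vector_ring.
Qed.

Lemma sum_dom : dom (subop HB (TRT H lam%:C B)) = dom H.
Proof. by rewrite /= setIT; exact: dHB. Qed.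

End OneOperator.
End CreationAnnihilation.

(** * The limit operator *)

Section LimitOperator.
Context {R : realType} {F : hilbertType R}.
Variables (H S A : operator F) (lam s c : R).
Hypotheses (saH : self_adjoint H) (hlam : resolvent_set H lam%:C).
Hypotheses (symS : symmetric_op S) (dS : dom H `<=` dom S).
Hypotheses (dA : dom A = dom H) (bA : bounded_on_Hs H s A).

Let mH : maximal_symmetric H := self_adjoint_maxsym saH.
Let R0 := resolvent H lam%:C.
Let hR0 : is_resolvent H lam%:C R0 := resolventP hlam.
Let W := A \o R0.
Let G : F -> F := G_op H A lam%:C.

Hypothesis hW : adjoint_pair W G c.

(** The weak form of (lam - H) G = A^*, tested on [dom H]. *)
Let GL psi phi : dom H phi ->
  '[G psi, H phi] = lam%:C * '[G psi, phi] - '[psi, A phi].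
Proof.
move=> dphi; have [_ _ _ aG] := adjoint_pair_sym hW.
have := aG psi (shift H lam%:C phi).
rewrite /W /= -/(shift H lam%:C phi).
have -> : R0 (- H phi + lam%:C *: phi) = phi by exact: resolvent_shift hR0 _ dphi.
rewrite dotDr dotNr dotZr conjc_real => <-; ring.
Qed.

Lemma T_opE psi : T_op H S A lam psi =
  S (psi - G psi) - W (S (psi - G psi)).
Proof.
rewrite -[LHS]/(S (psi - G psi) - adj (G_op H A lam%:C) (S (psi - G psi))).
by rewrite (adj_G_op _ hW).
Qed.

Lemma T_op_linear : linear_on (D_op H A lam) (T_op H S A lam).
Proof.
move=> a x y hx hy; have [lW _ _ _] := hW; have [lG _ _ _] := adjoint_pair_sym hW.
rewrite !T_opE.
have -> : a *: x + y - G (a *: x + y) = a *: (x - G x) + (y - G y).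
  by rewrite lG; vector_ring.
by rewrite (linear_opP _ symS.1 (dS hx) (dS hy)) lW; vector_ring.
Qed.

Lemma T_op_sym psi phi : D_op H A lam psi -> D_op H A lam phi ->
  '[T_op H S A lam psi, phi] = '[psi, T_op H S A lam phi].
Proof.
move=> h1 h2; have [_ _ _ aW] := hW; have [_ _ _ aG] := adjoint_pair_sym hW.
rewrite !T_opE dotBl dotBr aW -aG -dotBl -dotBr.
exact: symS.2 (dS h1) (dS h2).
Qed.

Let A0 : (forall t psi, Hs_sqnorm H t psi = 0%E) -> forall psi, dom H psi -> A psi = 0.
Proof.
move=> h psi dpsi; have [T [_ _ eT [C hC]]] := bA.
have hs : Hs H s psi by rewrite /Hs /= h.
apply: hnorm_eq0; apply/eqP; rewrite eq_le hnorm_ge0 andbT -eT ?dA//.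
by apply: (le_trans (hC _ hs)); rewrite /Hs_norm h sqrtr0 mulr0.
Qed.

Lemma HS_opE psi : D_op H A lam psi ->
  HS_op H S A lam psi = Kop H lam W G psi - T_op H S A lam psi.
Proof.
move=> dpsi; have [_ dH _ _] := saH.
rewrite /HS_op /=; congr (_ - _).
(* In the degenerate case [A] vanishes on [dom H], so [G = 0] and [psi] itself lies in [dom H]. *)
have hb : dom H psi \/ forall phi, dom H phi -> hnorm (H phi) <= Hs_norm H 1 phi.
  have [h|h] := Hs_norm1_sq H.
    right => phi dphi; rewrite h// -[leLHS]ger0_norm ?hnorm_ge0// -sqrtr_sqr.
    by rewrite ler_sqrt ?addr_ge0 ?sqr_ge0// lerDl sqr_ge0.
  left; suff -> : psi = psi - G psi by [].
  suff -> : G psi = 0 by rewrite subr0.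
  have [_ _ _ aW] := hW; apply: dot_eqr => v.
  by rewrite -aW /W /= A0 ?dot0l ?dot0r//; exact: resolvent_dom hR0 _.
(* The singular parts of H psi and A^* psi cancel by [GL], and what remains is this vector of
   [F]. *)
pose u0 := H (psi - G psi) + lam%:C *: G psi.
pose P := [set u | forall phi, dom H phi ->
   emb u phi = Hbar H psi phi + dual_adj A psi phi].
have Pu0 : P u0.
  move=> phi dphi; rewrite (Hbar_dot saH hb dphi) /emb /dual_adj /u0.
  rewrite dotDl dotZl (mH.1.2 _ _ dpsi dphi) dotBl GL//; ring.
have -> : unemb H (fun phi => Hbar H psi phi + dual_adj A psi phi) = u0.
  have hP : P (unemb H (fun phi => Hbar H psi phi + dual_adj A psi phi)).
    by apply: (@xgetPex _ 0 P); exists u0.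
  apply/eqP; rewrite -subr_eq0; apply/eqP; apply: (dense_orth dH) => v dv.
  rewrite dotC dotBl; have := Pu0 _ dv; rewrite -(hP _ dv) /emb => ->.
  by rewrite subrr conjc0.
have eW : W (- H (psi - G psi) + lam%:C *: (psi - G psi)) = A (psi - G psi).
  by have := resolvent_shift hR0 dpsi => /= e; rewrite /W /= e.
rewrite -/G eW /u0; vector_ring.
Qed.

End LimitOperator.

(** * Norm resolvent convergence of H_n - E_n to H_S *)

Theorem theorem4p2 (R : realType) (F : hilbertType R) (H S A : operator F)
    (s lam : R) (An : nat -> operator F) (E : nat -> operator F) :
  self_adjoint H -> bounded_below H ->
  symmetric_op S -> small S H ->
  linear_op A -> dom A = dom H ->
  0 < s < 1 -> bounded_on_Hs H s A ->
  (forall z : R[i], resolvent_set H z ->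
    range (G_op H A z) `&` dom H = [set 0]) ->
  (lam%:E < inf_spectrum H)%E ->
  (forall n, [/\ linear_op (An n), closable (An n),
      Hs H 2^-1 `<=` dom (An n), bounded_on_Hs H 2^-1 (An n) &
      small (addop (adj (An n)) (An n)) H]) ->
  let Hn n := addop H (addop (adj (An n)) (An n)) in
  let AnRAn n := TRT H lam%:C (An n) in
  let TS := T_op H S A lam in
  opnorm (dom H) (Hs_norm H 1) (fun psi => An n psi - A psi)
    @[n --> \oo] --> 0%E ->
  (forall n, bounded_op (E n) /\ symmetric_op (E n)) ->
  uniformly_small (fun n => subop (E n) (AnRAn n))
                  (fun n => subop (Hn n) (AnRAn n)) ->
  ereal_sup [set (hnorm (E n psi - AnRAn n psi - TS psi))%:E | psi in
      [set psi | D_op H A lam psi /\ hnorm (TS psi) ^+ 2 + hnorm psi ^+ 2 <= 1]]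
    @[n --> \oo] --> 0%E ->
  norm_resolvent_cvg (fun n => subop (Hn n) (E n)) (HS_op H S A lam).
Proof.
move=> saH bH symS smallS lA dA s01 bA _ hlam' hAn Hn AnRAn TS cvA hE hunif cvT.
have mH := self_adjoint_maxsym saH.
have hlam := below_spectrum_resolvent hlam'.
have hR0 := resolventP hlam.
pose R0 := resolvent H lam%:C.
have dS : dom H `<=` dom S by have [a [b [_ []]]] := smallS.
have lAn n : linear_op (An n) by have [] := hAn n.
have dAn n : dom H `<=` dom (An n).
  by have [_ _ h _ _] := hAn n => psi /(dom_Hs_half bH)/h.
have dE n : dom (E n) = setT by have [[_ ? _] _] := hE n.
have lE n a x y : E n (a *: x + y) = a *: E n x + E n y.
  have [[[_ h] d _] _] := hE n; rewrite d in h.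
  by have [] := h a x y I I.
have symE n x y : '[E n x, y] = '[x, E n y].
  by have [_ [_ h]] := hE n; rewrite dE in h; exact: h.
have bE n : exists k : R, forall x, hnorm (E n x) <= k * hnorm x.
  by have [[_ _ h] _] := hE n.
(* Facts for a single [n], with constants that may depend on it; uniformity enters afterwards. *)
have pkg n : [/\ maximal_symmetric (subop (Hn n) (E n)),
    maximal_symmetric (subop (Hn n) (AnRAn n)),
    dom (Hn n) = dom H,
    (forall psi, dom H psi ->
      dom (Kop H lam (An n \o R0) (G_op H (An n) lam%:C)) psi /\
      subop (Hn n) (AnRAn n) psi = Kop H lam (An n \o R0) (G_op H (An n) lam%:C) psi) &
    [/\ forall a x y, AnRAn n (a *: x + y) = a *: AnRAn n x + AnRAn n y,
       forall x y, '[AnRAn n x, y] = '[x, AnRAn n y] &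
       exists k : R, forall x, hnorm (AnRAn n x) <= k * hnorm x]].
  have [lB clB sB bB smB] := hAn n.
  have [C [c [C0 c0 formB domB]]] := Hs_half_form bH bB sB.
  have [N N0 boundB] := Hs_half_bound1 bH bB sB.
  have [kE hkE] := bE n.
  have lY := TRT_linear saH hlam lB clB (dAn n) C0 c0 N0 formB domB boundB smB.
  have sY := TRT_sym saH hlam lB clB (dAn n) C0 c0 N0 formB domB boundB smB.
  have [k k0 bY] := TRT_bounded saH hlam lB clB (dAn n) C0 c0 N0 formB domB boundB smB.
  split.
  - exact: (perturbed_bounded_maxsym saH lB (dAn n) smB (dE n) (fun=> erefl)
      (lE n) (symE n) hkE).
  - exact: (perturbed_bounded_maxsym (Z := AnRAn n) saH lB (dAn n) smB erefl
      (fun=> erefl) lY sY bY).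
  - by have := sum_dom lam (dAn n) smB; rewrite /= setIT.
  - move=> psi h; exact: (sum_Kop saH hlam lB (dAn n) N0 boundB smB h).
  - by split=> //; exists k.
have cvA' := Hs_cvg_eventually saH lA dA lAn dAn cvA.
(* A quarter for [A] and a quarter for [A_n - A] from [n0] on make the relative bound 1/2 that
   [Kop_apriori] absorbs. Indices are therefore shifted by [n0] below. *)
have q0 : 0 < 4^-1 :> R by rewrite invr_gt0.
have [CA CA0 hCA] := Hs_bounded_small dA s01 bA q0.
have [n0 hn0] := cvA' _ q0.
have [r r0 hr] := resolvent_bounded hR0.
have [kg kg0 hkg] := resolvent_graph_bound hlam.
(* [b0] serves [A] and the [A_n] alike. [C] is what [small_pair_bound] gives for 1/2 and [b0], and
   [c] bounds [W] and the [W_n] because ||R0 h|| <= r ||h||. *)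
pose b0 := CA + 4^-1.
pose C := 2^-1 * `|lam| + b0.
pose c := 2^-1 + C * r.
have h20 : 0 <= 2^-1 :> R by rewrite invr_ge0.
have b00 : 0 <= b0 by rewrite addr_ge0// ltW.
have C0 : 0 <= C by rewrite addr_ge0// mulr_ge0.
have c0 : 0 <= c by rewrite addr_ge0// mulr_ge0.
have smA psi : dom H psi -> hnorm (A psi) <= 2^-1 * hnorm (H psi) + b0 * hnorm psi.
  move=> h; have := hCA _ h; have := hnorm_ge0 (H psi); have := hnorm_ge0 psi.
  rewrite /b0; lra.
have smAn n psi : (n0 <= n)%N -> dom H psi ->
    hnorm (An n psi) <= 2^-1 * hnorm (H psi) + b0 * hnorm psi.
  move=> hn h; have := hn0 _ hn _ h; have := hCA _ h.
  have := ler_hnormD (An n psi - A psi) (A psi); rewrite subrK /b0; lra.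
have bndc (T : F -> F) : (forall h, hnorm (T h) <= 2^-1 * hnorm h + C * hnorm (R0 h)) ->
    forall h, hnorm (T h) <= c * hnorm h.
  move=> hT h; apply: (le_trans (hT h)); rewrite /c [leRHS]mulrDl lerD2l -mulrA.
  by rewrite ler_wpM2l.
have wA h : hnorm (A (R0 h)) <= 2^-1 * hnorm h + C * hnorm (R0 h).
  exact: (small_pair_bound hlam h20 b00 smA).
have wAn k h : hnorm (An (k + n0)%N (R0 h)) <= 2^-1 * hnorm h + C * hnorm (R0 h).
  apply: (small_pair_bound hlam h20 b00) => psi dpsi.
  by apply: smAn => //; exact: leq_addl.
have hW : adjoint_pair (A \o R0) (G_op H A lam%:C) c.
  by apply: G_op_pair => //; [rewrite dA|exact: bndc].
have hWn k : adjoint_pair (An (k + n0)%N \o R0) (G_op H (An (k + n0)%N) lam%:C) c.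
  by apply: G_op_pair => //; apply: (bndc (fun h => An (k + n0)%N (R0 h))); exact: wAn.
pose K := Kop H lam (A \o R0) (G_op H A lam%:C).
pose Kn k := subop (Hn (k + n0)%N) (AnRAn (k + n0)%N).
have mKn k : maximal_symmetric (Kn k) by have [] := pkg (k + n0)%N.
have dKn k : dom (Kn k) = dom H by have [_ _ h _ _] := pkg (k + n0)%N; rewrite /= setIT.
have KnE k psi : dom H psi ->
    dom (Kop H lam (An (k + n0)%N \o R0) (G_op H (An (k + n0)%N) lam%:C)) psi /\
    Kn k psi = Kop H lam (An (k + n0)%N \o R0) (G_op H (An (k + n0)%N) lam%:C) psi.
  by have [_ _ _ h _] := pkg (k + n0)%N; exact: h.
have sK : symmetric_op K := Kop_sym lam mH hW.
have cvW : forall e : R, 0 < e -> exists N, forall n, (N <= n)%N -> forall x,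
    hnorm ((An (n + n0)%N \o R0) x - (A \o R0) x) <= e * hnorm x.
  move=> e e0; have ek : 0 < e / (kg + 1) by rewrite divr_gt0// ltr_wpDl.
  have [N hN] := cvA' _ ek; exists N => n hn x /=.
  apply: (le_trans (hN _ (leq_trans hn (leq_addr _ _)) _ (resolvent_dom hR0 x))).
  apply: (le_trans (ler_wpM2l (ltW ek) (hkg x).2)).
  rewrite mulrA ler_wpM2r ?hnorm_ge0// mulrAC ler_pdivrMr ?ltr_wpDl//.
  by rewrite ler_wpM2l ?(ltW e0)// lerDl.
(* This [Kop] extends [Kn k], whose shift is already surjective. *)
have surjn k z : complex.Im z != 0 ->
    surjective_op (shift (Kop H lam (An (k + n0)%N \o R0) (G_op H (An (k + n0)%N) lam%:C)) z).
  move=> z0 f; have [psi dpsi <-] := maxsym_surj (mKn k) z0 f.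
  rewrite /= -/(Kn k) in dpsi *; have dpsi' : dom H psi by rewrite -(dKn k).
  have [d e] := KnE k _ dpsi'; exists psi => //.
  by rewrite /shift /= in e *; rewrite -e.
have surjK z : complex.Im z != 0 -> surjective_op (shift K z).
  move=> z0.
  have z0' : complex.Im z^*%C != 0 by rewrite Im_conjc oppr_eq0.
  apply: (Kop_surj_lim mH hR0 hWn hW C0 wAn cvW z0) => k; exact: surjn.
have cvK z : complex.Im z != 0 -> forall e : R, 0 < e ->
    exists N, forall n, (N <= n)%N -> forall psi phi, dom K psi -> dom (Kn n) phi ->
    shift (Kn n) z phi = shift K z psi -> hnorm (phi - psi) <= e * hnorm (shift K z psi).
  move=> z0 e e0.
  have z0' : complex.Im z^*%C != 0 by rewrite Im_conjc oppr_eq0.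
  pose k := 4 * (1 + (cabs (z - lam%:C) + C * (1 + c)) / `|complex.Im z|) / `|complex.Im z|.
  have k0 : 0 <= k.
    rewrite /k divr_ge0// mulr_ge0// addr_ge0// divr_ge0//.
    by rewrite addr_ge0 ?cabs_ge0// mulr_ge0// addr_ge0.
  have ek : 0 < e / (k + 1) by rewrite divr_gt0// ltr_wpDl.
  have [N hN] := cvW _ ek; exists N => n hn psi phi dpsi dphi eq.
  have dphi' : dom H phi by rewrite -(dKn n).
  have [d eK] := KnE n _ dphi'.
  have eq' : shift (Kop H lam (An (n + n0)%N \o R0) (G_op H (An (n + n0)%N) lam%:C)) z phi =
     shift K z psi by rewrite -eq /shift /= in eK *; rewrite -eK.
  have := Kop_dist mH hR0 (hWn n) hW C0 (ltW ek) (wAn n) wA (hN _ hn) z0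
    (surjK _ z0') d dpsi eq'.
  rewrite eq' -/k => h; apply: (le_trans h); rewrite ler_wpM2r ?hnorm_ge0//.
  by rewrite mulrAC ler_pdivrMr ?ltr_wpDl// ler_wpM2l ?(ltW e0)// lerDl.
(* With these signs H_n - E_n = K_n + V_n and H_S = K + V. *)
pose V psi := - TS psi.
pose Vn k psi := - (E (k + n0)%N psi - AnRAn (k + n0)%N psi).
have lTS := T_op_linear symS dS hW.
have lV : linear_on (dom K) V.
  by move=> a x y hx hy; rewrite /V lTS//; vector_ring.
have sV psi phi : dom K psi -> dom K phi -> '[V psi, phi] = '[psi, V phi].
  by move=> h1 h2; rewrite /V dotNl dotNr (T_op_sym symS dS hW h1 h2).
have lVn k : linear_on setT (Vn k).
  have [_ _ _ _ [lY _ _]] := pkg (k + n0)%N.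
  by move=> a x y _ _; rewrite /Vn lE lY; vector_ring.
have bVn k : exists d : R, forall x, hnorm (Vn k x) <= d * hnorm x.
  have [_ _ _ _ [_ _ [d2 h2]]] := pkg (k + n0)%N; have [d1 h1] := bE (k + n0)%N.
  exists (d1 + d2) => x; rewrite /Vn hnormN mulrDl.
  exact: le_trans (ler_hnormB _ _) (lerD (h1 x) (h2 x)).
have sVn k x y : '[Vn k x, y] = '[x, Vn k y].
  have [_ _ _ _ [_ sY _]] := pkg (k + n0)%N.
  by rewrite /Vn dotNl dotNr dotBl dotBr symE sY.
have [a [b [a01 hsm]]] := hunif.
have smallVn k psi : dom (Kn k) psi ->
    hnorm (Vn k psi) <= a * hnorm (Kn k psi) + b * hnorm psi.
  by move=> h; rewrite /Vn hnormN; have [_ h2] := hsm (k + n0)%N; exact: h2.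
have cvV : unif_cvg (dom K) Vn V (fun x => hnorm (V x) + hnorm x).
  move=> e e0; have [N hN] := ereal_cvg0 cvT e0; exists N => k hk psi dpsi.
  have {}hN := hN _ (leq_trans hk (leq_addr n0 k)).
  have [_ _ _ _ [lY _ _]] := pkg (k + n0)%N.
  have TSZ t phi : dom K phi -> TS (t *: phi) = t *: TS phi.
    move=> dphi; have TS0 : TS 0 = 0.
      have := lTS 1 0 0 sK.1.1 sK.1.1; rewrite !scale1r addr0 -/TS.
      by rewrite -{1}[TS 0]addr0 => /addrI <-.
    by rewrite -[t *: phi]addr0 lTS ?TS0 ?addr0//; exact: sK.1.1.
  have lin0 (T : F -> F) : (forall d x y, T (d *: x + y) = d *: T x + T y) ->
      forall d x, T (d *: x) = d *: T x.
    move=> lT d x; have T0 : T 0 = 0.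
      by have := lT 1 0 0; rewrite !scale1r addr0 -{1}[T 0]addr0 => /addrI <-.
    by rewrite -[d *: x]addr0 lT T0 addr0.
  rewrite /V hnormN.
  have -> : Vn k psi - - TS psi = - (E (k + n0)%N psi - AnRAn (k + n0)%N psi - TS psi).
    by rewrite /Vn; vector_ring.
  rewrite hnormN.
  (* The sum of the two norms is homogeneous, and where it is at most 1 so is the sum of squares in
     the hypothesis. *)
  apply: (unit_ball_bound (N := fun x => hnorm (TS x) + hnorm x) (ltW e0)
    (linear_op_dom sK.1) _ _ _ hN) => //.
  - by move=> t phi h; rewrite (lin0 _ (lE _)) (lin0 _ lY) TSZ// !scalerBr.
  - move=> t phi h t0 h1; rewrite TSZ// !hnormZ cabsR gtr0_norm//.
    have p1 := hnorm_ge0 (TS phi); have p2 := hnorm_ge0 phi.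
    have p3 : 0 <= t * hnorm (TS phi) by rewrite mulr_ge0// ltW.
    have p4 : 0 <= t * hnorm phi by rewrite mulr_ge0// ltW.
    rewrite mulrDr in h1; nra.
  - by move=> phi _; rewrite addr_ge0 ?hnorm_ge0.
have mKV := limit_maxsym sK mKn surjK cvK lV sV sVn a01 smallVn cvV.
have HSE psi : dom K psi -> K psi + V psi = HS_op H S A lam psi.
  by move=> h; rewrite (HS_opE S saH hlam dA bA hW h).
have mHS : maximal_symmetric (HS_op H S A lam).
  by apply: maxsym_ext mKV => // psi h; exact: HSE.
move=> z z0; split.
- exact: maxsym_resolvent mHS z0.
- by move=> n; have [m _ _ _ _] := pkg n; exact: maxsym_resolvent m z0.
apply: cvg0_ereal => [n|e e0].
  apply: (@le_trans _ _ (hnorm ((resolvent (subop (Hn n) (E n)) z \-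
    resolvent (HS_op H S A lam) z) 0))%:E); first by rewrite lee_fin hnorm_ge0.
  by apply: ereal_sup_ubound; exists 0 => //; split=> //; rewrite hnorm0 ler01.
have [N hN] := perturbed_cvg sK mKn surjK cvK lV sV lVn bVn sVn a01 smallVn cvV z0 e0.
exists (N + n0)%N => n hn.
have en : n = ((n - n0) + n0)%N by rewrite subnK// (leq_trans (leq_addl N n0) hn).
have hk : (N <= n - n0)%N by rewrite leq_subRL ?(leq_trans (leq_addl N n0) hn)// addnC.
apply: ge_ereal_sup => _ [f [_ hf] <-]; rewrite lee_fin /=.
have e1 : resolvent (HS_op H S A lam) z =
    resolvent (Operator (dom K) (fun psi => K psi + V psi)) z.
  by apply/esym/resolvent_eq => // psi h; exact: HSE.
have e2 : resolvent (subop (Hn n) (E n)) z = resolvent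
    (Operator (dom (Kn (n - n0)%N)) (fun psi => Kn (n - n0)%N psi + Vn (n - n0)%N psi)) z.
  apply: resolvent_eq; first by rewrite /Kn -en /= dE.
  by move=> psi _; rewrite /Kn /Vn -en /=; vector_ring.
rewrite e1 e2; apply: (le_trans (hN _ hk f I)).
by rewrite ler_piMr ?(ltW e0).
Qed.
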